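(* Let $f\colon\mathbb R\to\mathbb R$ satisfy conditions (i) and (ii) of the context with some $\varepsilon_\infty>0$. Let $0<\varepsilon<\varepsilon_\infty$ and let $\Gamma(\varepsilon)$ be a graph admissible for $\varepsilon$ and $f$. Then the Bellman candidate $B$ generated by $\Gamma(\varepsilon)$ admits an optimizer at every point of $\Omega_\varepsilon$.
   Context: Conditions on $f$: (i) $f\in C^2(\mathbb R)$, and $f''$ is piecewise monotone with only finitely many monotonicity intervals; (ii) $\int_{\mathbb R}e^{-|t|/\varepsilon_\infty}\,df''(t)$ is absolutely convergent. **Optimizers.** $\langle\varphi\rangle_J=\frac1{|J|}\int_J\varphi$; $\mathrm{BMO}_\varepsilon(I)$ is the set of functions $\varphi$ on an interval $I$ with $\sup_{J\subset I}\langle|\varphi-\langle\varphi\rangle_J|^2\rangle_J\le\varepsilon^2$ (supremum over subintervals). A function $\varphi\in\mathrm{BMO}_\varepsilon(I)$, for some interval $I$, is an optimizer for $B$ at $x\in\Omega_\varepsilon$ if $(\langle\varphi\rangle_I,\langle\varphi^2\rangle_I)=x$ and $\langle f(\varphi)\rangle_I=B(x)$. **Notation.** $\Omega_\varepsilon=\{x\in\mathbb R^2: x_1^2\le x_2\le x_1^2+\varepsilon^2\}$; its lower boundary parabola is the fixed boundary, the upper one is the free boundary. A capital letter $P$ denotes the point $(p,p^2)$. A pair $a<b$ satisfies the cup equation if $\langle f'\rangle_{[a,b]}=\frac{f'(a)+f'(b)}2$; its differentials are $D_L(a,b)=f''(a)-\langle f''\rangle_{[a,b]}$ and $D_R(a,b)=f''(b)-\langle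 f''\rangle_{[a,b]}$. The right (left) tangent at $u\in\mathbb R$ is the segment joining $(u,u^2)$ to $(u-\varepsilon,(u-\varepsilon)^2+\varepsilon^2)$ (respectively to $(u+\varepsilon,(u+\varepsilon)^2+\varepsilon^2)$). **Figures and their standard candidates.** (1) *Tangent domains.* For $-\infty\le u_1<u_2\le+\infty$, the right tangent domain $\Omega_R(u_1,u_2)$ (left tangent domain $\Omega_L(u_1,u_2)$) is the union of the right (left) tangents at all real $u\in[u_1,u_2]$. A standard candidate on it is $B(x)=m(u)(x_1-u)+f(u)$ for $x$ on the tangent at $u$, where in the right case $\varepsilon m'+m=f'$ and $m''<0$ on $(u_1,u_2)$, and, if $u_1=-\infty$, $m(u)=\varepsilon^{-1}e^{-u/\varepsilon}\int_{-\infty}^uf'(t)e^{t/\varepsilon}dt$; in the left case $-\varepsilon m'+m=f'$ and $m''>0$ on $(u_1,u_2)$, and, if $u_2=+\infty$, $m(u)=\varepsilon^{-1}e^{u/\varepsilon}\int_u^{+\infty}f'(t)e^{-t/\varepsilon}dt$. (2) *Chordal domains.* For $a_0<a_1\le b_1<b_0$, $b_0-a_0\le2\varepsilon$, a chordal domain $\Omega_{ch}([a_0,b_0],[a_1,b_1])$ is given by continuous functions $a,b$ on $[b_1-a_1,b_0-a_0]$, differentiable in the interior, with $b(l)-a(l)=l$, $a'<0$, $b'>0$, $a(b_j-a_j)=a_j$, $b(b_j-a_j)=b_j$ ($j=0,1$), each pair $(a(l),b(l))$, $l>0$, satisfying the cup equation, and $D_L(a(l),b(l))<0$, $D_R(a(l),b(l))<0$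 for $l$ in the open interval; the domain is the union of the chords $[A(l),B(l)]$. The standard candidate is linear on each of these chords and equals $f(t)$ at points $(t,t^2)$. The domain is full if $b_0-a_0=2\varepsilon$; it is a cup with origin $a_1$ if $a_1=b_1$. (3) *Linearity domains.* These are built over disjoint closed intervals $\mathfrak a_i=[\mathfrak a_i^l,\mathfrak a_i^r]$, $i=1,\dots,k$ (possibly single points), ordered from left to right, with $0<\mathfrak a_{i+1}^l-\mathfrak a_i^r\le2\varepsilon$. Such a domain is bounded by the arcs $\{(t,t^2):t\in\mathfrak a_i\}$, the chords joining the points of the fixed boundary over $\mathfrak a_i^r$ and $\mathfrak a_{i+1}^l$, and further: – right multitrolleybus: the right tangents at $\mathfrak a_1^l$ and $\mathfrak a_k^r$ and the free boundary arc between them ($\mathfrak a_k$ may be a ray, then the second tangent is absent); – left multitrolleybus: the left tangents at $\mathfrak a_1^l$ and $\mathfrak a_k^r$ and the free boundary arc between them ($\mathfrak a_1$ may be a ray, then the first tangent is absent); – multicup (requires $\mathfrak a_k^r-\mathfrak a_1^l\ge2\varepsilon$): the left tangent at $\mathfrak a_1^l$, the right tangent at $\mathfrak a_k^r$ and the free boundary arc between them ($\mathfrak a_1$, $\mathfrak a_k$ may be infinite, then the corresponding tangent is absent); it is full if $\mathfrak a_k^r-\mathfrak a_1^l=2\varepsilon$; – multibirdie: the right tangent at $\mathfrak a_1^l$, the left tangent at $\mathfrak a_k^r$ and the free boundary arc between them; – closed multicup (requires $\mathfrak a_k^r-\mathfrak a_1^l<2\varepsilon$): the chord joining the points over $\mathfrak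 a_1^l$ and $\mathfrak a_k^r$. For $k=2$ and both $\mathfrak a_i$ single points, a multitrolleybus is called a trolleybus and a multibirdie a birdie. The angle $\Omega_{ang}(w)$ is the linearity domain bounded by the right and left tangents at $w$ and the free boundary arc between them. The standard candidate on a linearity domain with at least two points on the fixed boundary is $B(x)=\beta_0+\beta_1x_1+\beta_2x_2$, where $f(t)=\beta_0+\beta_1t+\beta_2t^2$ and $f'(t)=\beta_1+2\beta_2t$ for all $t\in\bigcup_i\mathfrak a_i$ (such $\beta$'s exist iff all points $(t,f'(t))$, $t\in\bigcup_i\mathfrak a_i$, lie on one line and all pairs of points of $\bigcup_i\mathfrak a_i$ satisfy the cup equation; this is part of the requirement). On an angle a standard candidate is any function of this form with the two relations required only at $t=w$ (so $\beta_2$ is free). **Foliation graphs.** A foliation graph is a finite oriented tree (a tree when orientation is disregarded) describing a covering of $\Omega_\varepsilon$ by finitely many figures with disjoint interiors. The edges are the tangent domains and chordal domains; $\Omega_R$ is oriented from its left neighbour to its right neighbour, $\Omega_L$ from its right neighbour to its left neighbour, a chordal domain from its upper neighbour to its lower one. The vertices are the linearity domains and fictitious vertices of five types: (I) a long chord $[A,B]$, $b-a=2\varepsilon$, with $D_L(a,b)\ne0\ne D_R(a,b)$, the upper chord of a full chordal domain, with a left tangent domain $\Omega_L(u_1,a)$ and a right tangent domain $\Omega_R(b,u_2)$ attached; (II) the origin of a cup; (III) a chord separating two chordal domains, or a long chord as in (I) at which one or both differentials vanish; (IV) $-\infty$ or $+\infty$, when a tangent domain lasts to the corresponding infinity; (V)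 a single right (or left) tangent at a point $w$ separating two right (respectively left) tangent domains; its standard candidate is the restriction to this tangent of $\beta_0+\beta_1x_1+\beta_2x_2$ with $\beta_2=\frac12f''(w)$, $\beta_1=f'(w)-2\beta_2w$, $\beta_0=f(w)-wf'(w)+\beta_2w^2$. A vertex is incident to an edge iff the corresponding figures are adjacent. **Admissibility.** A foliation graph is admissible for $f$ and $\varepsilon$ if all its figures satisfy their local requirements and gluing conditions, i.e. there is a continuous function $B$ on $\Omega_\varepsilon$ whose restriction to the figure of every vertex and every edge is a standard candidate there. This $B$ is the function (Bellman candidate) generated by the graph. *)

(* Defs.v *)
From HB Require Import structures.
From mathcomp Require Export all_boot all_order all_algebra.
From mathcomp Require Export all_classical all_reals all_analysis.

Set Implicit Arguments.
Unset Strict Implicit.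
Unset Printing Implicit Defensive.

Export Order.TTheory GRing.Theory Num.Theory.
Export numFieldNormedType.Exports.

Local Open Scope ring_scope.
Local Open Scope classical_set_scope.

Local Notation "f ^` ()" := (derive1 f) : ring_scope.
Local Notation "f ^` ( n )" := (derive1n n f) : ring_scope.

Section Conditions.
Context {R : realType}.
Implicit Types (f g : R -> R) (s : seq R).

Definition C2 f : Prop :=
  [/\ forall x, derivable f x 1, forall x, derivable f^`() x 1
    & continuous f^`(2)].

Definition monotone_on (D : set R) g : Prop :=
  (forall x y, D x -> D y -> x <= y -> g x <= g y) \/
  (forall x y, D x -> D y -> x <= y -> g y <= g x).

Definition piecewise_monotone g : Prop :=
  exists2 s, sorted <%R s &
    let c := -oo%E :: rcons [seq t%:E | t <- s] +oo%E in
    forall i, (i <= size s)%N ->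
      monotone_on [set t : R | (nth -oo c i <= t%:E <= nth -oo c i.+1)%E] g.

(* Absolute convergence of the integral of e^{-|t|/e} against dg, i.e.
   integrability against the variation measure |dg|; the function V is the
   primitive of |dg|, so |dg| is the Lebesgue-Stieltjes measure of V. *)
Definition abs_conv_exp_d (e : R) g : Prop :=
  exists2 V : cumulative R R,
    forall a b : R, a <= b -> total_variation a b g = (V b - V a)%:E &
    (lebesgue_stieltjes_measure V).-integrable setT
      (fun t : R => (expR (- `|t| / e))%:E).

Definition regularity_condition f : Prop := C2 f /\ piecewise_monotone f^`(2).
Definition summability_condition (epsoo : R) f : Prop := abs_conv_exp_d epsoo f^`(2).

End Conditions.

Section Optimizers.
Context {R : realType}.
Local Notation mu := (@lebesgue_measure R).
Implicit Types (f phi : R -> R) (I J : set R).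

Definition mean J (g : R -> R) : R :=
  (fine (mu J))^-1 * (\int[mu]_(t in J) g t)%R.

Definition nondegenerate_interval J : Prop :=
  is_interval J /\ (0 < mu J < +oo)%E.

(* Square integrability makes all the averages meaningful. *)
Definition BMO (eps : R) I phi : Prop :=
  measurable_fun I phi /\
  forall J, nondegenerate_interval J -> J `<=` I ->
    mu.-integrable J (fun t => (phi t ^+ 2)%:E) /\
    mean J (fun t => `|phi t - mean J phi| ^+ 2) <= eps ^+ 2.

Definition is_optimizer f (eps : R) (B : R * R -> R) (x : R * R) I phi : Prop :=
  [/\ nondegenerate_interval I,
      BMO eps I phi,
      (mean I phi, mean I (fun t => phi t ^+ 2)) = x,
      mu.-integrable I (fun t => (f (phi t))%:E)
    & mean I (f \o phi) = B x].

Definition admits_optimizer f eps B x : Prop :=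
  exists I phi, is_optimizer f eps B x I phi.

End Optimizers.

Section Plane.
Context {R : realType}.
Implicit Types (a b u l r : R) (p q x : R * R) (f : R -> R).

Definition Omega (eps : R) : set (R * R) :=
  [set x | x.1 ^+ 2 <= x.2 <= x.1 ^+ 2 + eps ^+ 2].

Definition segment p q : set (R * R) :=
  [set x | exists2 s : R, 0 <= s <= 1 &
     x = ((1 - s) * p.1 + s * q.1, (1 - s) * p.2 + s * q.2)].

Definition parab a : R * R := (a, a ^+ 2).
Definition chord a b := segment (parab a) (parab b).

Definition right_tangent eps u :=
  segment (parab u) (u - eps, (u - eps) ^+ 2 + eps ^+ 2).
Definition left_tangent eps u :=
  segment (parab u) (u + eps, (u + eps) ^+ 2 + eps ^+ 2).

Definition Omega_R (eps : R) (u1 u2 : \bar R) : set (R * R) :=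
  [set x | exists2 u : R, (u1 <= u%:E <= u2)%E & right_tangent eps u x].
Definition Omega_L (eps : R) (u1 u2 : \bar R) : set (R * R) :=
  [set x | exists2 u : R, (u1 <= u%:E <= u2)%E & left_tangent eps u x].

Definition above_chord a b : set (R * R) :=
  [set x | (a + b) * x.1 - a * b <= x.2].
Definition below_chord a b : set (R * R) :=
  [set x | x.2 <= (a + b) * x.1 - a * b].

Definition cup_equation f a b : Prop :=
  mean `[a, b] f^`() = (f^`() a + f^`() b) / 2.
Definition D_L f a b : R := f^`(2) a - mean `[a, b] f^`(2).
Definition D_R f a b : R := f^`(2) b - mean `[a, b] f^`(2).

End Plane.

Inductive edge_figure (R : realType) :=
| TanR of \bar R & \bar R
| TanL of \bar R & \bar R
| Chordal (a b : R -> R) (a0 b0 a1 b1 : R).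
Arguments TanR {R}.
Arguments TanL {R}.

Inductive lin_kind :=
| RightMultitrolleybus | LeftMultitrolleybus
| Multicup | Multibirdie | ClosedMulticup.

(* In [Lin k s], [s] lists the intervals from left to right, each given by its
   two (possibly infinite) ends.  The constructors after [Angle] are the
   fictitious vertices: [LongChord] has two nonzero differentials, [ChordVertex]
   either separates two chordal domains or is a long chord with a vanishing
   differential, [TangentR] and [TangentL] separate two tangent domains of the
   same kind. *)
Inductive vertex_figure (R : realType) :=
| Lin of lin_kind & seq (\bar R * \bar R)
| Angle of R
| LongChord of R & R
| CupOrigin of R
| ChordVertex of R & R
| MinusInfty
| PlusInfty
| TangentR of R
| TangentL of R.
Arguments MinusInfty {R}.
Arguments PlusInfty {R}.

Section Figures.
Context {R : realType}.
Variables (f : R -> R) (eps : R).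
Implicit Types (s : seq (\bar R * \bar R)) (B : R * R -> R).

Definition edge_region (e : edge_figure R) : set (R * R) :=
  match e with
  | TanR u1 u2 => Omega_R eps u1 u2
  | TanL u1 u2 => Omega_L eps u1 u2
  | Chordal a b a0 b0 a1 b1 =>
      [set x | exists2 l, b1 - a1 <= l <= b0 - a0 & chord (a l) (b l) x]
  end.

Definition ivl s (i : nat) : \bar R * \bar R := nth (0%E, 0%E) s i.
Definition leftmost s : \bar R := (ivl s 0).1.
Definition rightmost s : \bar R := (ivl s (size s).-1).2.

Definition fixed_boundary s : set R :=
  [set t | exists2 i, (i < size s)%N & ((ivl s i).1 <= t%:E <= (ivl s i).2)%E].

Definition above_gaps s : set (R * R) :=
  [set x | forall i, (i.+1 < size s)%N ->
     above_chord (fine (ivl s i).2) (fine (ivl s i.+1).1) x].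

(* Each point of Omega lies on exactly one right and exactly one left tangent,
   so [Omega_R eps u +oo] is the part of Omega lying to the right of the right
   tangent at u, [Omega_R eps -oo u] the part lying to the left of it, and
   similarly for left tangents. *)
Definition lin_region (k : lin_kind) s : set (R * R) :=
  above_gaps s `&`
  match k with
  | RightMultitrolleybus => Omega_R eps (leftmost s) (rightmost s)
  | LeftMultitrolleybus => Omega_L eps (leftmost s) (rightmost s)
  | Multicup => Omega_L eps (leftmost s) +oo%E `&` Omega_R eps -oo%E (rightmost s)
  | Multibirdie =>
      Omega_R eps (leftmost s) +oo%E `&` Omega_L eps -oo%E (rightmost s)
  | ClosedMulticup =>
      Omega eps `&` below_chord (fine (leftmost s)) (fine (rightmost s))
  end.

Definition vertex_region (v : vertex_figure R) : set (R * R) :=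
  match v with
  | Lin k s => lin_region k s
  | Angle w => Omega_R eps w%:E +oo%E `&` Omega_L eps -oo%E w%:E
  | LongChord a b | ChordVertex a b => chord a b
  | CupOrigin c => [set parab c]
  | MinusInfty | PlusInfty => set0
  | TangentR w => right_tangent eps w
  | TangentL w => left_tangent eps w
  end.

Definition is_chordal_domain (a b : R -> R) (a0 b0 a1 b1 : R) : Prop :=
  [/\ a0 < a1, a1 <= b1, b1 < b0 & b0 - a0 <= 2 * eps] /\
  [/\ {within `[b1 - a1, b0 - a0], continuous a},
      {within `[b1 - a1, b0 - a0], continuous b},
      forall l, l \in `]b1 - a1, b0 - a0[ ->
        [/\ derivable a l 1, derivable b l 1, a^`() l < 0 & 0 < b^`() l]
    & forall l, l \in `[b1 - a1, b0 - a0] -> b l - a l = l] /\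
  [/\ a (b0 - a0) = a0, b (b0 - a0) = b0, a (b1 - a1) = a1
    & b (b1 - a1) = b1] /\
  (forall l, l \in `[b1 - a1, b0 - a0] -> 0 < l -> cup_equation f (a l) (b l)) /\
  (forall l, l \in `]b1 - a1, b0 - a0[ ->
     D_L f (a l) (b l) < 0 /\ D_R f (a l) (b l) < 0).

Definition edge_ok (e : edge_figure R) : Prop :=
  match e with
  | TanR u1 u2 | TanL u1 u2 => (u1 < u2)%E
  | Chordal a b a0 b0 a1 b1 => is_chordal_domain a b a0 b0 a1 b1
  end.

Definition allows_left_ray (k : lin_kind) : bool :=
  match k with LeftMultitrolleybus | Multicup => true | _ => false end.
Definition allows_right_ray (k : lin_kind) : bool :=
  match k with RightMultitrolleybus | Multicup => true | _ => false end.

(* A linearity domain has interior points: the configurations that collapse to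
   a single tangent or a single chord are not linearity domains. *)
Definition lin_ok (k : lin_kind) s : Prop :=
  [/\ s != [::],
      forall i, (i < size s)%N ->
        [/\ ((ivl s i).1 <= (ivl s i).2)%E, (ivl s i).1 != +oo%E
          & (ivl s i).2 != -oo%E]
    & forall i, (i.+1 < size s)%N -> exists r l : R,
        [/\ (ivl s i).2 = r%:E, (ivl s i.+1).1 = l%:E & 0 < l - r <= 2 * eps]] /\
  [/\ leftmost s = -oo%E -> allows_left_ray k,
      rightmost s = +oo%E -> allows_right_ray k,
      (leftmost s < rightmost s)%E,
      (k = Multicup -> leftmost s + (2 * eps)%:E <= rightmost s)%E
    & (k = ClosedMulticup -> rightmost s < leftmost s + (2 * eps)%:E)%E] /\
  (lin_region k s)° !=set0.

Definition affine (b0 b1 b2 : R) (x : R * R) : R := b0 + b1 * x.1 + b2 * x.2.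

Definition affine_candidate (D : set R) (A : set (R * R)) B : Prop :=
  exists b0 b1 b2 : R,
    (forall t, D t ->
       f t = b0 + b1 * t + b2 * t ^+ 2 /\ f^`() t = b1 + 2 * b2 * t) /\
    {in A, B =1 affine b0 b1 b2}.

Definition chord_candidate (a b : R) B : Prop :=
  forall h : R, 0 <= h <= 1 ->
    B ((1 - h) * a + h * b, (1 - h) * a ^+ 2 + h * b ^+ 2) =
    (1 - h) * f a + h * f b.

Definition tangent_point_candidate (w : R) (A : set (R * R)) B : Prop :=
  let b2 := f^`(2) w / 2 in
  let b1 := f^`() w - 2 * b2 * w in
  let b0 := f w - w * f^`() w + b2 * w ^+ 2 in
  {in A, B =1 affine b0 b1 b2}.

Definition tanR_candidate (u1 u2 : \bar R) B : Prop :=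
  exists m : R -> R,
    [/\ forall u x, (u1 <= u%:E <= u2)%E -> right_tangent eps u x ->
          B x = m u * (x.1 - u) + f u,
        forall u, (u1 < u%:E < u2)%E ->
          [/\ derivable m u 1, derivable m^`() u 1,
              eps * m^`() u + m u = f^`() u & m^`(2) u < 0]
      & u1 = -oo%E -> forall u, (u%:E <= u2)%E ->
          m u = eps^-1 * expR (- u / eps) *
            (\int[lebesgue_measure]_(t in `]-oo, u]) (f^`() t * expR (t / eps)))%R].

Definition tanL_candidate (u1 u2 : \bar R) B : Prop :=
  exists m : R -> R,
    [/\ forall u x, (u1 <= u%:E <= u2)%E -> left_tangent eps u x ->
          B x = m u * (x.1 - u) + f u,
        forall u, (u1 < u%:E < u2)%E ->
          [/\ derivable m u 1, derivable m^`() u 1,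
              - eps * m^`() u + m u = f^`() u & 0 < m^`(2) u]
      & u2 = +oo%E -> forall u, (u1 <= u%:E)%E ->
          m u = eps^-1 * expR (u / eps) *
            (\int[lebesgue_measure]_(t in `[u, +oo[) (f^`() t * expR (- t / eps)))%R].

Definition edge_candidate (e : edge_figure R) B : Prop :=
  match e with
  | TanR u1 u2 => tanR_candidate u1 u2 B
  | TanL u1 u2 => tanL_candidate u1 u2 B
  | Chordal a b a0 b0 a1 b1 =>
      forall l, b1 - a1 <= l <= b0 - a0 -> chord_candidate (a l) (b l) B
  end.

Definition vertex_candidate (v : vertex_figure R) B : Prop :=
  match v with
  | Lin k s => affine_candidate (fixed_boundary s) (lin_region k s) B
  | Angle w => affine_candidate [set w] (vertex_region v) B
  | LongChord a b | ChordVertex a b => chord_candidate a b B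
  | CupOrigin c => B (parab c) = f c
  | MinusInfty | PlusInfty => True
  | TangentR w | TangentL w => tangent_point_candidate w (vertex_region v) B
  end.

(* [starts_at e v] (resp. [ends_at e v]): the vertex figure v is adjacent to
   the edge figure e on the side from which e is oriented (resp. towards which
   it is oriented).  A right tangent domain goes from left to right, a left
   tangent domain from right to left, a chordal domain downwards. *)
Definition adjacent_left (tangent : R -> set (R * R)) (u1 : \bar R)
    (v : vertex_figure R) : Prop :=
  if u1 is u%:E then tangent u `<=` vertex_region v else v = MinusInfty.
Definition adjacent_right (tangent : R -> set (R * R)) (u2 : \bar R)
    (v : vertex_figure R) : Prop :=
  if u2 is u%:E then tangent u `<=` vertex_region v else v = PlusInfty.

Definition starts_at (e : edge_figure R) (v : vertex_figure R) : Prop :=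
  match e with
  | TanR u1 u2 => adjacent_left (right_tangent eps) u1 v
  | TanL u1 u2 => adjacent_right (left_tangent eps) u2 v
  | Chordal a b a0 b0 a1 b1 => chord a0 b0 `<=` vertex_region v
  end.

Definition ends_at (e : edge_figure R) (v : vertex_figure R) : Prop :=
  match e with
  | TanR u1 u2 => adjacent_right (right_tangent eps) u2 v
  | TanL u1 u2 => adjacent_left (left_tangent eps) u1 v
  | Chordal a b a0 b0 a1 b1 =>
      if a1 == b1 then v = CupOrigin a1 else chord a1 b1 `<=` vertex_region v
  end.

Definition upper_chord (e : edge_figure R) : option (R * R) :=
  if e is Chordal a b a0 b0 a1 b1 then Some (a0, b0) else None.
Definition lower_chord (e : edge_figure R) : option (R * R) :=
  if e is Chordal a b a0 b0 a1 b1 then Some (a1, b1) else None.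

End Figures.

Record foliation_graph (R : realType) := FoliationGraph {
  vertex : finType;
  edge : finType;
  vfig : vertex -> vertex_figure R;
  efig : edge -> edge_figure R;
  source : edge -> vertex;
  target : edge -> vertex
}.

Section Graphs.
Context {R : realType}.
Implicit Types (G : foliation_graph R) (f : R -> R) (B : R * R -> R).

Definition joins G (e : edge G) (v w : vertex G) : bool :=
  ((source e == v) && (target e == w)) || ((source e == w) && (target e == v)).

Definition linked G : rel (vertex G) := fun v w => [exists e, joins e v w].

(* The underlying unoriented graph is connected and has no cycles, i.e. no
   loops, no multiple edges and no simple cycles with at least 3 vertices. *)
Definition is_tree G : Prop :=
  [/\ forall v w : vertex G, connect (@linked G) v w,
      forall e : edge G, source e != target e,
      forall (e e' : edge G) v w, joins e v w -> joins e' v w -> e = e'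
    & forall c : seq (vertex G), (2 < size c)%N -> ~~ ucycleb (@linked G) c].

Definition figure_region eps G (i : vertex G + edge G) : set (R * R) :=
  match i with
  | inl v => vertex_region eps (vfig v)
  | inr e => edge_region eps (efig e)
  end.

Definition is_covering eps G : Prop :=
  \bigcup_(i in [set: vertex G + edge G]) figure_region eps i = Omega eps /\
  forall i j : vertex G + edge G, i != j ->
    (figure_region eps i)° `&` (figure_region eps j)° = set0.

Definition incidence_ok eps G : Prop :=
  forall (e : edge G) (v : vertex G),
    (source e = v <-> starts_at eps (efig e) (vfig v)) /\
    (target e = v <-> ends_at eps (efig e) (vfig v)).

Definition long_chord_attached eps G (a b : R) : Prop :=
  [/\ b - a = 2 * eps,
      exists e : edge G, upper_chord (efig e) = Some (a, b),
      exists (e : edge G) u1, efig e = TanL u1 a%:E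
    & exists (e : edge G) u2, efig e = TanR b%:E u2].

Definition vertex_ok f eps G (v : vertex_figure R) : Prop :=
  match v with
  | Lin k s => lin_ok eps k s
  | Angle w => True
  | LongChord a b =>
      long_chord_attached eps G a b /\ D_L f a b != 0 /\ D_R f a b != 0
  | CupOrigin c => exists e : edge G, lower_chord (efig e) = Some (c, c)
  | ChordVertex a b =>
      (a < b /\ exists e e' : edge G, lower_chord (efig e) = Some (a, b) /\
                                      upper_chord (efig e') = Some (a, b)) \/
      (long_chord_attached eps G a b /\ (D_L f a b = 0 \/ D_R f a b = 0))
  | MinusInfty => exists (e : edge G) u2,
      efig e = TanR -oo%E u2 \/ efig e = TanL -oo%E u2
  | PlusInfty => exists (e : edge G) u1,
      efig e = TanR u1 +oo%E \/ efig e = TanL u1 +oo%E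
  | TangentR w => exists (e e' : edge G) u1 u2,
      efig e = TanR u1 w%:E /\ efig e' = TanR w%:E u2
  | TangentL w => exists (e e' : edge G) u1 u2,
      efig e = TanL u1 w%:E /\ efig e' = TanL w%:E u2
  end.

Definition is_foliation_graph f eps G : Prop :=
  [/\ is_tree G,
      is_covering eps G,
      incidence_ok eps G,
      forall e : edge G, edge_ok f eps (efig e)
    & forall v : vertex G, vertex_ok f eps G (vfig v)].

Definition generates f eps G B : Prop :=
  [/\ {within Omega eps, continuous B},
      forall v : vertex G, vertex_candidate f eps (vfig v) B
    & forall e : edge G, edge_candidate f eps (efig e) B].

Definition admissible f eps G : Prop :=
  is_foliation_graph f eps G /\ exists B, generates f eps G B.

End Graphs.

(* Main.v *)
Require Import Defs.
From mathcomp Require Import ring lra measurable_realfun.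

Set Implicit Arguments.
Unset Strict Implicit.
Unset Printing Implicit Defensive.

Local Open Scope ring_scope.
Local Open Scope classical_set_scope.

(** An optimizer is assembled from monotone pieces.  Call a nondecreasing
    function [phi] on [a, b] a left profile if, for every t, some tangent to the
    free boundary at an abscissa c >= phi t - eps lies above the Bellman point of
    the restriction of [phi] to [a, t]; since [(phi - c)^2 - eps^2] is then
    positive only on an initial segment, its integral over every [s, t] is
    nonpositive, so that [phi] is in BMO_eps.  For the same reason a left profile
    and a reflected one whose Bellman points both lie below one common tangent can
    be concatenated.  Left profiles can be continued by constants and, along a
    right tangent domain, by logarithms; since the standard candidates are affine
    along the corresponding segments, the averages of [f] follow [B].

    It remains to know that the point where a right tangent domain, a right
    multitrolleybus, a multibirdie or an angle is entered from the left has a left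
    profile.  Approach that point vertically from below: one of the finitely many
    figures contains a sequence of these points.  It is either a source (a full
    chordal domain or a multicup), or a figure in which the right flow comes from
    further left (induction), or else its interior meets that of the entered
    figure, which is impossible.  Left flows are right flows for the reflection
    [t -> - t]. *)

(** * Integrals *)

Section Integrals.
Context {R : realType}.
Local Notation mu := (@lebesgue_measure R).
Implicit Types (A : set (measurableTypeR R)) (g h : R -> R).

(** The mean over J minimizes the integral of (phi - c)^2 in c, so it suffices to find for each
    subinterval J one c for which (phi - c)^2 - eps^2 has a nonpositive integral. For a fixed c this
    condition is additive under concatenation, whereas the variance is not.

    Logarithms come from a differential equation: if eps G' + G = g and phi(t) = u + eps ln((t - a)
    / L), then (t - a) G(phi(t)) is a primitive of g(phi(t)). The equation for m says that the value
    f - eps m of B at the upper end of the right tangent solves this for g = f; the coordinates of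
    that upper end solve it for g(v) = v and g(v) = v^2. The summability condition bounds f by K
    e^{|v|/e} with some e > eps, which lets a piece start from -oo.

    In a linearity domain an optimizer at x is sought on a line through x of slope 2 w, not above
    the tangent at w; its two ends come from arcs, gaps or entering tangents, and the kind of the
    domain dictates w. *)

Definition has_int A g (v : R) : Prop :=
  [/\ measurable A, mu.-integrable A (EFin \o g) & (\int[mu]_(t in A) g t)%R = v].

Lemma has_int_ext A g h v : {in A, g =1 h} -> has_int A g v -> has_int A h v.
Proof.
move=> gh [mA ig <-]; split=> //; last by apply/esym/eq_Rintegral.
by apply: eq_integrable ig => // x /gh /= ->.
Qed.

Lemma has_intD A g h v w : has_int A g v -> has_int A h w ->
  has_int A (fun t => g t + h t) (v + w).
Proof.
move=> [mA ig <-] [_ ih <-]; split=> //; last by rewrite RintegralD.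
exact: integrableD ig ih.
Qed.

Lemma has_intZ A g v k : has_int A g v -> has_int A (fun t => k * g t) (k * v).
Proof.
move=> [mA ig <-]; split=> //; last by rewrite RintegralZl.
by have := @integrableZl _ _ _ mu A mA k _ ig.
Qed.

Lemma has_int_cst A c : measurable A -> (mu A < +oo)%E ->
  has_int A (fun=> c) (c * fine (mu A)).
Proof.
move=> mA Aoo; split=> //; last by rewrite Rintegral_cst.
apply/integrableP; split; first exact: measurable_cst.
by rewrite /= integral_cst//= lte_mul_pinfty.
Qed.

Lemma has_int_sub A A' g v : has_int A g v -> measurable A' -> A' `<=` A ->
  exists v', has_int A' g v'.
Proof.
move=> [mA ig _] mA' AA'; eexists; split; [by []| |by []].
exact: integrableS ig.
Qed.


Lemma has_intU A A' g v v' : has_int A g v -> has_int A' g v' ->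
  A `&` A' = set0 -> has_int (A `|` A') g (v + v').
Proof.
move=> [mA ig <-] [mA' ig' <-] AA'.
have d : [disjoint A & A'] by apply/disj_set2P.
have mU : measurable (A `|` A') by exact: measurableU.
have igU : mu.-integrable (A `|` A') (EFin \o g).
  have /integrableP[mg fg] := ig; have /integrableP[mg' fg'] := ig'.
  have mgU := (measurable_funU _ mA mA').2 (conj mg mg').
  apply/integrableP; split=> //.
  rewrite ge0_integral_setU//; first exact: lte_add_pinfty.
  exact: measurableT_comp.
by split=> //; rewrite Rintegral_setU.
Qed.

Lemma has_int_ge0 A g v : has_int A g v -> (forall t, A t -> 0 <= g t) -> 0 <= v.
Proof. by move=> [_ _ <-] /Rintegral_ge0. Qed.

Lemma has_int_le A g h v w : has_int A g v -> has_int A h w ->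
  (forall t, A t -> g t <= h t) -> v <= w.
Proof. by move=> [mA ig <-] [_ ih <-] gh; exact: le_Rintegral. Qed.

Lemma has_int_uniq A g v w : has_int A g v -> has_int A g w -> v = w.
Proof. by move=> [_ _ <-] [_ _ <-]. Qed.

Lemma has_int_set1 g (r : R) : has_int [set r] g 0.
Proof.
split; [exact: measurable_set1| |exact: Rintegral_set1].
apply/integrableP; split; first exact: measurable_fun_set1.
by rewrite integral_set1.
Qed.

Lemma has_int_setU1 A g v (r : R) : has_int A g v -> has_int (A `|` [set r]) g v.
Proof.
move=> ig; have [Ar|nAr] := pselect (A r).
  by rewrite setUidl// => _ ->.
rewrite -[v]addr0; apply: has_intU => //; first exact: has_int_set1.
by apply/seteqP; split=> // t [At /= tr]; apply: nAr; rewrite -tr.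
Qed.

Lemma has_intD_sub A A' g v v' : has_int A g v -> has_int A' g v' -> A' `<=` A ->
  has_int (A `\` A') g (v - v').
Proof.
move=> ig ig' AA'; have [mA _ _] := ig; have [mA' _ _] := ig'.
have [w iw] := has_int_sub ig (measurableD mA mA') (@subDsetl _ _ _).
have := has_intU ig' iw; rewrite setDUK// setDIK => /(_ erefl) /(has_int_uniq ig) ->.
by rewrite addrAC subrr add0r.
Qed.

(** Lebesgue measure is invariant under negation. The change of variables is made for the positive
    and the negative part separately. *)
Lemma has_intN A g v : has_int A g v -> has_int (-%R @^-1` A) (fun t => g (- t)) v.
Proof.
move=> [mA ig <-]; have /integrableP[mg fg] := ig.
pose N := -%R : R -> measurableTypeR R.
have mN : measurable_fun setT N by exact: oppr_measurable.
have mNA : measurable (-%R @^-1` A : set (measurableTypeR R)) by rewrite -[X in measurable X]setTI; exact: mN.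
have pushE (h : R -> \bar R) : (\int[pushforward mu N]_(y in A) h y)%E =
    (\int[mu]_(y in A) h y)%E.
  by apply: eq_measure_integral => /= B mB BA; exact: lebesgue_measureN.
have mgN : measurable_fun (-%R @^-1` A : set (measurableTypeR R)) (EFin \o (fun t => g (- t))).
  apply: (measurable_comp mA _ mg (measurable_funS measurableT _ mN)) => //.
  by move=> _ [t At <-].
split=> //.
  apply/integrableP; split=> //; move: fg.
  rewrite -pushE ge0_integral_pushforward//.
  exact: measurableT_comp.
congr fine; rewrite integralE [RHS]integralE -2!pushE.
rewrite 2?ge0_integral_pushforward//.
- by congr (_ - _)%E; apply: eq_integral => x _; rewrite ?funeposE ?funenegE /= ?funeposE ?funenegE.
- exact: measurable_funeneg.
- exact: measurable_funepos.
Qed.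

Lemma has_int_itv_cst (a b : R) c : a <= b -> has_int `]a, b] (fun=> c) ((b - a) * c).
Proof.
move=> ab; have E : mu `]a, b] = (b - a)%:E.
  rewrite lebesgue_measure_itv/= lte_fin; have [|] := ltP a b; first by rewrite EFinB.
  by move=> ba; rewrite (le_anti (_ : a <= b <= a)) ?ab// subrr.
have -> : (b - a) * c = c * fine (mu `]a, b]) by rewrite E mulrC.
by apply: has_int_cst; rewrite ?E ?ltry//; exact: measurable_itv.
Qed.

Lemma has_int_cat (a m b : R) g v w : a <= m -> m <= b ->
  has_int `]a, m] g v -> has_int `]m, b] g w -> has_int `]a, b] g (v + w).
Proof.
move=> am mb ig ih.
rewrite (@itv_bndbnd_setU _ _ (BRight a) (BRight m) (BRight b)) ?bnd_simp//.
apply: has_intU => //; apply/seteqP; split=> // t [/=]; rewrite !in_itv/=; lra.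
Qed.

(** The set where [g] > 0 is an initial segment of ]a, t]. If [J] misses it, [g] <= 0 on [J];
    otherwise the complement of [J] lies inside it, and passing from ]a, t] to [J] removes a
    nonnegative part of a nonpositive integral. *)
Lemma has_int_lower (a t : R) (J : set R) g v w : is_interval J -> J !=set0 ->
  J `<=` `]a, t] -> t = sup J -> has_int `]a, t] g v -> has_int J g w ->
  (forall r s, a < r -> r <= s -> s <= t -> 0 < g s -> 0 < g r) ->
  v <= 0 -> w <= 0.
Proof.
move=> iJ J0 Jat tJ ig ih gmono v0.
have [[r0 Jr0 gr0]|nr0] := pselect (exists2 r, J r & 0 < g r); last first.
  rewrite -oppr_ge0 -mulN1r; apply: (has_int_ge0 (has_intZ (-1) ih)) => r Jr.
  by rewrite mulN1r oppr_ge0 leNgt; apply/negP => gr; apply: nr0; exists r.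
have hsJ : has_sup J.
  by split=> //; exists t => r /Jat/=; rewrite in_itv/= => /andP[].
have tA : a < t.
  by have /Jat/= := Jr0; rewrite in_itv/= => /andP[/lt_le_trans]; apply.
(* [J] may omit its supremum [t], where the sign of [g] is not known; this null set is added before
   the complement is taken. *)
have J'A : J `|` [set t] `<=` `]a, t].
  by move=> r [/Jat//|->] /=; rewrite in_itv/= tA lexx.
have iJ' := has_int_setU1 t ih.
have iK := has_intD_sub ig iJ' J'A.
have := has_int_ge0 iK; suff /[swap]/[apply] : forall s,
  (`]a, t] `\` (J `|` [set t])) s -> 0 <= g s by lra.
move=> s [/=]; rewrite in_itv/= => /andP[as_ st] /not_orP[nJs nst].
have slt : s < t by rewrite lt_neqAle st andbT; apply/eqP.
have [r0s|sr0] := leP r0 s; last first.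
  apply/ltW; apply: (gmono _ r0) => //; first exact: ltW.
  by have /Jat/= := Jr0; rewrite in_itv/= => /andP[].
move: slt; rewrite tJ => /(sup_gt J0)[r1 Jr1 sr1].
by case: nJs; apply: (iJ _ _ Jr0 Jr1); rewrite r0s ltW.
Qed.
End Integrals.

(** * Profiles and their concatenation *)

Section SquareIntegrals.
Context {R : realType}.
Implicit Types (A : set (measurableTypeR R)) (g h : R -> R).

Lemma has_int_itv_ext (a b : R) g h v :
  (forall t, a < t -> t <= b -> g t = h t) ->
  has_int `]a, b] g v -> has_int `]a, b] h v.
Proof.
move=> gh; apply: has_int_ext => t; rewrite inE/= in_itv/= => /andP[]; exact: gh.
Qed.

Lemma has_int_quad A g u v L c k : has_int A g u -> has_int A (fun t => g t ^+ 2) v ->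
  has_int A (fun=> 1) L ->
  has_int A (fun t => (g t - c) ^+ 2 - k) (v - 2 * c * u + (c ^+ 2 - k) * L).
Proof.
move=> i1 i2 i0; have := has_intD (has_intD i2 (has_intZ (- (2 * c)) i1)) (has_intZ (c ^+ 2 - k) i0).
rewrite mulNr; apply: has_int_ext => t _ /=; ring.
Qed.
End SquareIntegrals.

Section Profiles.
Context {R : realType}.
Local Notation mu := (@lebesgue_measure R).
Variables (f : R -> R) (eps : R).
Hypothesis eps0 : 0 < eps.
Implicit Types (phi : R -> R) (y : R * R).

(* The excess of [y] over the line tangent to the free boundary at abscissa c:
   nonpositive exactly when [y] lies on or below that line. *)
Definition excess c y : R := y.2 - 2 * c * y.1 + c ^+ 2 - eps ^+ 2.

(** [y] holds the averages of phi and phi^2, [v] is the average of f o phi, [M] an upper bound.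
    Half-open intervals make concatenation disjoint and let phi tend to -oo at the excluded end
    [a]. *)
Record profile (a b : R) phi y (M v : R) : Prop := Profile {
  profile_nd : forall s t, a < s -> s <= t -> t <= b -> phi s <= phi t;
  profile_le : forall t, a < t -> t <= b -> phi t <= M;
  profile1 : has_int `]a, b] phi ((b - a) * y.1);
  profile2 : has_int `]a, b] (fun t => phi t ^+ 2) ((b - a) * y.2);
  profilef : has_int `]a, b] (f \o phi) ((b - a) * v);
  profile_crit : forall t, a < t -> t <= b -> exists c w,
    [/\ phi t <= c + eps, has_int `]a, t] (fun s => (phi s - c) ^+ 2 - eps ^+ 2) w
      & w <= 0] }.

(** Quantifying over all intervals builds in scale invariance: a profile fits into any share of a
    longer interval without a change of variables. *)
Definition left_point y (M v : R) : Prop :=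
  forall a b, a < b -> exists phi, profile a b phi y M v.

Lemma left_point_le y M M' v : M <= M' -> left_point y M v -> left_point y M' v.
Proof.
move=> MM' lp a b /lp[phi [? h ? ? ? ?]]; exists phi; split=> // t at_ tb.
by apply: le_trans MM'; exact: h.
Qed.

Lemma left_point_cst p : left_point (p, p ^+ 2) p (f p).
Proof.
move=> a b ab; exists (fun=> p); split=> //=; try exact/has_int_itv_cst/ltW.
move=> t at_ tb; exists p, ((t - a) * ((p - p) ^+ 2 - eps ^+ 2)); split.
- by rewrite lerDl ltW.
- exact/has_int_itv_cst/ltW.
- by rewrite subrr expr0n/= sub0r mulrN oppr_le0 mulr_ge0 ?sqr_ge0// subr_ge0 ltW.
Qed.

Lemma profile_excess a b phi y M v c : a < b -> profile a b phi y M v ->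
  has_int `]a, b] (fun s => (phi s - c) ^+ 2 - eps ^+ 2) ((b - a) * excess c y).
Proof.
move=> ab [_ _ i1 i2 _ _].
have := has_int_quad c (eps ^+ 2) i1 i2 (has_int_itv_cst 1 (ltW ab)).
by congr has_int; rewrite /excess; ring.
Qed.

(** One [c] serves the whole tail: the old part contributes at most 0 because [y] lies below the
    tangent at [c], the constant [q] because |q - c| <= eps. *)
Lemma left_point_append y M v q c h : left_point y M v -> M <= q ->
  c - eps <= q <= c + eps -> excess c y <= 0 -> 0 <= h <= 1 ->
  left_point ((1 - h) * y.1 + h * q, (1 - h) * y.2 + h * q ^+ 2) q
    ((1 - h) * v + h * f q).
Proof.
move=> lp Mq /andP[cq qc] ey; rewrite 2!le_eqVlt => /andP[].
(* The cases h = 0 and h = 1 are separate because both pieces must have positive length. *)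
case: eqVneq => [<- _ _|_ /= h0].
  rewrite subr0 !mul1r !mul0r !addr0; apply: left_point_le Mq _.
  by case: y lp {ey}.
case: eqVneq => [-> _|_ /= h1].
  rewrite subrr !mul0r !mul1r !add0r; exact: left_point_cst.
move=> a b ab; pose m := a + (1 - h) * (b - a).
have am : a < m by rewrite ltrDl mulr_gt0// subr_gt0.
have mb : m < b.
  have : 0 < h * (b - a) by rewrite mulr_gt0// subr_gt0.
  rewrite /m; lra.
have [phi pp] := lp a m am; have [nd le i1 i2 i3 crit] := pp.
pose psi t := if t <= m then phi t else q.
have psi1 t : t <= m -> psi t = phi t by rewrite /psi => ->.
have psi2 t : m < t -> psi t = q by rewrite /psi leNgt => ->.
have cat (g : R -> R) u : has_int `]a, m] (g \o phi) u ->
    forall t, m <= t -> has_int `]a, t] (g \o psi) (u + (t - m) * g q).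
  move=> iu t mt; apply: (has_int_cat (ltW am) mt).
    by apply: has_int_itv_ext iu => s _ sm /=; rewrite psi1.
  by apply: has_int_itv_ext (has_int_itv_cst (g q) mt) => s ms _ /=; rewrite psi2.
exists psi; split.
- move=> s t as_ st tb; have [sm|ms] := leP s m; have [tm|mt] := leP t m.
  + by rewrite !psi1//; exact: nd.
  + by rewrite psi1// psi2//; apply: le_trans Mq; exact: le.
  + by move: (lt_le_trans ms st); rewrite ltNge tm.
  + by rewrite !psi2.
- move=> t at_ tb; have [tm|mt] := leP t m; last by rewrite psi2.
  by rewrite psi1//; apply: le_trans Mq; exact: le.
- have := cat id _ i1 b (ltW mb); congr has_int; rewrite /m /=; ring.
- have := cat (fun x => x ^+ 2) _ i2 b (ltW mb); congr has_int; rewrite /m /=; ring.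
- have := cat f _ i3 b (ltW mb); congr has_int; rewrite /m /=; ring.
- move=> t at_ tb; have [tm|mt] := leP t m.
    have [c' [w [h1' h2' h3']]] := crit t at_ tm; exists c', w; split=> //.
      by rewrite psi1.
    by apply: has_int_itv_ext h2' => s _ st; rewrite psi1//; exact: le_trans tm.
  have := cat (fun x => (x - c) ^+ 2 - eps ^+ 2) _ (profile_excess c am pp) t (ltW mt).
  move=> ic; eexists c, _; split; [by rewrite psi2|exact: ic|].
  have h2' : (q - c) ^+ 2 - eps ^+ 2 <= 0 by nra.
  have : 0 <= (t - m) * - ((q - c) ^+ 2 - eps ^+ 2) by apply: mulr_ge0; lra.
  have : 0 <= (m - a) * - excess c y by apply: mulr_ge0; lra.
  lra.
Qed.

(** Under the bound c + eps, (phi - c)^2 > eps^2 can only mean phi < c - eps, which by monotonicity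
    holds on an initial segment. *)
Lemma excess_lower (a t : R) phi c (J : set R) v w :
  (forall r s, a < r -> r <= s -> s <= t -> phi r <= phi s) ->
  phi t <= c + eps -> is_interval J -> J !=set0 -> J `<=` `]a, t] -> t = sup J ->
  has_int `]a, t] (fun s => (phi s - c) ^+ 2 - eps ^+ 2) v -> v <= 0 ->
  has_int J (fun s => (phi s - c) ^+ 2 - eps ^+ 2) w -> w <= 0.
Proof.
move=> nd pt iJ J0 Jat tJ iv v0 iw; apply: (has_int_lower iJ J0 Jat tJ iv iw) => //.
move=> r s ar rs st gs.
have prs := nd _ _ ar rs st; have pst := nd _ _ (lt_le_trans ar rs) st (lexx t).
have : phi s < c - eps by rewrite ltNge; apply/negP => h; nra.
nra.
Qed.

(** The criterion is applied at t = sup J, with the [c] that it supplies there. *)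
Lemma profile_BMO a b phi y M v (J : set R) : profile a b phi y M v ->
  is_interval J -> J !=set0 -> J `<=` `]a, b] -> exists c w,
  has_int J (fun s => (phi s - c) ^+ 2 - eps ^+ 2) w /\ w <= 0.
Proof.
move=> [nd _ _ _ _ crit] iJ J0 Jab.
have Jb r : J r -> r <= b by move=> /Jab/=; rewrite in_itv/= => /andP[].
have Ja r : J r -> a < r by move=> /Jab/=; rewrite in_itv/= => /andP[].
have sJ : has_sup J by split=> //; exists b => r /Jb.
have at_ : a < sup J.
  by have [r Jr] := J0; apply: lt_le_trans (Ja _ Jr) _; apply: ub_le_sup => //; exact: sJ.2.
have tb : sup J <= b by apply: ge_sup => // r /Jb.
have [c [w [ptc iw w0]]] := crit _ at_ tb.
have Jat : J `<=` `]a, sup J].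
  by move=> r Jr/=; rewrite in_itv/= Ja//=; apply: ub_le_sup => //; exact: sJ.2.
have [u iu] := has_int_sub iw (is_interval_measurable iJ) Jat.
exists c, u; split=> //; apply: (excess_lower _ ptc iJ J0 Jat erefl iw w0 iu).
by move=> r s ar rs st; apply: nd => //; exact: le_trans tb.
Qed.

(** At the right end the tangent can be prescribed, as gluing demands: both sides of a junction must
    use the same [c]. *)
Lemma profile_BMO_end a b phi y M v c (J : set R) w : a < b ->
  profile a b phi y M v -> M <= c + eps -> excess c y <= 0 ->
  is_interval J -> J `<=` `]a, b] -> J b ->
  has_int J (fun s => (phi s - c) ^+ 2 - eps ^+ 2) w -> w <= 0.
Proof.
move=> ab pp Mc ec iJ Jab Jb iw; have [nd le _ _ _ _] := pp.
have J0 : J !=set0 by exists b.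
have uJ : ubound J b by move=> r /Jab/=; rewrite in_itv/= => /andP[].
apply: (excess_lower nd _ iJ J0 Jab _ (profile_excess c ab pp) _ iw).
- by apply: le_trans Mc; exact: le.
- by apply/le_anti; rewrite ub_le_sup//=; [exact: ge_sup|exists b].
- by rewrite -oppr_ge0 -mulrN mulr_ge0 ?oppr_ge0// subr_ge0 ltW.
Qed.

Lemma mean_variance (J : set R) phi c u v w : nondegenerate_interval J ->
  has_int J phi u -> has_int J (fun s => phi s ^+ 2) v ->
  has_int J (fun s => (phi s - c) ^+ 2 - eps ^+ 2) w -> w <= 0 ->
  mean J (fun t => `|phi t - mean J phi| ^+ 2) <= eps ^+ 2.
Proof.
move=> [iJ /andP[J0 Joo]] iu iv iw w0.
set L := fine (mu J); have L0 : 0 < L by rewrite fine_gt0// J0.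
have i1 : has_int J (fun=> 1) L.
  rewrite -[X in has_int _ _ X]mul1r; apply: has_int_cst => //.
  exact: is_interval_measurable.
have wE := has_int_uniq iw (has_int_quad c (eps ^+ 2) iu iv i1).
have mE : mean J phi = L^-1 * u by have [_ _ <-] := iu.
rewrite {1}/mean -/L.
have : has_int J (fun t => `|phi t - mean J phi| ^+ 2)
    (v - 2 * mean J phi * u + mean J phi ^+ 2 * L).
  have := has_int_quad (mean J phi) 0 iu iv i1; rewrite subr0.
  by apply: has_int_ext => t _ /=; rewrite subr0 -normrX ger0_norm ?sqr_ge0.
move=> [_ _ ->]; rewrite mulrC ler_pdivrMr// mE.
have -> : v - 2 * (L^-1 * u) * u + (L^-1 * u) ^+ 2 * L = v - u ^+ 2 / L by field; rewrite gt_eqF.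
(* This is the amount by which the squared deviation from [c] exceeds the one from the mean. *)
have : 0 <= (u - c * L) ^+ 2 / L by rewrite mulr_ge0 ?sqr_ge0// invr_ge0 ltW.
have -> : (u - c * L) ^+ 2 / L = u ^+ 2 / L - 2 * c * u + c ^+ 2 * L by field; rewrite gt_eqF.
lra.
Qed.

End Profiles.

(** * Gluing a left and a right profile into an optimizer *)

Section Gluing.
Context {R : realType}.
Local Notation mu := (@lebesgue_measure R).
Variables (f : R -> R) (eps : R).
Hypothesis eps0 : 0 < eps.
Implicit Types (phi : R -> R) (x y : R * R).

(** Only the values are reflected here; once the argument is reflected too, the function is again
    nondecreasing and [M] is a lower bound for it. *)
Definition right_point y (M v : R) : Prop :=
  left_point (f \o -%R) eps (- y.1, y.2) (- M) v.

(** The open interval avoids both ends, where logarithmic pieces may tend to infinity. *)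
Lemma optimizer_intro (B : R * R -> R) phi x :
  has_int `]0, 1[ phi x.1 -> has_int `]0, 1[ (fun t => phi t ^+ 2) x.2 ->
  has_int `]0, 1[ (f \o phi) (B x) ->
  (forall J : set R, is_interval J -> J !=set0 -> J `<=` `]0, 1[ -> exists c w,
     has_int J (fun s => (phi s - c) ^+ 2 - eps ^+ 2) w /\ w <= 0) ->
  admits_optimizer f eps B x.
Proof.
move=> i1 i2 i3 osc; exists `]0, 1[%classic, phi.
have I1 : mu (`]0, 1[ : set R) = 1%E.
  by rewrite lebesgue_measure_itv/= lte_fin ltr01 oppr0 adde0.
have m1 (g : R -> R) u : has_int `]0, 1[ g u -> mean `]0, 1[ g = u.
  move=> [_ _ <-]; by rewrite /mean I1 invr1 mul1r.
have [mI ig1 _] := i1; split.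
- by split; [exact: interval_is_interval|rewrite I1 lte01 ltry].
- split; first by apply/measurable_EFinP; exact: measurable_int ig1.
  move=> J nJ JI; have mJ := is_interval_measurable nJ.1.
  have [u iu] := has_int_sub i1 mJ JI; have [v iv] := has_int_sub i2 mJ JI.
  split; first by have [] := iv.
  have J0 : J !=set0.
    by apply/set0P/eqP => J0; have := nJ.2; rewrite J0 measure0 ltxx.
  have [c [w [iw w0]]] := osc J nJ.1 J0 JI.
  exact: mean_variance nJ iu iv iw w0.
- by rewrite (m1 _ _ i1) (m1 _ _ i2); case: x {i1 i2 i3}.
- by have [] := i3.
- exact: m1.
Qed.

Lemma oppr_preimageK (A : set R) : -%R @^-1` (-%R @^-1` A) = A.
Proof. by apply/seteqP; split=> t /=; rewrite opprK. Qed.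

Lemma has_int_itvoo (a b : R) g v : a < b -> has_int `]a, b] g v -> has_int `]a, b[ g v.
Proof.
move=> ab ig; have [|w iw] := has_int_sub ig (measurable_itv (Interval (BRight a) (BLeft b))) _.
  by move=> t /=; rewrite !in_itv/= => /andP[-> /ltW].
have := has_int_setU1 b iw; rewrite setUitv1 ?bnd_simp//.
by move=> /(has_int_uniq ig) ->.
Qed.

(** The function is t -> - psi (- t) for a left profile psi; the last clause mirrors
    [profile_BMO_end] for intervals that start at [a]. *)
Lemma right_profile y M v (a b : R) : right_point y M v -> a < b -> exists phi,
  [/\ has_int `]a, b[ phi ((b - a) * y.1),
      has_int `]a, b[ (fun t => phi t ^+ 2) ((b - a) * y.2),
      has_int `]a, b[ (f \o phi) ((b - a) * v),
      forall J : set R, is_interval J -> J !=set0 -> J `<=` `]a, b[ -> exists c w,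
        has_int J (fun s => (phi s - c) ^+ 2 - eps ^+ 2) w /\ w <= 0
    & forall c (J : set R) w, is_interval J -> J `<=` `[a, b[ -> J a ->
        c - eps <= M -> excess eps c y <= 0 ->
        has_int J (fun s => (phi s - c) ^+ 2 - eps ^+ 2) w -> w <= 0].
Proof.
move=> rp ab; have ab' : - b < - a by rewrite ltrN2.
have [psi pp] := rp _ _ ab'; have [_ _ i1 i2 i3 _] := pp.
have E : - a - - b = b - a by rewrite opprK addrC.
have itv (g : R -> R) u : has_int `](- b), (- a)] g u -> has_int `]a, b[ (fun t => g (- t)) u.
  move=> /(has_int_itvoo ab') /has_intN.
  by rewrite opp_preimage_itvbndbnd !opprK.
have iN (J : set R) : is_interval J -> is_interval (-%R @^-1` J).
  move=> iJ r s Jr Js t /andP[rt ts]; apply: (iJ _ _ Js Jr).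
  by rewrite !lerN2 ts.
have excN (J : set R) c w : has_int J (fun s => (- psi (- s) - c) ^+ 2 - eps ^+ 2) w <->
    has_int (-%R @^-1` J) (fun s => (psi s - - c) ^+ 2 - eps ^+ 2) w.
  split=> /has_intN.
    by apply: has_int_ext => t _; rewrite opprK; congr (_ - _); ring.
  by rewrite oppr_preimageK; apply: has_int_ext => t _; congr (_ - _); ring.
exists (fun t => - psi (- t)); split.
- have := has_intZ (-1) (itv _ _ i1); rewrite E/= mulrN mulN1r opprK.
  by apply: has_int_ext => t _; rewrite mulN1r.
- have := itv _ _ i2; rewrite E/=.
  by apply: has_int_ext => t _; rewrite sqrrN.
- by have := itv _ _ i3; rewrite E.
- move=> J iJ [r Jr] Jab; have [||c [w [iw w0]]] := profile_BMO pp (iN _ iJ).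
  + by exists (- r); rewrite /= opprK.
  + move=> t /= /Jab/=; rewrite !in_itv/=; lra.
  + by exists (- c), w; split=> //; apply/excN; rewrite opprK.
- move=> c J w iJ Jab Ja cM ey /excN iw.
  apply: (profile_BMO_end ab' pp _ _ (iN _ iJ) _ _ iw).
  + by lra.
  + by apply: le_trans ey; rewrite /excess/=; lra.
  + by move=> t /= /Jab/=; rewrite !in_itv/=; lra.
  + by rewrite /= opprK.
Qed.

(** An interval on one side of the junction is handled by that side alone. One that crosses it is
    cut there, and the tangent at [c], above both Bellman points, makes both integrals
    nonpositive. *)
Lemma optimizer_glue (B : R * R -> R) y M v y' M' v' c h :
  left_point f eps y M v -> right_point y' M' v' ->
  M <= c + eps -> c - eps <= M' ->
  excess eps c y <= 0 -> excess eps c y' <= 0 -> 0 <= h <= 1 ->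
  B ((1 - h) * y.1 + h * y'.1, (1 - h) * y.2 + h * y'.2) = (1 - h) * v + h * v' ->
  admits_optimizer f eps B
    ((1 - h) * y.1 + h * y'.1, (1 - h) * y.2 + h * y'.2).
Proof.
move=> lp rp Mc cM' ey ey'; rewrite 2!le_eqVlt => /andP[].
case: eqVneq => [<- _ _|_ /= h0].
  rewrite subr0 !mul1r !mul0r !addr0 => BE.
  have [phi pp] := lp _ _ (@ltr01 R); have [_ _ i1 i2 i3 _] := pp.
  move: i1 i2 i3; rewrite subr0 !mul1r.
  move=> /(has_int_itvoo ltr01) i1 /(has_int_itvoo ltr01) i2 /(has_int_itvoo ltr01) i3.
  apply: (optimizer_intro (phi := phi)); rewrite ?BE// => J iJ J0 JI.
  apply: (profile_BMO pp) => // t /JI/=; rewrite !in_itv/=; lra.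
case: eqVneq => [-> _|_ /= h1].
  rewrite subrr !mul1r !mul0r !add0r => BE.
  have [phi []] := right_profile rp (@ltr01 R).
  rewrite subr0 !mul1r => i1 i2 i3 osc _.
  by apply: (optimizer_intro (phi := phi)); rewrite ?BE.
move=> BE; pose m := 1 - h.
have m0 : 0 < m by rewrite subr_gt0.
have m1 : m < 1 by rewrite /m; lra.
have [phi pp] := lp _ _ m0; have [_ _ i1 i2 i3 _] := pp.
have [phi' [i1' i2' i3' osc' end']] := right_profile rp m1.
pose psi t := if t <= m then phi t else phi' t.
have psi1 t : t <= m -> psi t = phi t by rewrite /psi => ->.
have psi2 t : m < t -> psi t = phi' t by rewrite /psi leNgt => ->.
have cat (g : R -> R) u u' : has_int `]0, m] (g \o phi) u ->
    has_int `]m, 1[ (g \o phi') u' -> has_int `]0, 1[ (g \o psi) (u + u').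
  move=> iu iu'.
  rewrite (@itv_bndbnd_setU _ _ (BRight 0) (BRight m) (BLeft 1)) ?bnd_simp ?ltW//.
  apply: has_intU.
  - by apply: has_int_itv_ext iu => s _ sm /=; rewrite psi1.
  - apply: has_int_ext iu' => s; rewrite inE/= in_itv/= => /andP[ms _].
    by rewrite psi2.
  - by apply/seteqP; split=> // t [/=]; rewrite !in_itv/=; lra.
have mE : m - 0 = 1 - h by rewrite subr0.
have mE' : 1 - m = h by rewrite /m; ring.
rewrite mE in i1 i2 i3; rewrite mE' in i1' i2' i3'.
have j1 := cat id _ _ i1 i1'; have j2 := cat (fun t => t ^+ 2) _ _ i2 i2'.
have j3 := cat f _ _ i3 i3'.
apply: (optimizer_intro (phi := psi)) => //; first by rewrite BE.
move=> J iJ J0 JI.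
have mJ := is_interval_measurable iJ.
have J01 t : J t -> 0 < t /\ t < 1.
  by move=> /JI/=; rewrite in_itv/= => /andP[].
have iI (K : interval R) : is_interval (J `&` [set` K]).
  move=> r s [Jr Kr] [Js Ks] t rts; split; first exact: (iJ _ _ Jr Js).
  exact: (interval_is_interval Kr Ks).
have [[t0 Jt0 t0m]|noL] := pselect (exists2 t, J t & t <= m); last first.
  have [|c' [w [iw w0]]] := osc' J iJ J0.
    move=> t Jt; rewrite /= in_itv/= (J01 _ Jt).2 andbT ltNge.
    by apply/negP => tm; apply: noL; exists t.
  exists c', w; split=> //; apply: has_int_ext iw => t; rewrite inE => Jt.
  by rewrite psi2// ltNge; apply/negP => tm; apply: noL; exists t.
have [[t1 Jt1 mt1]|noR] := pselect (exists2 t, J t & m < t); last first.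
  have [|c' [w [iw w0]]] := profile_BMO pp iJ J0.
    move=> t Jt; rewrite /= in_itv/= (J01 _ Jt).1/= leNgt.
    by apply/negP => tm; apply: noR; exists t.
  exists c', w; split=> //; apply: has_int_ext iw => t; rewrite inE => Jt.
  by rewrite psi1// leNgt; apply/negP => tm; apply: noR; exists t.
have Jm : J m by apply: (iJ _ _ Jt0 Jt1); rewrite t0m ltW.
have ic := has_int_quad c (eps ^+ 2) j1 j2 (has_int_itvoo ltr01 (has_int_itv_cst 1 ler01)).
pose J1 := J `&` `]-oo, m]; pose J2 := J `&` `]m, +oo[.
have mJ1 : measurable (J1 : set (measurableTypeR R)).
  exact: (is_interval_measurable (iI `]-oo, m]%R)).
have mJ2 : measurable (J2 : set (measurableTypeR R)).
  exact: (is_interval_measurable (iI `]m, +oo[%R)).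
have [w1 iw1] : exists w, has_int J1 (fun s => (psi s - c) ^+ 2 - eps ^+ 2) w.
  by apply: has_int_sub ic mJ1 _ => t [/JI].
have [w2 iw2] : exists w, has_int J2 (fun s => (psi s - c) ^+ 2 - eps ^+ 2) w.
  by apply: has_int_sub ic mJ2 _ => t [/JI].
exists c, (w1 + w2); split.
  have -> : J = J1 `|` J2.
    apply/seteqP; split=> [t Jt|t [[]|[]]]//.
    by rewrite /J1 /J2 /= !in_itv/= andbT; have [|] := leP t m; [left|right].
  apply: has_intU => //; apply/seteqP; split=> // t [[_ /=] + [_ /=]].
  by rewrite !in_itv/=; lra.
have w10 : w1 <= 0.
  apply: (profile_BMO_end m0 pp Mc ey (iI `]-oo, m]%R)) => //.
  - by move=> t [/J01[t0' _] /=]; rewrite !in_itv/= t0'.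
  - by split=> //=; rewrite in_itv/= lexx.
  - by apply: has_int_ext iw1 => t; rewrite inE => -[_ /=]; rewrite in_itv/= => /psi1 ->.
have w20 : w2 <= 0.
  (* [end'] speaks of intervals containing their left end, so the junction is put back as a null
     set. *)
  apply: (end' c (J2 `|` [set m])) => //.
  - have -> : J2 `|` [set m] = J `&` `[m, +oo[.
      apply/seteqP; split=> [t [[Jt]|->]|t [Jt]]/=; rewrite ?in_itv/= ?andbT//.
      + by split=> //; exact: ltW.
      + by rewrite le_eqVlt => /predU1P[<-|]; [right|left; split=> //=; rewrite in_itv/= andbT].
    exact: (iI `[m, +oo[%R).
  - move=> t [[Jt]|->] /=; rewrite !in_itv/= ?lexx ?m1//.
    by rewrite andbT (J01 _ Jt).2 andbT; exact: ltW.
  - by right.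
  - apply: has_int_setU1; apply: has_int_ext iw2 => t; rewrite inE => -[_ /=].
    by rewrite in_itv/= andbT => /psi2 ->.
lra.
Qed.
End Gluing.

(** * Logarithmic pieces *)

Section LogPieces.
Context {R : realType}.
Local Notation mu := (@lebesgue_measure R).
Variables (eps : R).
Hypothesis eps0 : 0 < eps.
Implicit Types (g G : R -> R) (a b L u s t v : R).

(** Takes the value [u] at a + L and tends to -oo at [a]. *)
Definition log_piece (a L u t : R) : R := u + eps * ln ((t - a) / L).

Lemma log_piece_le a L u s t : 0 < L -> a < s -> s <= t ->
  log_piece a L u s <= log_piece a L u t.
Proof.
move=> L0 as_ st; rewrite lerD2l ler_pM2l// ler_ln ?posrE ?divr_gt0//; [|lra|lra].
rewrite ler_pM2r ?invr_gt0//; lra.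
Qed.

Lemma log_piece_lt a L u s t : 0 < L -> a < s -> s < t ->
  log_piece a L u s < log_piece a L u t.
Proof.
move=> L0 as_ st; rewrite ltrD2l ltr_pM2l// ltr_ln ?posrE ?divr_gt0//; [|lra|lra].
rewrite ltr_pM2r ?invr_gt0//; lra.
Qed.

Lemma is_derive_log_piece a L u t : 0 < L -> a < t ->
  is_derive t 1 (log_piece a L u) (eps / (t - a)).
Proof.
move=> L0 at_.
have h1 : is_derive t 1 (fun r : R => (r - a) / L) L^-1.
  by apply: is_derive_eq; rewrite scaler0 add0r subr0 /GRing.scale/= mulr1.
have p : 0 < (t - a) / L by rewrite divr_gt0// subr_gt0.
have h2 := @is_derive1_comp R (@ln R) _ t _ _ (is_derive1_ln p) h1.
have -> : log_piece a L u = cst u + (eps \*: (@ln R \o (fun r : R => (r - a) / L))).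
  by apply/funext => r.
by apply: is_derive_eq; rewrite /GRing.scale/=; field; rewrite !gt_eqF ?subr_gt0.
Qed.

Lemma continuous_log_piece a L u t : 0 < L -> a < t ->
  {for t, continuous (log_piece a L u)}.
Proof.
move=> L0 at_; apply: differentiable_continuous; apply/derivable1_diffP.
by have [] := is_derive_log_piece u L0 at_.
Qed.

(* [(t - a) G (phi t)] is a primitive of [g (phi t)] for the logarithmic piece
   [phi] because [eps G' + G = g]. *)
Lemma log_piece_int a L u s t g G v1 : 0 < L -> a < s -> s < t ->
  continuous g -> continuous G ->
  (forall v, log_piece a L u s < v -> v < v1 ->
     exists2 dG, is_derive v 1 G dG & G v + eps * dG = g v) ->
  log_piece a L u t <= v1 ->
  has_int `]s, t] (g \o log_piece a L u)
    ((t - a) * G (log_piece a L u t) - (s - a) * G (log_piece a L u s)).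
Proof.
move=> L0 as_ st cg cG dG tv1; set phi := log_piece a L u.
have cphi r : s <= r -> {for r, continuous phi}.
  by move=> sr; apply: continuous_log_piece => //; exact: lt_le_trans sr.
have cgp : {within `[s, t], continuous (g \o phi)}.
  apply: continuous_in_subspaceT => r; rewrite inE/= in_itv/= => /andP[sr _].
  by apply: continuous_comp; [exact: cphi|exact: cg].
pose F r := (r - a) * G (phi r).
have cF r : s <= r -> {for r, continuous F}.
  move=> sr; apply: continuousM.
    by apply: continuousB; [exact: cvg_id|exact: cvg_cst].
  by apply: continuous_comp; [exact: cphi|exact: cG].
have dF r : r \in `]s, t[%R -> is_derive r 1 F (g (phi r)).
  rewrite in_itv/= => /andP[sr rt].
  have ar : a < r by exact: lt_trans sr.
  have [||d idG Gg] := dG (phi r).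
  - exact: log_piece_lt.
  - by apply: lt_le_trans tv1; exact: log_piece_lt.
  have h1 := is_derive1_comp idG (is_derive_log_piece u L0 ar).
  have -> : F = (fun r => r - a) * (G \o phi) by apply/funext.
  apply: is_derive_eq; rewrite /GRing.scale/= -Gg subr0 mulr1.
  by field; rewrite gt_eqF// subr_gt0.
have ig : mu.-integrable `[s, t] (EFin \o (g \o phi)).
  by apply: continuous_compact_integrable => //; exact: segment_compact.
have ig' : mu.-integrable `]s, t] (EFin \o (g \o phi)).
  by apply: integrableS ig => //; exact: subset_itv_oc_cc.
split=> //.
rewrite Rintegral_itv_obnd_cbnd// /Rintegral (@continuous_FTC2 _ _ F)//.
- split.
  + by move=> r /dF [].
  + by apply: cvg_at_right_filter; exact: cF.
  + by apply: cvg_at_left_filter; apply: cF; exact: ltW.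
- by move=> r /dF; rewrite derive1E => h; rewrite (@derive_val _ _ _ _ _ _ _ h).
Qed.

Definition vanishes_at_ninfty (h : R -> R) : Prop :=
  forall d, 0 < d -> exists V, forall v, v <= V -> `|h v| <= d.

Lemma log_piece_shift a L u t (n : nat) : 0 < L -> a < t ->
  log_piece a L u (a + (t - a) * expR (- n%:R)) = log_piece a L u t - eps * n%:R.
Proof.
move=> L0 at_; have t0 : 0 < t - a by rewrite subr_gt0.
rewrite /log_piece addrAC subrr add0r mulrAC [in LHS]lnM ?posrE ?expR_gt0 ?divr_gt0//.
by rewrite expRK; ring.
Qed.

(** Since [g] >= 0, monotone convergence applies along ]s n, t]. The boundary term tends to 0
    because s n - a is proportional to e^{phi (s n) / eps}, which is the weight in the decay
    hypothesis on [G]. *)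
Lemma log_piece_improper_ge0 a L u t g G v1 : 0 < L -> a < t ->
  continuous g -> continuous G ->
  (forall v, v < v1 -> exists2 dG, is_derive v 1 G dG & G v + eps * dG = g v) ->
  log_piece a L u t <= v1 ->
  (forall v, v <= log_piece a L u t -> 0 <= g v) ->
  vanishes_at_ninfty (fun v => expR (v / eps) * G v) ->
  has_int `]a, t] (g \o log_piece a L u) ((t - a) * G (log_piece a L u t)).
Proof.
move=> L0 at_ cg cG dG tv1 g0 G0; set phi := log_piece a L u.
have t0 : 0 < t - a by rewrite subr_gt0.
pose s (n : nat) := a + (t - a) * expR (- n%:R).
have as_ n : a < s n by rewrite ltrDl mulr_gt0// expR_gt0.
have st n : s n <= t.
  rewrite -lerBrDl -[leRHS]mulr1 ler_pM2l// -expR0 ler_expR oppr_le0//.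
pose F n : set (measurableTypeR R) := `]s n, t]%classic.
have int n : has_int (F n) (g \o phi) ((t - a) * G (phi t) - (s n - a) * G (phi (s n))).
  (* For n = 0 the interval is empty, s 0 being [t]. *)
  case: n => [|n].
    have s0 : s 0%N = t by rewrite /s oppr0 expR0; ring.
    rewrite /F s0 subrr set_itvoc0; split.
    + exact: measurable0.
    + exact: integrable_set0.
    + exact: Rintegral_set0.
  apply: (log_piece_int L0 _ _ cg cG _ tv1) => //.
  - rewrite -ltrBrDl -[ltRHS]mulr1 ltr_pM2l// -expR0 ltr_expR oppr_lt0//.
  - by move=> v _; exact: dG.
have FU : \bigcup_n F n = `]a, t].
  apply/seteqP; split=> r.
    by move=> [n _]; rewrite /F /= !in_itv/= => /andP[/(lt_trans (as_ n)) -> ->].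
  rewrite /= in_itv/= => /andP[ar rt]; pose z := - ln ((r - a) / (t - a)).
  have p : 0 < (r - a) / (t - a) by rewrite divr_gt0// subr_gt0.
  exists (Num.truncn `|z|).+1 => //; rewrite /F /= in_itv/= rt andbT.
  rewrite -ltrBrDl mulrC -ltr_pdivlMr// -[ltRHS](lnK p) ltr_expR ltrNl.
  apply: le_lt_trans (ler_norm z) _; exact: truncnS_gt.
have ndF : nondecreasing_seq F.
  move=> m n mn; apply/subsetPset => r; rewrite /F /= !in_itv/= => /andP[+ ->].
  rewrite andbT; apply: le_lt_trans.
  by rewrite lerD2l ler_pM2l// ler_expR lerN2 ler_nat.
have F0 n r : F n r -> (0 <= (EFin \o (g \o phi)) r)%E.
  rewrite /F /= in_itv/= => /andP[sr rt]; rewrite lee_fin; apply: g0.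
  by apply: log_piece_le => //; exact: lt_trans (as_ n) sr.
have mF n : measurable_fun (F n) (EFin \o (g \o phi)).
  by have [_ i _] := int n; exact: measurable_int i.
have cv1 := @ge0_nondecreasing_set_cvg_integral _ _ _ F (EFin \o (g \o phi)) mu ndF
  (fun n => let: And3 m _ _ := int n in m) mF F0.
have cv2 : (\int[mu]_(x in F n) (EFin \o (g \o phi)) x)%E @[n --> \oo] -->
    ((t - a) * G (phi t))%:E.
  apply: cvg_EFin.
    by apply: nearW => n; have [m i _] := int n; exact: integrable_fin_num.
  apply/cvgrPdist_le => e e0.
  (* The constant in s n - a = k e^{phi (s n) / eps}. *)
  pose k := (t - a) * expR (- (phi t / eps)).
  have k0 : 0 < k by rewrite mulr_gt0// expR_gt0.
  have [V VG] := G0 (e / k) (divr_gt0 e0 k0).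
  exists (Num.truncn `|(phi t - V) / eps|).+1 => // n /= Nn.
  have -> : fine (\int[mu]_(x in F n) (EFin \o (g \o phi)) x)%E =
      (t - a) * G (phi t) - (s n - a) * G (phi (s n)) by have [_ _ <-] := int n.
  rewrite opprB addrC subrK.
  have -> : (s n - a) * G (phi (s n)) =
      k * (expR (phi (s n) / eps) * G (phi (s n))).
    rewrite /phi log_piece_shift// mulrA; congr (_ * _).
    rewrite /k -mulrA -expRD /s addrAC subrr add0r; congr (_ * expR _).
    by rewrite /phi; field; rewrite gt_eqF.
  rewrite normrM gtr0_norm// -ler_pdivlMl// [leRHS]mulrC; apply: VG.
  rewrite /phi log_piece_shift// lerBlDr -lerBlDl -ler_pdivrMl// mulrC.
  apply: le_trans (ler_norm _) _; apply/ltW; apply: lt_le_trans (truncnS_gt _) _.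
  by rewrite ler_nat.
have E : (\int[mu]_(x in `]a, t]) (EFin \o (g \o phi)) x)%E = ((t - a) * G (phi t))%:E.
  by rewrite -FU; apply: cvg_unique cv1 cv2.
have mgp : measurable_fun (`]a, t] : set (measurableTypeR R)) (EFin \o (g \o phi)).
  rewrite -FU; apply/measurable_fun_bigcup => // n; by have [] := int n.
split=> //.
- apply/integrableP; split=> //.
  suff -> : (\int[mu]_(x in `]a, t]) `|(EFin \o (g \o phi)) x| =
      \int[mu]_(x in `]a, t]) (EFin \o (g \o phi)) x)%E by rewrite E ltry.
  apply: eq_integral => r; rewrite inE -FU => -[n _ Fnr]; exact: gee0_abs (F0 _ _ Fnr).
- by rewrite /Rintegral [X in fine X]E.
Qed.
End LogPieces.

(** * Exponential growth bounds *)

Section ExpBounded.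
Context {R : realType}.
Implicit Types (g G : R -> R) (e u v : R).

Definition exp_bounded e g : Prop :=
  exists2 K, 0 <= K & forall v, `|g v| <= K * expR (`|v| / e).

Lemma exp_boundedN e g : exp_bounded e g -> exp_bounded e (g \o -%R).
Proof. by move=> [K K0 gK]; exists K => // v; have := gK (- v); rewrite normrN. Qed.

(** The mean value theorem costs a factor |v|, which a loss of rate absorbs: k |v| <= e^{k |v|} with
    k = 1/e2 - 1/e1. *)
Lemma exp_bounded_primitive e1 e2 g dg : 0 < e2 -> e2 < e1 ->
  (forall v, is_derive v 1 g (dg v)) -> exp_bounded e1 dg -> exp_bounded e2 g.
Proof.
move=> e20 e21 dgg [K K0 dgK].
have e10 : 0 < e1 by exact: lt_trans e21.
pose k := e2^-1 - e1^-1.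
have k0 : 0 < k by rewrite subr_gt0 ltf_pV2.
have gb v : `|g v - g 0| <= K * expR (`|v| / e1) * `|v|.
  have cg : continuous g.
    by move=> r; apply: differentiable_continuous; apply/derivable1_diffP; have [] := dgg r.
  have dg' (a b : R) : forall x, x \in `]a, b[%R -> is_derive x 1 g (dg x) by [].
  have cw (a b : R) : {within `[a, b], continuous g} by exact: continuous_subspaceT.
  have key (c w : R) : `|c| <= `|v| -> `|w| = `|v| -> `|dg c * w| <= K * expR (`|v| / e1) * `|v|.
    move=> cv wv; rewrite normrM wv ler_wpM2r// (le_trans (dgK _))// ler_wpM2l//.
    by rewrite ler_expR ler_pM2r// invr_gt0.
  have [v0|v0] := leP 0 v.
    have [c + ->] := MVT_segment v0 (dg' _ _) (cw _ _).
    rewrite in_itv/= => /andP[c0 cv]; apply: key; first by rewrite !ger0_norm.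
    by rewrite subr0.
  have [c + h] := MVT_segment (ltW v0) (dg' _ _) (cw _ _).
  rewrite in_itv/= => /andP[vc c0]; rewrite distrC h; apply: key.
    by rewrite !ler0_norm ?lerN2// ltW.
  by rewrite sub0r normrN.
exists (K / k + `|g 0|) => [|v]; first by rewrite addr_ge0// divr_ge0// ltW.
rewrite -[g v](subrK (g 0)) (le_trans (ler_normD _ _))// mulrDl lerD//; last first.
  by rewrite ler_peMr// -expR0 ler_expR divr_ge0// ltW.
apply: le_trans (gb v) _; rewrite -!mulrA ler_wpM2l//.
have -> : `|v| / e2 = `|v| / e1 + k * `|v| by rewrite /k; ring.
rewrite expRD mulrCA ler_pM2l ?expR_gt0// mulrC ler_pdivlMr// mulrC.
by apply: le_trans (expR_ge1Dx _); rewrite lerDr.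
Qed.

Lemma exp_bounded_cst e c : 0 < e -> exp_bounded e (cst c).
Proof.
move=> e0; exists `|c| => // v /=; rewrite ler_peMr// -expR0 ler_expR divr_ge0//.
exact: ltW.
Qed.

Lemma exp_bounded_vanish eps e g : 0 < eps -> eps < e -> exp_bounded e g ->
  vanishes_at_ninfty (fun v => expR (v / eps) * g v).
Proof.
move=> eps0 epse [K K0 gK] d d0; have e0 : 0 < e by exact: lt_trans epse.
pose k := eps^-1 - e^-1.
have k0 : 0 < k by rewrite subr_gt0 ltf_pV2.
(* [K] may be 0; K + 1 is safe as a divisor inside the logarithm. *)
have K1 : 0 < K + 1 by rewrite ltr_wpDl.
exists (Num.min 0 (ln (d / (K + 1)) / k)) => v.
rewrite le_min => /andP[v0]; rewrite ler_pdivlMr// -ler_expR lnK ?posrE ?divr_gt0//.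
rewrite ler_pdivlMr// => vd; apply: le_trans vd.
rewrite normrM ger0_norm ?expR_ge0// (le_trans (ler_wpM2l (expR_ge0 _) (gK v)))//.
rewrite mulrCA -expRD ler0_norm// mulrC.
have -> : v / eps + - v / e = v * k by rewrite /k; ring.
by rewrite ler_wpM2l ?expR_ge0// lerDl.
Qed.
End ExpBounded.

Section ImproperLog.
Context {R : realType}.
Variables (eps : R).
Hypothesis eps0 : 0 < eps.
Implicit Types (g G : R -> R) (a L u t v e : R).

(** To reach [g] of either sign, a dominating exponential [h], for which [H] solves the equation
    explicitly, is added and subtracted again after integration. *)
Lemma log_piece_improper e a L u t g G v1 : eps < e -> exp_bounded e g ->
  0 < L -> a < t -> continuous g -> continuous G ->
  (forall v, v < v1 -> exists2 dG, is_derive v 1 G dG & G v + eps * dG = g v) ->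
  log_piece eps a L u t <= v1 ->
  vanishes_at_ninfty (fun v => expR (v / eps) * G v) ->
  has_int `]a, t] (g \o log_piece eps a L u) ((t - a) * G (log_piece eps a L u t)).
Proof.
move=> epse [K K0 gK] L0 at_ cg cG dG tv1 G0; set p := log_piece eps a L u t.
have e0 : 0 < e by exact: lt_trans epse.
(* Comes from |v| <= 2 |p| - v, valid for every v <= p. *)
pose K' := K * expR (2 * `|p| / e).
have K'0 : 0 <= K' by rewrite mulr_ge0// expR_ge0.
pose h v := K' * expR (- v / e).
(* The constant for which H + eps H' = h. *)
pose k := K' / (1 - eps / e).
have k1 : 0 < 1 - eps / e by rewrite subr_gt0 ltr_pdivrMr// mul1r.
pose H v := k * expR (- v / e).
have h0 v : 0 <= h v by rewrite mulr_ge0// expR_ge0.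
have gh v : v <= p -> `|g v| <= h v.
  move=> vp; apply: le_trans (gK v) _; rewrite /h /K' -mulrA ler_wpM2l// -expRD ler_expR.
  rewrite -mulrDl ler_pM2r ?invr_gt0//.
  have := ler_norm p; have := normr_ge0 p.
  by have [v0|v0] := leP 0 v; [rewrite (ger0_norm v0)|rewrite (ltr0_norm v0)]; lra.
have dE v c : is_derive v 1 (fun r : R => c * expR (- r / e)) (- (c / e) * expR (- v / e)).
  have d1 : is_derive v 1 (fun r : R => - r / e) (- e^-1).
    by apply: is_derive_eq; rewrite scaler0 add0r /GRing.scale/=; ring.
  have d2 := @is_derive1_comp R (@expR R) (fun r : R => - r / e) v _ _ (is_derive_expR _) d1.
  have -> : (fun r : R => c * expR (- r / e)) = c \*: (@expR R \o (fun r : R => - r / e)).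
    by apply/funext.
  by apply: is_derive_eq; rewrite /GRing.scale/=; ring.
have cE c : continuous (fun r : R => c * expR (- r / e)).
  by move=> v; apply: differentiable_continuous; apply/derivable1_diffP; have [] := dE v c.
have HE v : H v + eps * (- (k / e) * expR (- v / e)) = h v.
  by rewrite /H /h /k; field; rewrite !gt_eqF//; lra.
have H0 : vanishes_at_ninfty (fun v => expR (v / eps) * H v).
  apply: (exp_bounded_vanish eps0 epse); exists k; first by rewrite divr_ge0// ltW.
  move=> v; rewrite normrM (ger0_norm (expR_ge0 _)) ger0_norm; last first.
    by rewrite divr_ge0// ltW.
  rewrite ler_wpM2l ?divr_ge0 ?(ltW k1)// ler_expR ler_pM2r ?invr_gt0//.
  by rewrite -normrN; exact: ler_norm.
have iH := log_piece_improper_ge0 eps0 L0 at_ (cE K') (cE k)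
  (fun v _ => ex_intro2 _ _ _ (dE v k) (HE v)) tv1 (fun v _ => h0 v) H0.
have iGH : has_int `]a, t] ((g \+ h) \o log_piece eps a L u) ((t - a) * (G \+ H) p).
  apply: (log_piece_improper_ge0 eps0 L0 at_ _ _ _ tv1).
  - by move=> v; apply: continuousD; [exact: cg|exact: cE].
  - by move=> v; apply: continuousD; [exact: cG|exact: cE].
  - move=> v /dG[d dv Gg]; eexists; first exact: (is_deriveD dv (dE v k)).
    by rewrite /= -Gg -HE; ring.
  - by move=> v /gh; rewrite /=; have := ler_norm (- g v); rewrite normrN; lra.
  - move=> d d0; have d2 : 0 < d / 2 by rewrite divr_gt0.
    have [V1 h1] := G0 _ d2; have [V2 h2] := H0 _ d2.
    exists (Num.min V1 V2) => v; rewrite le_min => /andP[/h1 ? /h2 ?].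
    rewrite /= mulrDr (le_trans (ler_normD _ _))//; lra.
have := has_intD iGH (has_intZ (-1) iH).
have -> : (t - a) * (G \+ H) p + -1 * ((t - a) * H p) = (t - a) * G p by rewrite /=; ring.
by apply: has_int_ext => r _ /=; rewrite /h; ring.
Qed.
End ImproperLog.

(** * Flow along right tangents *)

Section Flow.
Context {R : realType}.
Variables (f : R -> R) (eps : R) (B : R * R -> R).
Hypothesis eps0 : 0 < eps.
Implicit Types (u v w : R).

Definition free_point w : R * R := (w, w ^+ 2 + eps ^+ 2).

(* [right_flow u]: the upper end of the right tangent at [u] has a nondecreasing
   optimizer bounded by [u], to which larger values can be appended. *)
Definition right_flow u : Prop :=
  left_point f eps (free_point (u - eps)) u (B (free_point (u - eps))).

Definition free_value u : R := B (free_point (u - eps)).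

Definition strip_ode v0 v1 : Prop := forall v, v0 < v -> v < v1 ->
  exists2 d, is_derive v 1 free_value d & free_value v + eps * d = f v.

Let is_derive_id_prim v : is_derive v 1 (fun v : R => v - eps) 1.
Proof. by apply: is_derive_eq; rewrite subr0. Qed.

Let is_derive_sq_prim v :
  is_derive v 1 (fun v : R => (v - eps) ^+ 2 + eps ^+ 2) (2 * (v - eps)).
Proof.
by apply: is_derive_eq; rewrite /GRing.scale/=; ring.
Qed.

(** This and the next equation are why a logarithmic piece carries the Bellman point along the free
    boundary. *)
Let id_ode v : exists2 d, is_derive v 1 (fun v : R => v - eps) d & v - eps + eps * d = v.
Proof. by exists 1 => //; ring. Qed.

Let sq_ode v : exists2 d, is_derive v 1 (fun v : R => (v - eps) ^+ 2 + eps ^+ 2) d &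
  (v - eps) ^+ 2 + eps ^+ 2 + eps * d = v ^+ 2.
Proof. by exists (2 * (v - eps)) => //; ring. Qed.

Let sq_continuous : continuous (fun v : R => v ^+ 2).
Proof. by move=> v; exact: exprn_continuous. Qed.

Let id_prim_continuous : continuous (fun v : R => v - eps).
Proof.
move=> v; apply: differentiable_continuous; apply/derivable1_diffP.
by have [] := is_derive_id_prim v.
Qed.

Let sq_prim_continuous : continuous (fun v : R => (v - eps) ^+ 2 + eps ^+ 2).
Proof.
move=> v; apply: differentiable_continuous; apply/derivable1_diffP.
by have [] := is_derive_sq_prim v.
Qed.

Let log_piece_end a b u : a < b -> log_piece eps a (b - a) u b = u.
Proof. by move=> ab; rewrite /log_piece divff ?subr_eq0 ?gt_eqF// ln1 mulr0 addr0. Qed.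

(** On the free boundary the tangent at the Bellman point itself serves, with integral exactly 0. *)
Let log_crit (a t : R) (phi : R -> R) :
  has_int `]a, t] phi ((t - a) * (phi t - eps)) ->
  has_int `]a, t] (fun s => phi s ^+ 2) ((t - a) * ((phi t - eps) ^+ 2 + eps ^+ 2)) ->
  a < t -> exists c w, [/\ phi t <= c + eps,
    has_int `]a, t] (fun s => (phi s - c) ^+ 2 - eps ^+ 2) w & w <= 0].
Proof.
move=> i1 i2 at_; exists (phi t - eps); eexists; split; first by rewrite subrK.
  exact: has_int_quad i1 i2 (has_int_itv_cst 1 (ltW at_)).
rewrite le_eqVlt; apply/orP; left; apply/eqP; ring.
Qed.

(** The profile for [v0] is compressed into ]a, m] and followed on ]m, b] by the logarithmic piece
    climbing from [v0] to [u]. Up to [m] it has the same averages that the piece itself would have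
    produced. *)
Lemma right_flow_extend v0 v1 u : continuous f -> continuous free_value ->
  strip_ode v0 v1 -> right_flow v0 -> v0 < u -> u <= v1 -> right_flow u.
Proof.
move=> cf cB ode rf v0u uv1 a b ab.
(* Where the logarithmic piece with value [u] at [b] takes the value [v0]. *)
pose m := a + (b - a) * expR ((v0 - u) / eps).
have L0 : 0 < b - a by rewrite subr_gt0.
have am : a < m by rewrite ltrDl mulr_gt0// expR_gt0.
have mb : m < b.
  rewrite -ltrBrDl -[ltRHS]mulr1 ltr_pM2l// -expR0 ltr_expR.
  by rewrite pmulr_llt0 ?invr_gt0// subr_lt0.
have [phi [nd le i1 i2 i3 crit]] := rf a m am.
set chi := log_piece eps a (b - a) u.
have chim : chi m = v0.
  rewrite /chi /log_piece /m addrAC subrr add0r mulrAC divff ?gt_eqF// mul1r expRK.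
  by field; rewrite gt_eqF.
have chib : chi b = u by exact: log_piece_end.
have chi_le s t : m <= s -> s <= t -> chi s <= chi t.
  by move=> ms; apply: log_piece_le => //; exact: lt_le_trans ms.
pose psi t := if t <= m then phi t else chi t.
have psi1 t : t <= m -> psi t = phi t by rewrite /psi => ->.
have psi2 t : m < t -> psi t = chi t by rewrite /psi leNgt => ->.
have cat (g G : R -> R) : continuous g -> continuous G ->
    (forall v, v0 < v -> v < v1 -> exists2 d, is_derive v 1 G d & G v + eps * d = g v) ->
    has_int `]a, m] (g \o phi) ((m - a) * G v0) -> forall t, m < t -> t <= b ->
    has_int `]a, t] (g \o psi) ((t - a) * G (chi t)).
  move=> cg cG dG iu t mt tb.
  have := @has_int_cat _ a m t (g \o psi) _ _ (ltW am) (ltW mt)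
     (has_int_itv_ext _ iu) (has_int_itv_ext _ (log_piece_int (u := u) (v1 := v1) eps0 L0 am mt cg cG _ _)).
  rewrite -/chi chim addrC subrK; apply.
  - by move=> s _ sm /=; rewrite psi1.
  - by move=> s ms _ /=; rewrite psi2.
  - exact: dG.
  - by apply: le_trans uv1; rewrite -chib; apply: chi_le => //; exact: ltW.
have j1 := cat id _ (fun v => cvg_id) id_prim_continuous (fun v _ _ => id_ode v) i1.
have j2 := cat (fun v => v ^+ 2) _ sq_continuous sq_prim_continuous (fun v _ _ => sq_ode v) i2.
have j3 := cat f _ cf cB ode i3.
exists psi; split.
- move=> s t as_ st tb; have [sm|ms] := leP s m; have [tm|mt] := leP t m.
  + by rewrite !psi1//; exact: nd.
  + rewrite psi1// psi2//; apply: le_trans (le _ as_ sm) _.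
    by rewrite -chim; apply: chi_le => //; exact: ltW.
  + by move: (lt_le_trans ms st); rewrite ltNge tm.
  + by rewrite !psi2//; apply: chi_le => //; exact: ltW.
- move=> t at_ tb; have [tm|mt] := leP t m.
    by rewrite psi1//; apply: le_trans (le _ at_ tm) (ltW v0u).
  by rewrite psi2// -chib; apply: chi_le => //; exact: ltW.
- by have := j1 b mb (lexx b); rewrite chib.
- by have := j2 b mb (lexx b); rewrite chib.
- by have := j3 b mb (lexx b); rewrite chib.
- move=> t at_ tb; have [tm|mt] := leP t m.
    have [c' [w [h1' h2' h3']]] := crit t at_ tm; exists c', w; split=> //.
      by rewrite psi1.
    by apply: has_int_itv_ext h2' => s _ st; rewrite psi1//; exact: le_trans tm.
  apply: log_crit => //; rewrite psi2//.
    exact: j1.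
  exact: j2.
Qed.

(** There is no earlier profile to continue: the logarithmic piece fills all of ]a, b]. *)
Lemma right_flow_ninfty e v1 u : eps < e -> exp_bounded e f ->
  continuous f -> continuous free_value ->
  (forall v, v < v1 -> exists2 d, is_derive v 1 free_value d & free_value v + eps * d = f v) ->
  vanishes_at_ninfty (fun v => expR (v / eps) * free_value v) ->
  u <= v1 -> right_flow u.
Proof.
move=> epse fe cf cB ode B0 uv1 a b ab.
have e0 : 0 < e by exact: lt_trans epse.
have L0 : 0 < b - a by rewrite subr_gt0.
set chi := log_piece eps a (b - a) u.
have chib : chi b = u by exact: log_piece_end.
have chi_le s t : a < s -> s <= t -> chi s <= chi t by move=> as_; exact: log_piece_le.
(* Rates for the identity and the square, each bounded as a primitive with some loss. *)
have [e1 ee1 e1e] : exists2 e1, eps < e1 & e1 < e.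
  by exists ((eps + e) / 2); rewrite ?midf_lt.
have e10 : 0 < e1 by exact: lt_trans ee1.
have [e2 ee2 e2e] : exists2 e2, eps < e2 & e2 < e1.
  by exists ((eps + e1) / 2); rewrite ?midf_lt.
have e20 : 0 < e2 by exact: lt_trans ee2.
have bid c : exp_bounded e1 (fun v : R => v - c).
  apply: (exp_bounded_primitive e10 e1e (dg := cst 1)); last exact: exp_bounded_cst.
  by move=> v; apply: is_derive_eq; rewrite subr0.
have bsq c k : exp_bounded e2 (fun v : R => (v - c) ^+ 2 + k).
  apply: (exp_bounded_primitive e20 e2e (dg := fun v => 2 * (v - c))).
    by move=> v; apply: is_derive_eq; rewrite /GRing.scale/=; ring.
  have [K K0 bK] := bid c; exists (2 * K); first by rewrite mulr_ge0.
  by move=> v; rewrite normrM ger0_norm// -mulrA ler_pM2l.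
have tv1 t : a < t -> t <= b -> chi t <= v1.
  by move=> at_ tb; apply: le_trans uv1; rewrite -chib; exact: chi_le.
have j1 t : a < t -> t <= b -> has_int `]a, t] chi ((t - a) * (chi t - eps)).
  move=> at_ tb; have := bid 0; have -> : (fun v : R => v - 0) = id.
    by apply/funext => v; rewrite subr0.
  move=> b0; have := log_piece_improper (u := u) (v1 := v1) eps0 ee1 b0 L0 at_ (fun v => cvg_id)
    id_prim_continuous _ (tv1 _ at_ tb) _; apply => //.
  exact: exp_bounded_vanish (bid eps).
have j2 t : a < t -> t <= b -> has_int `]a, t] (fun s => chi s ^+ 2)
    ((t - a) * ((chi t - eps) ^+ 2 + eps ^+ 2)).
  move=> at_ tb; have := bsq 0 0; have -> : (fun v : R => (v - 0) ^+ 2 + 0) = (fun v : R => v ^+ 2).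
    by apply/funext => v; rewrite subr0 addr0.
  move=> b0; have := log_piece_improper (u := u) (v1 := v1) eps0 ee2 b0 L0 at_ sq_continuous
    sq_prim_continuous _ (tv1 _ at_ tb) _; apply => //.
  exact: exp_bounded_vanish (bsq eps (eps ^+ 2)).
have j3 t : a < t -> t <= b -> has_int `]a, t] (f \o chi) ((t - a) * free_value (chi t)).
  by move=> at_ tb; apply: (log_piece_improper (u := u) (v1 := v1) eps0 epse fe) => //; exact: tv1.
exists chi; split.
- by move=> s t as_ st _; exact: chi_le.
- by move=> t at_ tb; rewrite -chib; exact: chi_le.
- by have := j1 b ab (lexx b); rewrite chib.
- by have := j2 b ab (lexx b); rewrite chib.
- by have := j3 b ab (lexx b); rewrite chib.
- by move=> t at_ tb; apply: log_crit => //; [exact: j1|exact: j2].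
Qed.
End Flow.

(** * Strips of tangents *)

Local Notation "f ^` ()" := (derive1 f) : ring_scope.

Section Growth.
Context {R : realType}.
Implicit Types (f g : R -> R) (e u v k K c t : R).

(** An increment of [g] is at most the variation over ]a, b]. If |t| <= M there, the weight is at
    least e^{-M/e}, so the finite weighted integral C gives the bound C e^{M/e}. *)
Lemma abs_conv_exp_bounded e g : 0 < e -> abs_conv_exp_d e g -> exp_bounded e g.
Proof.
move=> e0 [V TV iV].
pose lV := lebesgue_stieltjes_measure V.
pose C := fine (\int[lV]_t (expR (- `|t| / e))%:E)%E.
have VE (a b : R) : a <= b -> lV `]a, b] = (V b - V a)%:E.
  move=> ab; rewrite /lV /lebesgue_stieltjes_measure /measure_extension/=.
  by rewrite measurable_mu_extE/= ?wlength_itv_bnd//; exact: is_ocitv.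
have ifn : (\int[lV]_t (expR (- `|t| / e))%:E)%E = C%:E.
  by rewrite /C fineK//; exact: integrable_fin_num.
have key (a b M : R) : a <= b -> (forall t, a < t -> t <= b -> `|t| <= M) ->
    `|g b - g a| <= C * expR (M / e).
  move=> ab tM; apply: (@le_trans _ _ (V b - V a)).
    by rewrite -lee_fin -TV//; exact: total_variation_ge.
  have m0 : measurable_fun (setT : set (measurableTypeR R)) (fun t => (expR (- `|t| / e))%:E).
    exact: measurable_int iV.
  have h1 : ((expR (- M / e))%:E * lV `]a, b] <=
      \int[lV]_(t in `]a, b]) (expR (- `|t| / e))%:E)%E.
    rewrite -integral_cst//; apply: ge0_le_integral => //.
    - by move=> t _; rewrite lee_fin expR_ge0.
    - exact: measurable_funS m0.
    - move=> t /=; rewrite in_itv/= => /andP[at_ tb].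
      by rewrite lee_fin ler_expR ler_pM2r ?invr_gt0// lerN2 tM.
  have h2 : (\int[lV]_(t in `]a, b]) (expR (- `|t| / e))%:E <= C%:E)%E.
    by rewrite -ifn; apply: ge0_subset_integral => // t _; rewrite lee_fin expR_ge0.
  move: (le_trans h1 h2); rewrite VE// -EFinM lee_fin mulrC mulNr expRN.
  by rewrite ler_pdivrMr ?expR_gt0.
have C0 : 0 <= C.
  rewrite -lee_fin -ifn; apply: integral_ge0 => t _; rewrite lee_fin expR_ge0//.
exists (C + `|g 0|) => [|v]; first by rewrite addr_ge0.
rewrite -[g v](subrK (g 0)) (le_trans (ler_normD _ _))// mulrDl lerD//; last first.
  by rewrite ler_peMr// -expR0 ler_expR divr_ge0// ltW.
have [v0|v0] := leP 0 v.
  apply: key => // t t0 tv; rewrite !ger0_norm//; exact: ltW.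
rewrite distrC; apply: key; first exact: ltW.
move=> t vt t0; rewrite (ler0_norm t0) (ltr0_norm v0); lra.
Qed.

Lemma has_int_expR_ninfty k K v : 0 < k -> 0 <= K ->
  has_int `]-oo, v] (fun t => K * expR (k * t)) (K / k * expR (k * v)).
Proof.
move=> k0 K0.
pose h (t : R) := K * expR (- k * t); pose H (t : R) := - (K / k) * expR (- k * t).
have dE c t : is_derive t 1 (fun r : R => c * expR (- k * r)) (- (c * k) * expR (- k * t)).
  have d1 : is_derive t 1 (fun r : R => - k * r) (- k).
    by apply: is_derive_eq; rewrite /GRing.scale/=; ring.
  have d2 := @is_derive1_comp R (@expR R) (fun r : R => - k * r) t _ _ (is_derive_expR _) d1.
  have -> : (fun r : R => c * expR (- k * r)) = c \*: (@expR R \o (fun r : R => - k * r)).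
    by apply/funext.
  by apply: is_derive_eq; rewrite /GRing.scale/=; ring.
have cE c : continuous (fun r : R => c * expR (- k * r)).
  by move=> t; apply: differentiable_continuous; apply/derivable1_diffP; have [] := dE c t.
have E : (\int[lebesgue_measure]_(t in `[(- v)%R, +oo[) (h t)%:E = 0%R%:E - (H (- v)%R)%:E)%E.
  apply: ge0_continuous_FTC2y.
  - by move=> t _; rewrite mulr_ge0// expR_ge0.
  - by apply: continuous_subspaceT; exact: cE.
  - apply/cvgrPdist_le => d d0; exists (K / k / (d * k)); split; first exact: num_real.
    move=> x Xx; rewrite sub0r normrN normrM normrN (ger0_norm (expR_ge0 _)).
    rewrite ger0_norm ?divr_ge0 ?(ltW k0)// mulNr expRN ler_pdivrMr ?expR_gt0//.
    move: Xx; rewrite ltr_pdivrMr ?mulr_gt0// => /ltW/le_trans; apply.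
    have -> : x * (d * k) = d * (k * x) by ring.
    by rewrite ler_pM2l//; apply: le_trans (expR_ge1Dx _); rewrite lerDr.
  - by move=> t _; have [] := dE (- (K / k)) t.
  - by apply: cvg_at_right_filter; exact: cE.
  - move=> t _; rewrite derive1E; have d := dE (- (K / k)) t.
    rewrite (@derive_val _ _ _ _ _ _ _ d) /h; field; rewrite gt_eqF//.
have hi : has_int `[- v, +oo[ h (K / k * expR (k * v)).
  split.
  - exact: measurable_itv.
  - apply/integrableP; split.
      by apply/measurable_EFinP; apply: measurable_funTS; apply: continuous_measurable_fun; exact: cE.
    under eq_integral do rewrite gee0_abs ?lee_fin ?mulr_ge0 ?expR_ge0//.
    by rewrite E -EFinD ltry.
  - by rewrite /Rintegral E/= /H mulrNN; ring.
have := has_intN hi; rewrite opp_preimage_itvbndy opprK.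
by apply: has_int_ext => t _; rewrite /h mulrNN.
Qed.

(** With g = f' this is the integral defining [m] on a strip lasting to -oo. For t <= v the
    integrand is dominated by K' v e^{k t}, k = 1/eps - 1/e, because |t| <= 2 max(v, 0) - t. *)
Lemma weighted_int eps e g : 0 < eps -> eps < e -> continuous g -> exp_bounded e g ->
  exists2 I, (forall v, has_int `]-oo, v] (fun t => g t * expR (t / eps)) (I v)) &
    vanishes_at_ninfty I.
Proof.
move=> eps0 epse cg [K K0 gK]; have e0 : 0 < e by exact: lt_trans epse.
pose k := eps^-1 - e^-1.
have k0 : 0 < k by rewrite subr_gt0 ltf_pV2.
pose q t := g t * expR (t / eps).
have cq : continuous q.
  move=> t; apply: (@continuousM R R g (fun t : R => expR (t / eps))); first exact: cg.
  apply: (@continuous_comp _ _ _ (fun t : R => t / eps) (@expR R)); last exact: continuous_expR.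
  by apply: cvgMr_tmp; exact: cvg_id.
pose m v := Num.max v 0.
pose K' v := K * expR (2 * m v / e).
have K'0 v : 0 <= K' v by rewrite mulr_ge0// expR_ge0.
have qh v t : t <= v -> `|q t| <= K' v * expR (k * t).
  move=> tv; rewrite normrM (ger0_norm (expR_ge0 _)).
  apply: le_trans (ler_wpM2r (expR_ge0 _) (gK t)) _.
  rewrite /K' -[leLHS]mulrA -[leRHS]mulrA ler_wpM2l// -!expRD ler_expR.
  have -> : t / eps = t / e + k * t by rewrite /k; ring.
  rewrite addrA lerD2r -mulrDl ler_pM2r ?invr_gt0//.
  have vm : v <= m v by rewrite le_max lexx.
  have m0 : 0 <= m v by rewrite le_max lexx orbT.
  by have [t0|t0] := leP 0 t; [rewrite (ger0_norm t0)|rewrite (ltr0_norm t0)]; lra.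
have hi v := has_int_expR_ninfty v k0 (K'0 v).
have qi v : exists I, has_int `]-oo, v] q I /\ `|I| <= K' v / k * expR (k * v).
  have [mv ih hE] := hi v.
  have iq : (@lebesgue_measure R).-integrable `]-oo, v] (EFin \o q).
    apply: le_integrable ih => //.
      by apply/measurable_EFinP; apply: measurable_funTS; exact: continuous_measurable_fun.
    move=> t /=; rewrite in_itv/= => tv; rewrite lee_fin (le_trans (qh _ _ tv))//.
    exact: ler_norm.
  have iq' : has_int `]-oo, v] q (\int[lebesgue_measure]_(t in `]-oo, v]) q t)%R by [].
  eexists; split; first exact: iq'.
  rewrite ler_norml; apply/andP; split.
    rewrite -mulN1r; apply: has_int_le (has_intZ (-1) (hi v)) iq' _ => t /=.
    by rewrite in_itv/= => /qh; rewrite ler_norml mulN1r => /andP[].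
  apply: has_int_le iq' (hi v) _ => t /=.
  by rewrite in_itv/= => /qh; rewrite ler_norml => /andP[].
exists (fun v => projT1 (cid (qi v))) => [v|d d0]; first by have [] := projT2 (cid (qi v)).
have p : 0 < d * k / (K + 1) by rewrite divr_gt0 ?mulr_gt0// ltr_wpDl.
exists (Num.min 0 (ln (d * k / (K + 1)) / k)) => v.
rewrite le_min => /andP[v0]; rewrite ler_pdivlMr// -ler_expR lnK ?posrE//.
rewrite ler_pdivlMr ?ltr_wpDl// => vd.
have [_] := projT2 (cid (qi v)); move/le_trans; apply.
rewrite mulrAC ler_pdivrMr//; apply: le_trans vd.
rewrite /K' /m max_r// mulr0 mul0r expR0 mulr1 mulrC [v * k]mulrC.
by rewrite ler_wpM2l ?expR_ge0// lerDl.
Qed.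
End Growth.

Section Strips.
Context {R : realType}.
Implicit Types (f : R -> R) (B : R * R -> R) (u v eps e : R).

Lemma near_lte (u1 : \bar R) v : (u1 < v%:E)%E -> \forall u \near v, (u1 < u%:E)%E.
Proof.
case: u1 => [r| |]//; last by move=> _; near=> u; exact: ltNyr.
by rewrite lte_fin => rv; near=> u; rewrite lte_fin; near: u; exact: lt_nbhsr.
Unshelve. all: by end_near. Qed.

Lemma near_gte (u2 : \bar R) v : (v%:E < u2)%E -> \forall u \near v, (u%:E < u2)%E.
Proof.
case: u2 => [r| |]//; last by move=> _; near=> u; exact: ltry.
by rewrite lte_fin => rv; near=> u; rewrite lte_fin; near: u; exact: lt_nbhsl.
Unshelve. all: by end_near. Qed.

(* What the flow uses of a standard candidate on a right tangent domain. *)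
Definition right_strip f eps (u1 u2 : \bar R) B : Prop :=
  [/\ forall u h, (u1 <= u%:E <= u2)%E -> 0 <= h <= 1 ->
        B ((1 - h) * u + h * (u - eps),
           (1 - h) * u ^+ 2 + h * ((u - eps) ^+ 2 + eps ^+ 2)) =
        (1 - h) * f u + h * free_value eps B u,
      forall v, (u1 < v%:E < u2)%E -> exists2 d, is_derive v 1 (free_value eps B) d &
        free_value eps B v + eps * d = f v
    & u1 = -oo%E -> vanishes_at_ninfty (fun v => expR (v / eps) * free_value eps B v)].

(** A form shared by right candidates and reflected left ones: if [m] belongs to a left candidate, u
    -> - m (- u) satisfies the right equation for f o (-). *)
Definition tanR_weak f eps (u1 u2 : \bar R) B : Prop :=
  exists m : R -> R,
    [/\ forall u x, (u1 <= u%:E <= u2)%E -> right_tangent eps u x ->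
          B x = m u * (x.1 - u) + f u,
        forall u, (u1 < u%:E < u2)%E ->
          exists2 d, is_derive u 1 m d & eps * d + m u = f^`() u
      & u1 = -oo%E -> forall u, (u%:E <= u2)%E ->
          m u = eps^-1 * expR (- u / eps) *
            (\int[lebesgue_measure]_(t in `]-oo, u]) (f^`() t * expR (t / eps)))%R].

Lemma tanR_candidate_weak f eps (u1 u2 : \bar R) B :
  tanR_candidate f eps u1 u2 B -> tanR_weak f eps u1 u2 B.
Proof.
move=> [m [h1 h2 h3]]; exists m; split=> // u /h2[dm _ mE _].
by exists (m^`() u) => //; rewrite derive1E; exact/derivableP.
Qed.

(** On the strip [free_value] is f - eps m. At -oo its product with e^{v/eps} is e^{v/eps} f minus
    the weighted integral of f', and both terms tend to 0. *)
Lemma tanR_weak_strip f eps e (u1 u2 : \bar R) B : 0 < eps -> eps < e ->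
  (forall v, is_derive v 1 f (f^`() v)) -> continuous f^`() ->
  exp_bounded e f -> exp_bounded e f^`() -> (u1 < u2)%E ->
  tanR_weak f eps u1 u2 B -> right_strip f eps u1 u2 B.
Proof.
move=> eps0 epse df cf' bf bf' u12 [m [h1 h2 h3]].
have seg u h : 0 <= h <= 1 -> right_tangent eps u
    ((1 - h) * u + h * (u - eps), (1 - h) * u ^+ 2 + h * ((u - eps) ^+ 2 + eps ^+ 2)).
  by move=> h01; exists h.
have fvE u : (u1 <= u%:E <= u2)%E -> free_value eps B u = f u - eps * m u.
  move=> hu; rewrite /free_value (h1 u)//=; first by ring.
  exists 1; first by rewrite ler01 lexx.
  by rewrite /free_point/= subrr !mul0r !mul1r !add0r.
split.
- move=> u h hu h01; rewrite (h1 u _ hu (seg u h h01))/= fvE//; ring.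
- move=> v hv; have [d dm mE] := h2 v hv; have /andP[u1v vu2] := hv.
  have nearE : {near v, (fun u => f u - eps * m u) =1 free_value eps B}.
    apply: filterS2 (near_lte u1v) (near_gte vu2) => u a b.
    by rewrite fvE// !ltW.
  have dG : is_derive v 1 (fun u => f u - eps * m u) (f^`() v - eps * d).
    have := df v => df_v; apply: is_derive_eq; rewrite /GRing.scale/=; ring.
  exists (f^`() v - eps * d).
    have [dG1 dG2] := dG; split; first exact: near_eq_derivable nearE dG1.
    by rewrite -(near_eq_derive _ nearE).
  by rewrite fvE ?(ltW u1v) ?(ltW vu2)// -mE; ring.
- move=> u1E; have [I hI I0] := weighted_int eps0 epse cf' bf'.
  have bf0 := exp_bounded_vanish eps0 epse bf.
  move=> d d0; have d2 : 0 < d / 2 by rewrite divr_gt0.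
  have [V1 hV1] := bf0 _ d2; have [V2 hV2] := I0 _ d2.
  (* Keeps v below [u2], where the formula for [m] is available. *)
  have [V3 hV3] : exists V, (V%:E <= u2)%E.
    have : u2 != -oo%E by rewrite -ltNye -u1E.
    by clear; case: u2 => // [r _|_]; [exists r|exists 0; rewrite leey].
  exists (Num.min V1 (Num.min V2 V3)) => v; rewrite !le_min => /and3P[v1 v2 v3].
  have vu2 : (v%:E <= u2)%E by apply: le_trans hV3; rewrite lee_fin.
  rewrite fvE; last by rewrite u1E leNye.
  have -> : expR (v / eps) * (f v - eps * m v) = expR (v / eps) * f v - I v.
    rewrite (h3 u1E v vu2); have [_ _ ->] := hI v.
    rewrite mulrBr; congr (_ - _); rewrite mulNr expRN; field.
    by rewrite !gt_eqF ?expR_gt0.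
  by rewrite (le_trans (ler_normB _ _))//; have := hV1 _ v1; have := hV2 _ v2; lra.
Qed.

(** Regularity and growth in a form stable under reflection. *)
Definition tame eps f : Prop := exists2 e, eps < e &
  [/\ forall v, is_derive v 1 f (f^`() v), continuous f^`(),
      exp_bounded e f & exp_bounded e f^`()].

(** The bound on f'' is integrated twice; the room between [eps] and [epsoo] pays for both losses of
    rate. *)
Lemma regular_tame epsoo eps f : 0 < epsoo -> 0 < eps -> eps < epsoo ->
  regularity_condition f -> summability_condition epsoo f -> tame eps f.
Proof.
move=> epsoo0 eps0 epsle [[df ddf cf2] _] sf.
have [e1 ee1 e1e] : exists2 e1, eps < e1 & e1 < epsoo.
  by exists ((eps + epsoo) / 2); rewrite ?midf_lt.
have e10 : 0 < e1 by exact: lt_trans ee1.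
have [e2 ee2 e2e] : exists2 e2, eps < e2 & e2 < e1.
  by exists ((eps + e1) / 2); rewrite ?midf_lt.
have e20 : 0 < e2 by exact: lt_trans ee2.
have d1 v : is_derive v 1 f (f^`() v) by rewrite derive1E; exact/derivableP.
have d2 v : is_derive v 1 f^`() (f^`()^`() v) by rewrite derive1E; exact/derivableP.
have b2 : exp_bounded epsoo f^`()^`() by exact: abs_conv_exp_bounded.
have b1 := exp_bounded_primitive e10 e1e d2 b2.
have b0 := exp_bounded_primitive e20 e2e d1 b1.
exists e2; [exact: ee2|split; [exact: d1| |exact: b0|]].
  by move=> v; apply: differentiable_continuous; exact/derivable1_diffP.
have [K K0 bK] := b1; exists K => // v; apply: le_trans (bK v) _.
by rewrite ler_wpM2l// ler_expR ler_wpM2l// lef_pV2// ltW.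
Qed.

Lemma tame_continuous eps f : tame eps f -> continuous f.
Proof.
move=> [e _ [df _ _ _]] v; apply: differentiable_continuous; apply/derivable1_diffP.
by have [] := df v.
Qed.

Lemma is_derive_oppr f v d : is_derive (- v) 1 f d -> is_derive v 1 (f \o -%R) (- d).
Proof.
move=> df; have d1 : is_derive v 1 (-%R : R -> R) (- 1) by apply: is_derive_eq.
by have := is_derive1_comp df d1; rewrite mulrN1.
Qed.

Lemma derive1_oppr eps f v : tame eps f -> (f \o -%R)^`() v = - f^`() (- v).
Proof.
move=> [e _ [df _ _ _]]; rewrite derive1E.
exact: (@derive_val _ _ _ _ _ _ _ (is_derive_oppr (df (- v)))).
Qed.

Lemma tame_oppr eps f : tame eps f -> tame eps (f \o -%R).
Proof.
move=> tf; have [e ee [df cf' bf bf']] := tf; exists e => //.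
have fE : (f \o -%R)^`() = (fun v => - f^`() (- v)).
  by apply/funext => v; rewrite (derive1_oppr _ tf).
split.
- by move=> v; rewrite fE; exact: is_derive_oppr.
- rewrite fE => v; apply: cvgN; apply: (@continuous_comp _ _ _ -%R f^`()).
    exact: oppr_continuous.
  exact: cf'.
- exact: exp_boundedN.
- have [K K0 bK] := exp_boundedN bf'; exists K => // v; rewrite fE normrN; exact: bK.
Qed.

Definition reflect (x : R * R) : R * R := (- x.1, x.2).

Lemma reflectK : involutive reflect.
Proof. by move=> [x y]; rewrite /reflect/= opprK. Qed.

Lemma left_right_tangent eps u x : right_tangent eps u x ->
  left_tangent eps (- u) (reflect x).
Proof.
move=> [h h01 ->]; exists h => //; rewrite /reflect/=; congr (_, _); ring.
Qed.

Lemma ereal_itv_opp (u1 u2 : \bar R) u :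
  ((- u2 <= u%:E <= - u1) = (u1 <= (- u)%:E <= u2))%E.
Proof. by rewrite EFinN leeNl andbC leeNr. Qed.

Lemma tanL_candidate_weak f eps (u1 u2 : \bar R) B : 0 < eps -> tame eps f ->
  tanL_candidate f eps u1 u2 B ->
  tanR_weak (f \o -%R) eps (- u2)%E (- u1)%E (B \o reflect).
Proof.
move=> eps0 tf [m [h1 h2 h3]]; exists (fun u => - m (- u)); split.
- move=> u x; rewrite ereal_itv_opp => hu /left_right_tangent xu.
  by rewrite /= (h1 _ _ hu xu)/=; ring.
- move=> u /andP[u2u uu1].
  have hu : (u1 < (- u)%:E < u2)%E by rewrite EFinN lteNr uu1 lteNl.
  have [dm _ mE _] := h2 _ hu.
  have dm' : is_derive (- u) 1 m (m^`() (- u)) by rewrite derive1E; exact/derivableP.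
  exists (m^`() (- u)).
    have -> : (fun u => - m (- u)) = - (m \o -%R) by apply/funext.
    have := is_derive_oppr dm' => d1; have := is_deriveN d1; rewrite opprK; exact.
  by rewrite (derive1_oppr _ tf) -mE; ring.
- move=> u2E u uu1; have u2oo : u2 = +oo%E by rewrite -[u2]oppeK u2E.
  have [e ee [df cf' _ bf']] := tame_oppr tf.
  have [I hI _] := weighted_int eps0 ee cf' bf'.
  have [_ _ ->] := hI u; have := has_intN (hI u).
  rewrite h3//; last by rewrite EFinN leeNr.
  have -> : -%R @^-1` `]-oo, u] = `[- u, +oo[%classic.
    by apply/seteqP; split=> t /=; rewrite !in_itv/= andbT lerNl.
  have E : {in `[- u, +oo[%classic, (fun t => (f \o -%R)^`() (- t) * expR (- t / eps)) =1
      (fun t => - 1 * (f^`() t * expR (- t / eps)))}.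
    by move=> t _; rewrite (derive1_oppr _ tf) opprK; ring.
  move=> /(has_int_ext E)/(has_intZ (-1)) [_ _].
  have -> : (fun t => -1 * (-1 * (f^`() t * expR (- t / eps)))) =
      (fun t => f^`() t * expR (- t / eps)).
    by apply/funext => t; ring.
  by move=> ->; ring.
Qed.

Lemma continuous_free_value eps B : 0 <= eps ->
  {within Omega eps, continuous B} -> continuous (free_value eps B).
Proof.
move=> eps0 /subspace_continuousP cB u.
have OW w : Omega eps (free_point eps w).
  by rewrite /Omega/= lerDl sqr_ge0 lexx.
apply: (cvg_comp (fun u => free_point eps (u - eps)) B _ (cB _ (OW (u - eps)))).
move=> A AW; have c : (fun u => free_point eps (u - eps)) x @[x --> u] -->
    free_point eps (u - eps).
  have c1 : (x - eps) @[x --> u] --> u - eps by apply: cvgB; [exact: cvg_id|exact: cvg_cst].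
  have c2 : ((x - eps) ^+ 2 + eps ^+ 2) @[x --> u] --> (u - eps) ^+ 2 + eps ^+ 2.
    apply: cvgD; last exact: cvg_cst.
    exact: (cvg_comp (fun x : R => x - eps) (fun x : R => x ^+ 2) c1 (@exprn_continuous _ 2 (u - eps))).
  exact: cvg_pair c1 c2.
apply: (@filterS _ (nbhs u) _ _ _ _ (c _ AW)) => x; apply; exact: OW.
Qed.

Lemma right_strip_flow f eps (u1 u2 : \bar R) B u : 0 < eps -> tame eps f ->
  continuous (free_value eps B) -> right_strip f eps u1 u2 B ->
  (u1 <= u%:E <= u2)%E -> (forall r, u1 = r%:E -> right_flow f eps B r) ->
  right_flow f eps B u.
Proof.
move=> eps0 tf cB [_ ode van] /andP[u1u uu2] flow1.
have cf := tame_continuous tf.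
case: u1 u1u ode van flow1 => [r ru ode _ flow1|//|_ ode van _].
  move: ru; rewrite lee_fin le_eqVlt => /predU1P[<-|ru]; first exact: flow1.
  apply: (right_flow_extend eps0 cf cB _ (flow1 _ erefl) ru (lexx u)).
  by move=> v rv vu; apply: ode; rewrite lte_fin rv (lt_le_trans _ uu2)// lte_fin.
have [e ee [_ _ bf _]] := tf.
apply: (right_flow_ninfty eps0 ee bf cf cB _ (van erefl) (lexx u)).
by move=> v vu; apply: ode; rewrite ltNyr (lt_le_trans _ uu2)// lte_fin.
Qed.
End Strips.

(** * Tangent coordinates and lines *)

Section TangentCoordinates.
Context {R : realType}.
Variable eps : R.
Hypothesis eps0 : 0 < eps.
Implicit Types (x y : R * R) (u w : R).

(* The abscissa distance from [x] to the points where the two tangents through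
   [x] touch the free boundary; [uR x] and [uL x] are the feet of the right and
   left tangents through [x]. *)
Definition half x : R := Num.sqrt (eps ^+ 2 - (x.2 - x.1 ^+ 2)).
Definition uR x : R := x.1 + eps - half x.
Definition uL x : R := x.1 - eps + half x.

Lemma half_ge0 x : 0 <= half x. Proof. exact: sqrtr_ge0. Qed.

Lemma sqr_half x : Omega eps x -> half x ^+ 2 = eps ^+ 2 - (x.2 - x.1 ^+ 2).
Proof. by move=> /andP[h1 h2]; rewrite sqr_sqrtr//; lra. Qed.

Lemma half_unique x h : 0 <= h -> h ^+ 2 = eps ^+ 2 - (x.2 - x.1 ^+ 2) -> half x = h.
Proof. by move=> h0 hE; rewrite /half -hE sqrtr_sqr ger0_norm. Qed.

Lemma half_le x : Omega eps x -> half x <= eps.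
Proof.
move=> Ox; have := sqr_half Ox; have /andP[h1 h2] := Ox => hE.
by rewrite -(@ler_pXn2r _ 2%N)// ?nnegrE ?half_ge0 ?(ltW eps0)// hE; lra.
Qed.

Lemma uR_reflect x : uR (reflect x) = - uL x.
Proof. by rewrite /uR /uL /half /= sqrrN; ring. Qed.

Lemma uL_reflect x : uL (reflect x) = - uR x.
Proof. by rewrite /uR /uL /half /= sqrrN; ring. Qed.

Lemma Omega_reflect x : Omega eps (reflect x) = Omega eps x.
Proof. by rewrite /Omega/= sqrrN. Qed.

Lemma Omega_free_point w : Omega eps (free_point eps w).
Proof. by rewrite /Omega/= lerDl sqr_ge0 lexx. Qed.

Lemma half_free_point w : half (free_point eps w) = 0.
Proof. by apply: half_unique => //=; ring. Qed.

Lemma uR_free_point w : uR (free_point eps w) = w + eps.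
Proof. by rewrite /uR half_free_point subr0. Qed.

Lemma uL_free_point w : uL (free_point eps w) = w - eps.
Proof. by rewrite /uL half_free_point addr0. Qed.

(** The point with parameter h on the tangent at [u] has [half] equal to (1 - h) eps. Tangent
    domains thereby become inequalities on [uR]. *)
Lemma right_tangentP u x : right_tangent eps u x <-> Omega eps x /\ uR x = u.
Proof.
split=> [[h /andP[h0 h1] ->]|[Ox <-]].
  have hE : half ((1 - h) * u + h * (u - eps),
      (1 - h) * u ^+ 2 + h * ((u - eps) ^+ 2 + eps ^+ 2)) = (1 - h) * eps.
    by apply: half_unique => /=; [rewrite mulr_ge0 ?subr_ge0// ltW|ring].
  split; last by rewrite /uR hE/=; ring.
  rewrite /Omega /=; have e2 : 0 <= eps ^+ 2 by rewrite sqr_ge0.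
  have h2 : 0 <= h * eps ^+ 2 * (2 - h).
    by apply: mulr_ge0; [exact: mulr_ge0|lra].
  have h3 : 0 <= (1 - h) ^+ 2 * eps ^+ 2 by rewrite mulr_ge0// sqr_ge0.
  by apply/andP; split; rewrite -subr_ge0; [move: h2|move: h3]; congr (0 <= _); ring.
have hle := half_le Ox; have hge := half_ge0 x; have hE := sqr_half Ox.
exists (1 - half x / eps).
  by rewrite subr_ge0 ler_pdivrMr// mul1r hle/= gerBl divr_ge0// ltW.
apply: injective_projections; rewrite /uR/=; first by field; rewrite gt_eqF.
have -> : x.2 = x.1 ^+ 2 + eps ^+ 2 - half x ^+ 2 by rewrite hE; ring.
by field; rewrite gt_eqF.
Qed.

Lemma left_tangentP u x : left_tangent eps u x <-> Omega eps x /\ uL x = u.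
Proof.
split=> [[h h01 ->]|[Ox <-]].
  have : right_tangent eps (- u) (reflect ((1 - h) * u + h * (u + eps),
      (1 - h) * u ^+ 2 + h * ((u + eps) ^+ 2 + eps ^+ 2))).
    by exists h => //; rewrite /reflect/=; congr (_, _); ring.
  by move=> /right_tangentP; rewrite Omega_reflect uR_reflect => -[? /oppr_inj].
have /right_tangentP : Omega eps (reflect x) /\ uR (reflect x) = - uL x.
  by rewrite Omega_reflect uR_reflect.
by move=> /left_right_tangent; rewrite opprK reflectK.
Qed.

Lemma Omega_RP (u1 u2 : \bar R) x :
  Omega_R eps u1 u2 x <-> Omega eps x /\ (u1 <= (uR x)%:E <= u2)%E.
Proof.
split=> [[u hu /right_tangentP[Ox uE]]|[Ox hu]]; first by rewrite uE.
by exists (uR x) => //; exact/right_tangentP.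
Qed.

Lemma Omega_LP (u1 u2 : \bar R) x :
  Omega_L eps u1 u2 x <-> Omega eps x /\ (u1 <= (uL x)%:E <= u2)%E.
Proof.
split=> [[u hu /left_tangentP[Ox uE]]|[Ox hu]]; first by rewrite uE.
by exists (uL x) => //; exact/left_tangentP.
Qed.

(* The line of slope [2 w] cutting the fixed boundary at [w - eta], [w + eta]. *)
Definition on_line w eta x : Prop := x.2 - 2 * w * x.1 + w ^+ 2 = eta ^+ 2.

Lemma on_line_near w eta x : 0 <= eta -> Omega eps x -> on_line w eta x ->
  w - eta <= x.1 <= w + eta.
Proof.
move=> e0 /andP[h _] hl; have : (x.1 - w) ^+ 2 <= eta ^+ 2 by rewrite -hl; lra.
rewrite -(@ler_sqrt _ _ (eta ^+ 2)) ?sqr_ge0// !sqrtr_sqr (ger0_norm e0) ler_norml.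
lra.
Qed.

Lemma on_right_tangent x : Omega eps x -> on_line (uR x - eps) eps x.
Proof. by move=> /sqr_half; rewrite /on_line /uR => h; lra. Qed.

(** [X0] lies on or above the line and [X1] on or below it, so the segment crosses it; a point of
    the line above the chord X0 X1 cannot be to the left of the crossing. *)
Lemma line_segment w eta (X0 X1 x : R * R) :
  X0.1 <= X1.1 -> eta ^+ 2 <= X0.2 - 2 * w * X0.1 + w ^+ 2 ->
  X1.2 - 2 * w * X1.1 + w ^+ 2 <= eta ^+ 2 -> X0.1 <= x.1 -> on_line w eta x ->
  (X1.2 - X0.2) * (x.1 - X0.1) <= (X1.1 - X0.1) * (x.2 - X0.2) ->
  exists2 h, 0 <= h <= 1 & on_line w eta
    ((1 - h) * X0.1 + h * X1.1, (1 - h) * X0.2 + h * X1.2) /\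
    (1 - h) * X0.1 + h * X1.1 <= x.1.
Proof.
rewrite /on_line => X01 k0 k1 Xx lx above.
pose K0 := X0.2 - 2 * w * X0.1 + w ^+ 2 - eta ^+ 2.
pose K1 := X1.2 - 2 * w * X1.1 + w ^+ 2 - eta ^+ 2.
have K0p : 0 <= K0 by rewrite /K0; lra.
have K1n : K1 <= 0 by rewrite /K1; lra.
have [K00|K0n] := eqVneq K0 0.
  exists 0; first by rewrite lexx ler01.
  by split; rewrite /= subr0 !mul1r !mul0r !addr0//; move: K00; rewrite /K0; lra.
have K0pos : 0 < K0 by rewrite lt_neqAle eq_sym K0n.
have dK : 0 < K0 - K1 by lra.
exists (K0 / (K0 - K1)).
  by rewrite divr_ge0 ?(ltW dK)//= ler_pdivrMr// mul1r; lra.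
split.
  apply/eqP; rewrite -subr_eq0; apply/eqP.
  have -> : (1 - K0 / (K0 - K1)) * X0.2 + K0 / (K0 - K1) * X1.2 -
    2 * w * ((1 - K0 / (K0 - K1)) * X0.1 + K0 / (K0 - K1) * X1.1) + w ^+ 2 - eta ^+ 2 =
    (1 - K0 / (K0 - K1)) * K0 + K0 / (K0 - K1) * K1 by rewrite /K0 /K1; ring.
  by field; rewrite gt_eqF.
rewrite /=.
have -> : (1 - K0 / (K0 - K1)) * X0.1 + K0 / (K0 - K1) * X1.1 =
   X0.1 + (X1.1 - X0.1) * K0 / (K0 - K1) by ring.
rewrite -lerBrDl ler_pdivrMr//.
have : (X1.1 - X0.1) * (x.2 - X0.2) =
   (X1.1 - X0.1) * (2 * w * (x.1 - X0.1)) - (X1.1 - X0.1) * K0.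
  by rewrite /K0 -lx; ring.
have : (X1.2 - X0.2) * (x.1 - X0.1) =
   (K1 - K0) * (x.1 - X0.1) + 2 * w * (X1.1 - X0.1) * (x.1 - X0.1).
  by rewrite /K0 /K1; ring.
lra.
Qed.
End TangentCoordinates.

(** * Optimizers on lines parallel to tangents of the free boundary *)

Section LineEnds.
Context {R : realType}.
Variable eps : R.
Hypothesis eps0 : 0 < eps.
Implicit Types (f : R -> R) (B : R * R -> R) (x y z : R * R) (u w p q h r l t eta : R).

(** Here [t] is the abscissa of the point to be reached; M <= w + eps is the bound under which the
    tangent at [w] may be used for gluing. *)
Definition left_end f (aff : R * R -> R) w eta t : Prop := exists y M,
  [/\ left_point f eps y M (aff y), on_line w eta y, y.1 <= t & M <= w + eps].

Definition right_end f aff w eta t : Prop :=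
  left_end (f \o -%R) (aff \o reflect) (- w) eta (- t).

Lemma affine_conv b0 b1 b2 h y z : affine b0 b1 b2
    ((1 - h) * y.1 + h * z.1, (1 - h) * y.2 + h * z.2) =
  (1 - h) * affine b0 b1 b2 y + h * affine b0 b1 b2 z.
Proof. by rewrite /affine/=; ring. Qed.

(** For eta <= eps the line is parallel to the tangent at [w] and not above it, so this tangent
    glues the two ends. *)
Lemma optimizer_line f B b0 b1 b2 w eta x : 0 <= eta <= eps -> on_line w eta x ->
  left_end f (affine b0 b1 b2) w eta x.1 -> right_end f (affine b0 b1 b2) w eta x.1 ->
  B x = affine b0 b1 b2 x -> admits_optimizer f eps B x.
Proof.
move=> /andP[eta0 etae] lx [y [M [ly oy yx Mw]]] [z [N [lz oz zx Nw]]] Bx.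
have ee : eta ^+ 2 <= eps ^+ 2 by rewrite lerXn2r// nnegrE// ltW.
have ey : excess eps w y <= 0 by move: oy; rewrite /on_line /excess; lra.
have ez : excess eps w (reflect z) <= 0.
  by move: oz; rewrite /on_line /excess /reflect/=; lra.
have rz : right_point f eps (reflect z) (- N) (affine b0 b1 b2 (reflect z)).
  by rewrite /right_point /reflect/= !opprK; case: (z) lz.
have [h h01 xE] : exists2 h, 0 <= h <= 1 &
    x = ((1 - h) * y.1 + h * (reflect z).1, (1 - h) * y.2 + h * (reflect z).2).
  have lineE t (v : R * R) : on_line w eta v -> v.1 = t -> v.2 = 2 * w * t - w ^+ 2 + eta ^+ 2.
    by rewrite /on_line => <- <-; ring.
  have oz' : on_line w eta (reflect z).
    by move: oz; rewrite /on_line /reflect/= => <-; ring.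
  have xz : x.1 <= (reflect z).1 by rewrite /reflect/=; lra.
  have [zy|zy] := eqVneq (reflect z).1 y.1.
    have yx1 : y.1 = x.1 by apply/le_anti; rewrite yx -zy.
    exists 0; first by rewrite lexx ler01.
    rewrite subr0 !mul1r !mul0r !addr0; apply: injective_projections => //=.
    by rewrite (lineE x.1 y)// (lineE x.1 x).
  have d0 : 0 < (reflect z).1 - y.1.
    by rewrite subr_gt0 lt_neqAle eq_sym zy (le_trans yx).
  exists ((x.1 - y.1) / ((reflect z).1 - y.1)).
    apply/andP; split; first by rewrite divr_ge0 ?(ltW d0)// subr_ge0.
    by rewrite ler_pdivrMr// mul1r lerD2r.
  apply: injective_projections => /=; first by field; rewrite gt_eqF.
  rewrite (lineE _ _ lx erefl) (lineE _ _ oy erefl); have /= -> := lineE _ _ oz' erefl.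
  by field; rewrite gt_eqF.
rewrite xE; apply: (optimizer_glue ly rz Mw _ ey ez h01); first by lra.
by rewrite -xE Bx {1}xE affine_conv.
Qed.

(** The line meets the fixed boundary at w - eta in [p, q]. If q <= w + eta, it cuts the chord from
    [p] to [q], whose points have two-valued profiles. Otherwise its part in Omega is nowhere
    strictly above that chord, and [x] can only be the common end over [p]. *)
Lemma left_end_bracket f b0 b1 b2 w eta p q x : 0 <= eta <= eps ->
  Omega eps x -> on_line w eta x -> p <= w - eta -> w - eta <= q -> q - p <= 2 * eps ->
  f p = affine b0 b1 b2 (parab p) -> f q = affine b0 b1 b2 (parab q) ->
  above_chord p q x -> left_end f (affine b0 b1 b2) w eta x.1.
Proof.
move=> /andP[eta0 etae] Ox lx pw wq pq fp fq /= ab.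
have /andP[n1 n2] := on_line_near eta0 Ox lx.
have lE : x.2 = 2 * w * x.1 - w ^+ 2 + eta ^+ 2 by move: lx; rewrite /on_line => <-; ring.
have [qw|wq'] := leP q (w + eta).
  have [|||||h h01 [oh hx]] := @line_segment R w eta (parab p) (parab q) x _ _ _ _ lx _.
  - by rewrite /=; lra.
  - by rewrite /=; nra.
  - by rewrite /=; nra.
  - by rewrite /=; lra.
  - have : (q - p) * ((p + q) * x.1 - p * q) <= (q - p) * x.2.
      by rewrite ler_wpM2l//; lra.
    by rewrite /=; lra.
  have lp : left_point f eps (parab p) p (affine b0 b1 b2 (parab p)).
    by rewrite -fp; exact: left_point_cst.
  have lpq := left_point_append (q := q) (c := q - eps) eps0 lp _ _ _ h01.
  exists ((1 - h) * (parab p).1 + h * (parab q).1, (1 - h) * (parab p).2 + h * (parab q).2), q.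
  split; [rewrite affine_conv -fq; apply: lpq|exact: oh|exact: hx|].
  - by lra.
  - by lra.
  - by rewrite /excess/=; nra.
  - by apply: le_trans qw _; rewrite lerD2l.
have xp : x.1 = p.
  have h1 : 0 <= (x.1 - p) * (x.1 - q) + (x.2 - x.1 ^+ 2).
    by move: ab; rewrite /above_chord/=; lra.
  have h2 : x.2 - x.1 ^+ 2 = (eta - (x.1 - w)) * (eta + (x.1 - w)) by rewrite lE; ring.
  apply/le_anti; rewrite (le_trans pw n1) andbT leNgt; apply/negP => px.
  have h3 : 0 < (x.1 - p) * (q - (w + eta)) by rewrite mulr_gt0//; lra.
  have h4 : 0 <= (w - eta - p) * (w + eta - x.1) by rewrite mulr_ge0//; lra.
  nra.
have pE : p = w - eta by lra.
exists (parab p), p; split.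
- by rewrite -fp; exact: left_point_cst.
- by rewrite /on_line /= pE; ring.
- by rewrite /= xp.
- by lra.
Qed.

(** The line passes between the two ends of the entering tangent; at the crossing, the flow's
    profile is followed by the constant [l]. As [x] is to the right of this tangent, it is to the
    right of the crossing. *)
Lemma left_end_flow f B b0 b1 b2 w eta l x : 0 <= eta <= eps ->
  Omega eps x -> on_line w eta x -> right_flow f eps B l -> l <= uR eps x ->
  w - eta <= l <= w + eta ->
  B (free_point eps (l - eps)) = affine b0 b1 b2 (free_point eps (l - eps)) ->
  f l = affine b0 b1 b2 (parab l) -> left_end f (affine b0 b1 b2) w eta x.1.
Proof.
move=> /andP[eta0 etae] Ox lx fl lx' /andP[wl lw] BE fE.
have ee : eta ^+ 2 <= eps ^+ 2 by rewrite lerXn2r// nnegrE// ltW.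
have h0 := half_ge0 eps x; have hE := sqr_half Ox.
have hx : x.1 - l + eps >= half eps x by move: lx'; rewrite /uR; lra.
have [|||||h h01 [oh hx']] := @line_segment R w eta (free_point eps (l - eps)) (parab l) x _ _ _ _ lx _.
- by rewrite /=; lra.
- by rewrite /=; have := sqr_ge0 (l - eps - w); nra.
- by rewrite /=; nra.
- by rewrite /=; lra.
- rewrite /=; have : half eps x ^+ 2 <= (x.1 - l + eps) ^+ 2.
    by rewrite lerXn2r// nnegrE; lra.
  rewrite hE => hh.
  have : 0 <= eps * ((x.1 - l + eps) ^+ 2 - (eps ^+ 2 - (x.2 - x.1 ^+ 2))).
    by apply: mulr_ge0; lra.
  by lra.
have lpq := left_point_append (q := l) (c := l - eps) eps0 fl _ _ _ h01.
exists ((1 - h) * (free_point eps (l - eps)).1 + h * (parab l).1,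
  (1 - h) * (free_point eps (l - eps)).2 + h * (parab l).2), l.
split; [rewrite affine_conv -fE -BE; apply: lpq|exact: oh|exact: hx'|].
- by [].
- by lra.
- by rewrite /excess/=; lra.
- by lra.
Qed.

(** Along the right tangent at [r], the value [r] is appended to a left end until the free boundary
    is reached. *)
Lemma flow_from_left_end f B b0 b1 b2 r :
  left_end f (affine b0 b1 b2) (r - eps) eps (r - eps) ->
  B (free_point eps (r - eps)) = affine b0 b1 b2 (free_point eps (r - eps)) ->
  f r = affine b0 b1 b2 (parab r) -> right_flow f eps B r.
Proof.
move=> [y [M [ly oy yr Mr]]] BE fE; rewrite subrK in Mr.
have d0 : 0 < r - y.1 by rewrite subr_gt0 (le_lt_trans yr)// gtrBl.
pose h := (r - eps - y.1) / (r - y.1).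
have h01 : 0 <= h <= 1.
  apply/andP; split; first by rewrite divr_ge0 ?(ltW d0)// subr_ge0.
  by rewrite ler_pdivrMr//; have := eps0; lra.
have ey : excess eps (r - eps) y <= 0 by move: oy; rewrite /on_line /excess; lra.
have := left_point_append (q := r) (c := r - eps) eps0 ly Mr _ ey h01.
have -> : ((1 - h) * y.1 + h * r, (1 - h) * y.2 + h * r ^+ 2) = free_point eps (r - eps).
  have -> : y.2 = 2 * (r - eps) * y.1 - (r - eps) ^+ 2 + eps ^+ 2.
    by move: oy; rewrite /on_line => <-; ring.
  by apply: injective_projections; rewrite /h/=; field; rewrite gt_eqF.
have e : affine b0 b1 b2 (free_point eps (r - eps)) =
    (1 - h) * affine b0 b1 b2 y + h * f r.
  rewrite fE -affine_conv; congr affine.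
  have yE : y.2 = 2 * (r - eps) * y.1 - (r - eps) ^+ 2 + eps ^+ 2.
    by move: oy; rewrite /on_line => <-; ring.
  by apply: injective_projections; rewrite /h/= ?yE; field; rewrite gt_eqF.
by rewrite /right_flow BE e; apply; have := eps0; lra.
Qed.

(** The midpoint of a long chord lies on the free boundary; its profile takes the values [p] and [q]
    on halves. *)
Lemma flow_from_chord f B (p q : R) : q - p = 2 * eps ->
  B (free_point eps (q - eps)) = (f p + f q) / 2 -> right_flow f eps B q.
Proof.
move=> pq BE.
have := left_point_append (q := q) (c := q - eps) (h := 2^-1) eps0 (left_point_cst f eps0 p).
rewrite /right_flow BE /excess /=.
have -> : ((1 - 2^-1) * p + 2^-1 * q, (1 - 2^-1) * p ^+ 2 + 2^-1 * q ^+ 2) = free_point eps (q - eps).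
  have -> : q = p + 2 * eps by lra.
  by apply: injective_projections => /=; field.
have -> : (1 - 2^-1) * f p + 2^-1 * f q = (f p + f q) / 2 by field.
have -> : p = q - 2 * eps by lra.
apply; have := eps0; lra.
Qed.
End LineEnds.

(** * Figures near the free boundary *)

Section NearArc.
Context {R : realType}.
Variable eps : R.
Hypothesis eps0 : 0 < eps.
Implicit Types (x : R * R) (u w d r : R) (A G P Q : set (R * R)).

Definition near_arc w P : Prop := exists2 d, 0 < d & forall x, Omega eps x ->
  `|x.1 - w| < d -> `|x.2 - (w ^+ 2 + eps ^+ 2)| < d -> P x.

Lemma near_arcI w P Q : near_arc w P -> near_arc w Q -> near_arc w (P `&` Q).
Proof.
move=> [d d0 h] [d' d'0 h']; exists (Num.min d d'); first by rewrite lt_min d0.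
by move=> x Ox; rewrite !lt_min => /andP[? ?] /andP[? ?]; split; [exact: h|exact: h'].
Qed.

Lemma near_arcS w P Q : (forall x, Omega eps x -> P x -> Q x) ->
  near_arc w P -> near_arc w Q.
Proof. by move=> PQ [d d0 h]; exists d => // x Ox h1 h2; apply: PQ => //; exact: h. Qed.

Lemma near_arc_half w d : 0 < d -> near_arc w [set x | `|x.1 - w| < d /\ half eps x <= d].
Proof.
(* The vertical error d^2/K and the error (2|w| + 1) d^2/K of x.1^2 add up to d^2. *)
move=> d0; pose K := 2 + 2 * `|w|.
have K0 : 0 < K by rewrite /K; have := normr_ge0 w; lra.
exists (Num.min (Num.min 1 d) (d ^+ 2 / K)).
  by rewrite !lt_min ltr01 d0/= divr_gt0// exprn_gt0.
move=> x Ox; rewrite !lt_min => /andP[/andP[x1 xd] xK] /andP[/andP[y1 yd] yK].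
split=> //; rewrite -(@ler_pXn2r _ 2%N)// ?nnegrE ?half_ge0 ?(ltW d0)// (sqr_half Ox).
have : x.1 ^+ 2 - w ^+ 2 <= d ^+ 2 / K * (2 * `|w| + 1).
  have -> : x.1 ^+ 2 - w ^+ 2 = (x.1 - w) * (x.1 + w) by ring.
  apply: le_trans (ler_norm _) _; rewrite normrM; apply: ler_pM => //; first exact: ltW.
  have -> : x.1 + w = 2 * w + (x.1 - w) by ring.
  by rewrite (le_trans (ler_normD _ _))// normrM ger0_norm// lerD2l ltW.
have : d ^+ 2 / K * K = d ^+ 2 by rewrite divfK// gt_eqF.
move: yK; rewrite ltr_norml => /andP[yK _]; rewrite /K in yK *; lra.
Qed.

Lemma near_arc_uR_ge w r : r < w + eps -> near_arc w [set x | r <= uR eps x].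
Proof.
move=> rw; have d0 : 0 < (w + eps - r) / 2 by lra.
apply: near_arcS (near_arc_half w d0) => x _ [] /=; rewrite /uR ltr_norml; lra.
Qed.

Lemma near_arc_uR_le w r : w + eps < r -> near_arc w [set x | uR eps x <= r].
Proof.
move=> rw; have d0 : 0 < (r - w - eps) / 2 by lra.
apply: near_arcS (near_arc_half w d0) => x _ [] /=; rewrite /uR ltr_norml.
have := half_ge0 eps x; lra.
Qed.

Lemma near_arc_uL_ge w r : r < w - eps -> near_arc w [set x | r <= uL eps x].
Proof.
move=> rw; have d0 : 0 < (w - eps - r) / 2 by lra.
apply: near_arcS (near_arc_half w d0) => x _ [] /=; rewrite /uL ltr_norml.
have := half_ge0 eps x; lra.
Qed.

Lemma near_arc_uL_le w r : w - eps < r -> near_arc w [set x | uL eps x <= r].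
Proof.
move=> rw; have d0 : 0 < (r - w + eps) / 2 by lra.
apply: near_arcS (near_arc_half w d0) => x _ [] /=; rewrite /uL ltr_norml; lra.
Qed.

Lemma near_arc_reflect w P : near_arc w P -> near_arc (- w) (reflect @^-1` P).
Proof.
move=> [d d0 h]; exists d => // x Ox; rewrite sqrrN => h1 h2; apply: h => //=.
  by rewrite Omega_reflect.
by rewrite -normrN; have -> : - (- x.1 - w) = x.1 - - w by ring.
Qed.

(* Short chords meet the free boundary at most at one point. *)
Lemma near_arc_above_chord w p q : q - p <= 2 * eps -> p <= q -> w != (p + q) / 2 ->
  near_arc w (above_chord p q).
Proof.
(* A lower bound for the height of the free boundary point over the chord. *)
move=> pq p_q wpq; pose c := (w - (p + q) / 2) ^+ 2.
have c0 : 0 < c by rewrite exprn_even_gt0//= subr_eq0.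
pose K := 1 + `|p + q|; have K0 : 0 < K by rewrite /K; have := normr_ge0 (p + q); lra.
exists (c / K); first by rewrite divr_gt0.
move=> x _; rewrite !ltr_norml => /andP[x1 x2] /andP[y1 y2]; rewrite /above_chord/=.
have cK : c / K * K = c by rewrite divfK// gt_eqF.
have h1 : (p + q) * (x.1 - w) <= `|p + q| * (c / K).
  apply: le_trans (ler_norm _) _; rewrite normrM ler_wpM2l// ltW// ltr_norml x1//.
have h2 : 0 <= (2 * eps - (q - p)) * (2 * eps + (q - p)).
  by apply: mulr_ge0; have := eps0; lra.
rewrite /K in cK; rewrite /c in cK x1 x2 y1 y2 h1 *; rewrite -/c in cK x1 x2 y1 y2 h1 *.
have cE : c = w ^+ 2 - (p + q) * w + (p + q) ^+ 2 / 4 by rewrite /c; field.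
lra.
Qed.

Lemma above_chord_free_point w p q : q - p <= 2 * eps -> p <= q ->
  above_chord p q (free_point eps w).
Proof.
move=> pq p_q; rewrite /above_chord/=.
have h1 : 0 <= (2 * eps - (q - p)) * (2 * eps + (q - p)).
  by apply: mulr_ge0; have := eps0; lra.
have := sqr_ge0 (w - (p + q) / 2); lra.
Qed.

(** The list [M] allows for gaps of length 2 eps: their chord touches the free boundary at its
    midpoint, near which a domain above its gaps omits points of Omega. *)
Definition fine_right A w : Prop := exists d (M : seq R), 0 < d /\
  forall w', w < w' -> w' < w + d -> w' \notin M -> near_arc w' A.

Lemma avoid_seq (a b : R) (M : seq R) : a < b ->
  exists w, [/\ a < w, w < b & w \notin M].
Proof.
move=> ab; suff [a' [b' [? ? ? h]]] : exists a' b', [/\ a <= a', a' < b', b' <= b &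
    forall w, a' < w -> w < b' -> w \notin M].
  exists ((a' + b') / 2); split; [lra|lra|apply: h; lra].
elim: M => [|m M [a' [b' [aa ab' bb h]]]]; first by exists a, b; split.
have [mb|bm] := ltP m b'; last first.
  exists a', b'; split=> // w aw wb; rewrite inE negb_or h// andbT lt_eqF//.
  exact: lt_le_trans bm.
exists (Num.max a' m), b'; split; [by rewrite le_max aa|by rewrite gt_max ab'|by []|].
move=> w; rewrite gt_max => /andP[aw mw] wb.
by rewrite inE negb_or h// andbT gt_eqF.
Qed.

(** At a free boundary point outside both lists, a small box slightly below the boundary lies in
    both sets. *)
Lemma fine_right_interior A A' w : fine_right A w -> fine_right A' w ->
  exists x, (A° `&` A'°) x.
Proof.
move=> [d [M [d0 h]]] [d' [M' [d'0 h']]].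
have [|v [wv vd vM]] := @avoid_seq w (w + Num.min d d') (M ++ M').
  by rewrite ltrDl lt_min d0.
move: vM; rewrite mem_cat negb_or => /andP[vM vM'].
have [||r r0 hr] := near_arcI (h v wv _ vM) (h' v wv _ vM').
- by apply: lt_le_trans vd _; rewrite lerD2l ge_min lexx.
- by apply: lt_le_trans vd _; rewrite lerD2l ge_min lexx orbT.
have [s [s0 sr se]] : exists s, [/\ 0 < s, s < r & s < eps ^+ 2].
  exists (Num.min r (eps ^+ 2) / 2).
  have m0 : 0 < Num.min r (eps ^+ 2) by rewrite lt_min r0 exprn_gt0.
  split; first by rewrite divr_gt0.
  - by apply: (@lt_le_trans _ _ (Num.min r (eps ^+ 2))); [lra|rewrite ge_min lexx].
  - by apply: (@lt_le_trans _ _ (Num.min r (eps ^+ 2))); [lra|rewrite ge_min lexx orbT].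
(* On the box |x1^2 - v^2| <= q (2|v| + 1); with q K <= s / 2 the box centred at depth s / 2 stays
   in Omega. *)
pose K := 2 * `|v| + 2; have K2 : 2 <= K by rewrite /K; have := normr_ge0 v; lra.
pose q := Num.min 1 (s / 2 / K); have K0 : 0 < K by lra.
have q0 : 0 < q by rewrite lt_min ltr01 !divr_gt0.
have q1 : q <= 1 by rewrite ge_min lexx.
have qK : q * K <= s / 2 by rewrite -ler_pdivlMr// ge_min lexx orbT.
have qs : q <= s / 4 by have := ler_wpM2l (ltW q0) K2; lra.
pose y2 := v ^+ 2 + eps ^+ 2 - s / 2.
have box (x1 x2 : R) : ball v q x1 -> ball y2 q x2 -> A (x1, x2) /\ A' (x1, x2).
  rewrite /ball/= => b1 b2.
  have b1' : `|x1 ^+ 2 - v ^+ 2| <= q * K - q.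
    have -> : x1 ^+ 2 - v ^+ 2 = (v - x1) * (v - x1 - 2 * v) by ring.
    have -> : q * K - q = q * (2 * `|v| + 1) by rewrite /K; ring.
    rewrite normrM ler_pM//; first exact: ltW.
    rewrite (le_trans (ler_normB _ _))// normrM ger0_norm// addrC lerD2l.
    exact: le_trans (ltW b1) q1.
  move: b1 b2 b1'; rewrite !ltr_norml ler_norml /y2.
  move=> /andP[b1 b1'] /andP[b2 b2'] /andP[b3 b3'].
  apply: hr => /=.
  - by rewrite /Omega/=; apply/andP; split; lra.
  - by rewrite ltr_norml; apply/andP; split; lra.
  - by rewrite ltr_norml; apply/andP; split; lra.
by exists (v, y2); split; exists (ball v q, ball y2 q);
  [split; exact: nbhsx_ballx|move=> [x1 x2] /= [b1 b2]; have [] := box _ _ b1 b2|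
   split; exact: nbhsx_ballx|move=> [x1 x2] /= [b1 b2]; have [] := box _ _ b1 b2].
Qed.

(** Writing the depth as h^2 makes the tangent coordinates affine in h: uR = u - h and uL = u - 2
    eps + h. *)
Definition just_below A u : Prop := forall d, 0 < d ->
  exists h, [/\ 0 < h, h < d & A (u - eps, (u - eps) ^+ 2 + eps ^+ 2 - h ^+ 2)].

Lemma half_below u h : 0 <= h -> half eps (u - eps, (u - eps) ^+ 2 + eps ^+ 2 - h ^+ 2) = h.
Proof. by move=> h0; apply: half_unique => //=; ring. Qed.

Lemma uR_below u h : 0 <= h ->
  uR eps (u - eps, (u - eps) ^+ 2 + eps ^+ 2 - h ^+ 2) = u - h.
Proof. by move=> h0; rewrite /uR half_below//=; ring. Qed.

Lemma uL_below u h : 0 <= h ->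
  uL eps (u - eps, (u - eps) ^+ 2 + eps ^+ 2 - h ^+ 2) = u - 2 * eps + h.
Proof. by move=> h0; rewrite /uL half_below//=; ring. Qed.

Lemma below_Omega u h : 0 < h -> h < eps ->
  Omega eps (u - eps, (u - eps) ^+ 2 + eps ^+ 2 - h ^+ 2).
Proof.
move=> h0 he; rewrite /Omega/=.
have : 0 <= (eps - h) * (eps + h) by apply: mulr_ge0; lra.
have := sqr_ge0 h; lra.
Qed.

End NearArc.

(** * Linearity domains *)

Section LinearityDomains.
Context {R : realType}.
Variable eps : R.
Hypothesis eps0 : 0 < eps.
Implicit Types (f : R -> R) (B : R * R -> R) (x y z : R * R) (u w p q h r l t eta : R).
Implicit Types (D : set R) (G A : set (R * R)) (lm rm : \bar R).

(* Common data of the linearity domains and angles: [D] is the set of abscissae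
   of their points on the fixed boundary, [lm] and [rm] its ends, [G] the region
   above its gaps, [A] the domain itself. *)
Record lin_frame f B D lm rm G (b0 b1 b2 : R) A : Prop := LinFrame {
  lf_brk : forall u, (lm <= u%:E <= rm)%E -> exists p q,
    [/\ D p, D q, p <= u, u <= q & q - p <= 2 * eps /\ forall x, G x -> above_chord p q x];
  lf_D : forall t, D t -> (lm <= t%:E <= rm)%E;
  lf_f : forall t, D t -> f t = affine b0 b1 b2 (parab t);
  lf_B : forall x, A x -> B x = affine b0 b1 b2 x;
  lf_sub : forall x, A x -> G x /\ Omega eps x;
  lf_near : exists M : seq R, forall w, w \notin M -> near_arc eps w G;
  lf_arc : forall w, G (free_point eps w) }.

Lemma affine_reflect (b0 b1 b2 : R) x : affine b0 (- b1) b2 x = affine b0 b1 b2 (reflect x).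
Proof. by rewrite /affine/=; ring. Qed.

Lemma lin_frame_reflect f B D lm rm G b0 b1 b2 A :
  lin_frame f B D lm rm G b0 b1 b2 A ->
  lin_frame (f \o -%R) (B \o reflect) (-%R @^-1` D) (- rm)%E (- lm)%E
    (reflect @^-1` G) b0 (- b1) b2 (reflect @^-1` A).
Proof.
move=> [brk lD lf lB lsub [M near] arc]; split.
- move=> u; rewrite ereal_itv_opp => /brk[p [q [Dp Dq pu uq [qp ab]]]].
  exists (- q), (- p); split; rewrite /= ?opprK//; [lra|lra|split; [lra|]].
  by move=> x /ab; rewrite /above_chord/=; lra.
- by move=> t /lD; rewrite ereal_itv_opp.
- move=> t /lf /= ->; rewrite affine_reflect; congr affine.
  by rewrite /reflect /parab/= sqrrN.
- by move=> x /lB /= ->; rewrite affine_reflect.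
- by move=> x /lsub[? ?]; split=> //; rewrite -Omega_reflect.
- exists [seq - w | w <- M] => w wM; rewrite -[w]opprK.
  apply: near_arc_reflect; apply: near; apply: contra wM => wM.
  by apply/mapP; exists (- w) => //; rewrite opprK.
- move=> w; rewrite /= /reflect/= -[in X in G (_, X)]sqrrN; exact: arc.
Qed.

Section Frame.
Variables (f : R -> R) (B : R * R -> R) (D : set R) (lm rm : \bar R) (G A : set (R * R)).
Variables b0 b1 b2 : R.
Hypothesis frame : lin_frame f B D lm rm G b0 b1 b2 A.

Lemma lf_lmD l : lm = l%:E -> (lm <= rm)%E -> D l.
Proof.
move=> lE; rewrite lE => lr.
have [|p [q [Dp _ pl _ _]]] := lf_brk frame (u := l); first by rewrite lE lexx.
have := lf_D frame Dp; rewrite lE lee_fin => /andP[lp _].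
by have -> : l = p by apply/le_anti; rewrite lp.
Qed.

Lemma lin_left_end w eta x : A x -> 0 <= eta <= eps -> on_line w eta x ->
  (lm <= (w - eta)%:E <= rm)%E -> left_end eps f (affine b0 b1 b2) w eta x.1.
Proof.
move=> Ax e01 lx /(lf_brk frame)[p [q [Dp Dq pw wq [qp ab]]]].
have [Gx Ox] := lf_sub frame Ax.
apply: (left_end_bracket eps0 e01 Ox lx pw wq qp) => //; last exact: ab.
- exact: lf_f frame _ Dp.
- exact: lf_f frame _ Dq.
Qed.

Lemma lin_left_end_flow w eta x l : A x -> 0 <= eta <= eps -> on_line w eta x ->
  lm = l%:E -> (lm <= rm)%E -> w - eta <= l <= w + eta -> l <= uR eps x ->
  right_flow f eps B l -> A (free_point eps (l - eps)) ->
  left_end eps f (affine b0 b1 b2) w eta x.1.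
Proof.
move=> Ax e01 lx lE lr lw lux fl AW; have [Gx Ox] := lf_sub frame Ax.
apply: (left_end_flow eps0 e01 Ox lx fl lux lw); first exact: lf_B frame _ AW.
exact/(lf_f frame)/lf_lmD.
Qed.

End Frame.

Lemma lin_right_end f B D lm rm G b0 b1 b2 A w eta x :
  lin_frame f B D lm rm G b0 b1 b2 A -> A x -> 0 <= eta <= eps -> on_line w eta x ->
  (lm <= (w + eta)%:E <= rm)%E -> right_end eps f (affine b0 b1 b2) w eta x.1.
Proof.
move=> fr Ax e01 lx lr; have fr' := lin_frame_reflect fr.
have -> : right_end eps f (affine b0 b1 b2) w eta x.1 =
    left_end eps (f \o -%R) (affine b0 (- b1) b2) (- w) eta (reflect x).1.
  rewrite /right_end (_ : affine b0 b1 b2 \o reflect = affine b0 (- b1) b2)//.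
  by apply/funext => y; rewrite affine_reflect.
apply: (lin_left_end fr') => //.
- by rewrite /= reflectK.
- by move: lx; rewrite /on_line /= => <-; ring.
- have -> : - w - eta = - (w + eta) by ring.
  by rewrite ereal_itv_opp opprK.
Qed.

Lemma lin_right_end_flow f B D lm rm G b0 b1 b2 A w eta x l :
  lin_frame f B D lm rm G b0 b1 b2 A -> A x -> 0 <= eta <= eps -> on_line w eta x ->
  rm = l%:E -> (lm <= rm)%E -> w - eta <= l <= w + eta -> uL eps x <= l ->
  right_flow (f \o -%R) eps (B \o reflect) (- l) -> A (free_point eps (l + eps)) ->
  right_end eps f (affine b0 b1 b2) w eta x.1.
Proof.
move=> fr Ax e01 lx lE lr lw lux fl AW; have fr' := lin_frame_reflect fr.
have -> : right_end eps f (affine b0 b1 b2) w eta x.1 =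
    left_end eps (f \o -%R) (affine b0 (- b1) b2) (- w) eta (reflect x).1.
  rewrite /right_end (_ : affine b0 b1 b2 \o reflect = affine b0 (- b1) b2)//.
  by apply/funext => y; rewrite affine_reflect.
apply: (lin_left_end_flow fr' (l := - l)) => //.
- by rewrite /= reflectK.
- by move: lx; rewrite /on_line /= => <-; ring.
- by rewrite lE EFinN.
- by rewrite leeN2.
- by move: lw; lra.
- by rewrite uR_reflect lerN2.
- rewrite /= /reflect/=; have -> : - (- l - eps) = l + eps by ring.
  have -> : (- l - eps) ^+ 2 = (l + eps) ^+ 2 by ring.
  exact: AW.
Qed.

(* The optimizers of one figure are built from the flows entering it; [dem] is
   the foot of the right tangent through which the right flow enters. *)
Record right_figure f B A (dem : option R) : Prop := RightFigure {
  rf_step : forall u, just_below eps A u ->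
    [\/ right_flow f eps B u,
        exists2 u', u' < u & dem = Some u' /\ (right_flow f eps B u' -> right_flow f eps B u)
      | fine_right eps A (u - eps)];
  rf_dem : forall u, dem = Some u -> fine_right eps A (u - eps) /\
    forall x, A x -> u <= uR eps x }.

(** Inside Omega, the second factor of [lin_region] in tangent coordinates; with abstract ends it
    also covers angles. *)
Definition lin_side (k : lin_kind) lm rm : set (R * R) := [set x |
  match k with
  | RightMultitrolleybus => (lm <= (uR eps x)%:E <= rm)%E
  | LeftMultitrolleybus => (lm <= (uL eps x)%:E <= rm)%E
  | Multicup => (lm <= (uL eps x)%:E)%E /\ ((uR eps x)%:E <= rm)%E
  | Multibirdie => (lm <= (uR eps x)%:E)%E /\ ((uL eps x)%:E <= rm)%E
  | ClosedMulticup => below_chord (fine lm) (fine rm) x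
  end].

Lemma near_arc_lm_uR lm w : (lm < (w + eps)%:E)%E -> near_arc eps w [set x | (lm <= (uR eps x)%:E)%E].
Proof.
case: lm => [l| |]//; last by move=> _; exists 1 => // x _ _ _ /=; exact: leNye.
by rewrite lte_fin => /near_arc_uR_ge; apply: near_arcS => x _ /=; rewrite lee_fin.
Qed.

Lemma near_arc_rm_uR rm w : ((w + eps)%:E < rm)%E -> near_arc eps w [set x | ((uR eps x)%:E <= rm)%E].
Proof.
case: rm => [l| |]//; last by move=> _; exists 1 => // x _ _ _ /=; exact: leey.
by rewrite lte_fin => /near_arc_uR_le; apply: near_arcS => x _ /=; rewrite lee_fin.
Qed.

Lemma near_arc_lm_uL lm w : (lm < (w - eps)%:E)%E -> near_arc eps w [set x | (lm <= (uL eps x)%:E)%E].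
Proof.
case: lm => [l| |]//; last by move=> _; exists 1 => // x _ _ _ /=; exact: leNye.
by rewrite lte_fin => /near_arc_uL_ge; apply: near_arcS => x _ /=; rewrite lee_fin.
Qed.

Lemma near_arc_rm_uL rm w : ((w - eps)%:E < rm)%E -> near_arc eps w [set x | ((uL eps x)%:E <= rm)%E].
Proof.
case: rm => [l| |]//; last by move=> _; exists 1 => // x _ _ _ /=; exact: leey.
by rewrite lte_fin => /near_arc_uL_le; apply: near_arcS => x _ /=; rewrite lee_fin.
Qed.

Lemma room_right (z : \bar R) w : (w%:E < z)%E ->
  exists2 d, 0 < d & forall w', w' < w + d -> (w'%:E < z)%E.
Proof.
case: z => [r| |]//; last by move=> _; exists 1 => // w' _; exact: ltry.
by rewrite lte_fin => wr; exists (r - w); [lra|move=> w'; rewrite lte_fin; lra].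
Qed.

Lemma ereal_le_lim lm (c : R) : (forall d, 0 < d -> exists2 h, 0 < h < d & (lm <= (c + h)%:E)%E) ->
  (lm <= c%:E)%E.
Proof.
case: lm => [l| |] H; last by rewrite leNye.
- rewrite lee_fin leNgt; apply/negP => cl.
  by have [|h /andP[h0 hd]] := H (l - c); [lra|rewrite lee_fin; lra].
- by have [|h] := H 1.
Qed.

Lemma ereal_ge_lim rm (c : R) : (forall d, 0 < d -> exists2 h, 0 < h < d & ((c - h)%:E <= rm)%E) ->
  (c%:E <= rm)%E.
Proof.
case: rm => [l| |] H; first last.
- by have [|h] := H 1.
- by rewrite leey.
- rewrite lee_fin leNgt; apply/negP => cl.
  by have [|h /andP[h0 hd]] := H (c - l); [lra|rewrite lee_fin; lra].
Qed.
End LinearityDomains.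

Lemma ereal_between {R : realType} (z : \bar R) (a b : R) :
  (a%:E < z)%E -> (z <= b%:E)%E -> exists l, z = l%:E.
Proof. by case: z => [l| |]// _ _; exists l. Qed.

Lemma ereal_between2 {R : realType} (z : \bar R) (a b : R) :
  (a%:E <= z)%E -> (z < b%:E)%E -> exists l, z = l%:E.
Proof. by case: z => [l| |]// _ _; exists l. Qed.

(** * The five kinds of linearity domains *)

Section LinearityKinds.
Context {R : realType}.
Variable eps : R.
Hypothesis eps0 : 0 < eps.
Variables (f : R -> R) (B : R * R -> R) (D : set R) (lm rm : \bar R).
Variables (G A : set (R * R)) (b0 b1 b2 : R).
Hypothesis frame : lin_frame eps f B D lm rm G b0 b1 b2 A.
Hypothesis lr : (lm <= rm)%E.
Implicit Types (x y z : R * R) (u w p q h r l t eta : R).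

Definition lin_kind_frame k : Prop :=
  forall x, A x <-> [/\ Omega eps x, G x & lin_side eps k lm rm x].

Lemma on_left_tangent x : Omega eps x -> on_line (uL eps x + eps) eps x.
Proof. by move=> /sqr_half; rewrite /on_line /uL => h; lra. Qed.

Lemma lin_free_point k w : lin_kind_frame k -> lin_side eps k lm rm (free_point eps w) ->
  A (free_point eps w).
Proof.
move=> AE sw; apply/AE; split=> //; first exact: Omega_free_point.
exact: lf_arc frame w.
Qed.

Lemma lin_fine_right k u : lin_kind_frame k ->
  (exists2 d, 0 < d & forall w, u - eps < w -> w < u - eps + d ->
     near_arc eps w (lin_side eps k lm rm)) -> fine_right eps A (u - eps).
Proof.
move=> AE [d d0 h]; have [M near] := lf_near frame.
exists d, M; split=> // w w1 w2 wM.
by apply: near_arcS (near_arcI (near w wM) (h w w1 w2)) => x Ox [Gx sx]; exact/AE.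
Qed.

Lemma lin_left_flow x w eta k : lin_kind_frame k -> A x -> 0 <= eta <= eps ->
  on_line w eta x -> (lm <= (uR eps x)%:E)%E -> uR eps x <= w + eta ->
  ((w - eta)%:E <= rm)%E ->
  (forall l, lm = l%:E -> lin_side eps k lm rm (free_point eps (l - eps))) ->
  (forall l, lm = l%:E -> right_flow f eps B l) ->
  left_end eps f (affine b0 b1 b2) w eta x.1.
Proof.
move=> AE Ax e01 lx lux uxw wrm side flow.
have [lw|wl] := leP lm (w - eta)%:E; first by apply: (lin_left_end eps0 frame) => //; rewrite lw.
have [l lE] := ereal_between wl lux.
move: wl lux; rewrite lE lte_fin lee_fin => wl lux.
apply: (lin_left_end_flow eps0 frame (l := l)) => //; try exact: flow.
- by rewrite (ltW wl) (le_trans lux).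
- by apply: (lin_free_point AE); exact: side.
Qed.

Lemma lin_right_flow x w eta k : lin_kind_frame k -> A x -> 0 <= eta <= eps ->
  on_line w eta x -> ((uL eps x)%:E <= rm)%E -> w - eta <= uL eps x ->
  (lm <= (w + eta)%:E)%E ->
  (forall l, rm = l%:E -> lin_side eps k lm rm (free_point eps (l + eps))) ->
  (forall l, rm = l%:E -> right_flow (f \o -%R) eps (B \o reflect) (- l)) ->
  right_end eps f (affine b0 b1 b2) w eta x.1.
Proof.
move=> AE Ax e01 lx lux uxw wrm side flow.
have [lw|wl] := leP (w + eta)%:E rm; first by apply: (lin_right_end eps0 frame) => //; rewrite lw wrm.
have [l lE] := ereal_between2 lux wl.
move: wl lux; rewrite lE lte_fin lee_fin => wl lux.
apply: (lin_right_end_flow eps0 frame (l := l)) => //; try exact: flow.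
- by rewrite (ltW wl) andbT (le_trans uxw).
- by apply: (lin_free_point AE); exact: side.
Qed.

(** The line is taken along the right tangent through [x]; on the right it ends at uR x, between
    [lm] and [rm]. *)
Lemma right_multitrolleybus_optimizer x : lin_kind_frame RightMultitrolleybus ->
  (forall l, lm = l%:E -> right_flow f eps B l) -> A x -> admits_optimizer f eps B x.
Proof.
move=> AE flow Ax; have [Ox Gx /= /andP[lux urm]] := (AE x).1 Ax.
have e01 : 0 <= eps <= eps by rewrite lexx ltW.
have lx := on_right_tangent Ox.
apply: (optimizer_line eps0 e01 lx); last exact: lf_B frame _ Ax.
- apply: (lin_left_flow AE Ax e01 lx lux) => //; first by rewrite subrK.
    by apply: le_trans urm; rewrite lee_fin; have := eps0; lra.
  by move=> l lE /=; rewrite uR_free_point// subrK -lE lexx lr.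
- by apply: (lin_right_end eps0 frame) => //; rewrite subrK lux.
Qed.

Lemma left_multitrolleybus_optimizer x : lin_kind_frame LeftMultitrolleybus ->
  (forall l, rm = l%:E -> right_flow (f \o -%R) eps (B \o reflect) (- l)) ->
  A x -> admits_optimizer f eps B x.
Proof.
move=> AE flow Ax; have [Ox Gx /= /andP[lux urm]] := (AE x).1 Ax.
have e01 : 0 <= eps <= eps by rewrite lexx ltW.
have lx := on_left_tangent Ox.
apply: (optimizer_line eps0 e01 lx); last exact: lf_B frame _ Ax.
- by apply: (lin_left_end eps0 frame) => //; rewrite addrK lux.
- apply: (lin_right_flow AE Ax e01 lx urm) => //; first by rewrite addrK.
    by apply: le_trans lux _; rewrite lee_fin; have := eps0; lra.
  by move=> l lE /=; rewrite uL_free_point// addrK -lE lexx lr.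
Qed.

Lemma line_exists w x : Omega eps x ->
  exists eta, [/\ 0 <= eta, on_line w eta x & eta ^+ 2 = eps ^+ 2 - half eps x ^+ 2 + (x.1 - w) ^+ 2].
Proof.
move=> Ox; have /andP[h1 h2] := Ox.
have p : 0 <= x.2 - x.1 ^+ 2 + (x.1 - w) ^+ 2 by rewrite addr_ge0 ?sqr_ge0// subr_ge0.
exists (Num.sqrt (x.2 - x.1 ^+ 2 + (x.1 - w) ^+ 2)); rewrite /on_line sqr_sqrtr//.
by rewrite sqrtr_ge0 (sqr_half Ox); split=> //; ring.
Qed.

Lemma le_of_sqr (a b : R) : 0 <= b -> a ^+ 2 <= b ^+ 2 -> a <= b.
Proof. by move=> b_ge0 h; rewrite leNgt; apply/negP => ba; nra. Qed.

(** The right tangent through [x] works if uR x - 2 eps is not before [lm]. Otherwise w = l + eps is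
    taken: the line meets the fixed boundary within [l, l + 2 eps], which fits by the width of a
    multicup. *)
Lemma multicup_optimizer x : lin_kind_frame Multicup ->
  (lm + (2 * eps)%:E <= rm)%E -> A x -> admits_optimizer f eps B x.
Proof.
move=> AE lr2 Ax; have [Ox Gx /= [lux urm]] := (AE x).1 Ax.
have [lw|wl] := leP lm (uR eps x - 2 * eps)%:E.
  have e01 : 0 <= eps <= eps by rewrite lexx ltW.
  have lx := on_right_tangent Ox.
  apply: (optimizer_line eps0 e01 lx); last exact: lf_B frame _ Ax.
  - apply: (lin_left_end eps0 frame) => //.
    have -> : uR eps x - eps - eps = uR eps x - 2 * eps by ring.
    by rewrite lw (le_trans _ urm)// lee_fin; have := eps0; lra.
  - apply: (lin_right_end eps0 frame) => //; rewrite subrK urm andbT.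
    by apply: le_trans lw _; rewrite lee_fin; have := eps0; lra.
have [l lE] := ereal_between wl lux.
move: wl lux lr2; rewrite lE lte_fin lee_fin -EFinD => wl lux lr2.
have [eta [eta0 lx etaE]] := line_exists (l + eps) Ox.
have hx : (x.1 - (l + eps)) ^+ 2 <= half eps x ^+ 2.
  move: wl lux; rewrite /uR /uL => h1 h2.
  have : 0 <= (half eps x - (x.1 - (l + eps))) * (half eps x + (x.1 - (l + eps))).
    by apply: mulr_ge0; lra.
  lra.
have etae : eta <= eps by apply: le_of_sqr; [exact: ltW|lra].
have e01 : 0 <= eta <= eps by rewrite eta0.
apply: (optimizer_line eps0 e01 lx); last exact: lf_B frame _ Ax.
- apply: (lin_left_end eps0 frame) => //; rewrite lE lee_fin; apply/andP; split; first lra.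
  by apply: le_trans lr2; rewrite lee_fin; lra.
- apply: (lin_right_end eps0 frame) => //; rewrite lE lee_fin; apply/andP; split.
    by have := eps0; lra.
  by apply: le_trans lr2; rewrite lee_fin; lra.
Qed.

(** The line is parallel to the closing chord and not above it, hence meets the parabola between [l]
    and [r]. *)
Lemma closed_multicup_optimizer x (l r : R) : lin_kind_frame ClosedMulticup ->
  lm = l%:E -> rm = r%:E -> r - l <= 2 * eps -> A x -> admits_optimizer f eps B x.
Proof.
move=> AE lE rE lr2 Ax; have [Ox Gx] := (AE x).1 Ax.
rewrite /= lE rE /below_chord /= => be.
have lr' : l <= r by move: lr; rewrite lE rE lee_fin.
have [eta [eta0 lx etaE]] := line_exists ((l + r) / 2) Ox.
have h : eta <= (r - l) / 2.
  apply: le_of_sqr; first lra.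
  by move: lx; rewrite /on_line => <-; lra.
have e01 : 0 <= eta <= eps by rewrite eta0; lra.
apply: (optimizer_line eps0 e01 lx); last exact: lf_B frame _ Ax.
- by apply: (lin_left_end eps0 frame) => //; rewrite lE rE !lee_fin; lra.
- by apply: (lin_right_end eps0 frame) => //; rewrite lE rE !lee_fin; lra.
Qed.

(** With w = x.1 one has eta^2 + half^2 = eps^2, so eta + half >= eps. Hence w - eta <= uL x and uR
    x <= w + eta, the bounds under which the line crosses the entering tangents. *)
Lemma multibirdie_optimizer x : lin_kind_frame Multibirdie ->
  (forall l, lm = l%:E -> right_flow f eps B l) ->
  (forall l, rm = l%:E -> right_flow (f \o -%R) eps (B \o reflect) (- l)) ->
  A x -> admits_optimizer f eps B x.
Proof.
move=> AE flow flow' Ax; have [Ox Gx /= [lux urm]] := (AE x).1 Ax.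
have [eta [eta0 lx etaE]] := line_exists x.1 Ox.
rewrite subrr expr0n/= addr0 in etaE.
have h0 := half_ge0 eps x.
have etae : eta <= eps by apply: le_of_sqr; [exact: ltW|have := sqr_ge0 (half eps x); lra].
have h1 : eps <= half eps x + eta.
  by apply: le_of_sqr; [lra|have : 0 <= half eps x * eta by apply: mulr_ge0; lra];
    rewrite sqrrD etaE mulr2n; lra.
have e01 : 0 <= eta <= eps by rewrite eta0.
apply: (optimizer_line eps0 e01 lx); last exact: lf_B frame _ Ax.
- apply: (lin_left_flow AE Ax e01 lx lux) => //; first by rewrite /uR; lra.
    by apply: le_trans urm; rewrite lee_fin /uL; lra.
  move=> l lE /=; rewrite uR_free_point// uL_free_point// subrK -lE lexx; split=> //.
  by apply: le_trans lr; rewrite lE lee_fin; have := eps0; lra.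
- apply: (lin_right_flow AE Ax e01 lx urm) => //; first by rewrite /uL; lra.
    by apply: le_trans lux _; rewrite lee_fin /uR; lra.
  move=> l lE /=; rewrite uR_free_point// uL_free_point// addrK -lE lexx; split=> //.
  by apply: le_trans lr _; rewrite lE lee_fin; have := eps0; lra.
Qed.

(** Points just below have uR = u - h, so lm < u <= rm. If u < rm, the figure extends further right;
    if u = rm, this is the exit tangent, to which the flow entering at [l] is passed on. *)
Lemma right_multitrolleybus_figure (l : R) : lin_kind_frame RightMultitrolleybus ->
  lm = l%:E -> (lm < rm)%E -> right_figure eps f B A (Some l).
Proof.
move=> AE lE lr'; split=> [u FZ|u [<-]].
  have FZ' d : 0 < d -> exists2 h, 0 < h < d & (lm <= (u - h)%:E <= rm)%E.
    move=> /FZ[h [h0 hd Ah]]; exists h; first by rewrite h0.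
    by have [_ _] := (AE _).1 Ah; rewrite /= uR_below// ltW.
  have lu : (lm < u%:E)%E.
    have [h /andP[h0 _] /andP[lh _]] := FZ' 1 ltr01.
    by apply: le_lt_trans lh _; rewrite lte_fin; lra.
  have : (u%:E <= rm)%E.
    apply: ereal_ge_lim => d /FZ'[h hd /andP[_ ?]]; by exists h.
  rewrite le_eqVlt => /predU1P[uE|ur]; last first.
    apply: Or33; apply: (lin_fine_right AE).
    have [d d0 hd] := room_right ur; exists d => // w uw wd.
    have h1 : (lm < (w + eps)%:E)%E by apply: lt_trans lu _; rewrite lte_fin; lra.
    have h2 : ((w + eps)%:E < rm)%E by apply: hd; lra.
    apply: near_arcS (near_arcI (near_arc_lm_uR h1) (near_arc_rm_uR h2)).
    by move=> x _ [/= -> ->].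
  apply: Or32; exists l; first by move: lu; rewrite lE lte_fin.
  split=> // flow.
  have Aw : A (free_point eps (u - eps)).
    by apply: (lin_free_point AE); rewrite /= uR_free_point// subrK uE lr lexx.
  have e01 : 0 <= eps <= eps by rewrite lexx ltW.
  apply: (flow_from_left_end eps0 (b0 := b0) (b1 := b1) (b2 := b2)); last 2 first.
  - exact: lf_B frame _ Aw.
  - apply: (lf_f frame); have fr' := lin_frame_reflect frame.
    have := lf_lmD fr' (l := - u); rewrite EFinN uE leeN2 => /(_ erefl lr).
    by rewrite /= opprK.
  have lx : on_line (u - eps) eps (free_point eps (u - eps)) by rewrite /on_line/=; ring.
  apply: (lin_left_flow AE Aw e01 lx) => //.
  - by rewrite uR_free_point// subrK ltW.
  - by rewrite uR_free_point.
  - by rewrite -uE lee_fin; have := eps0; lra.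
  - by move=> l' l'E; rewrite /= uR_free_point// subrK -l'E lexx lr.
  - by move=> l'; rewrite lE => -[<-].
split; last by move=> x /AE[_ _ /= /andP[]]; rewrite lE lee_fin.
apply: (lin_fine_right AE).
have /room_right[d d0 hd] : (l%:E < rm)%E by rewrite -lE.
exists d => // w lw wd.
have h1 : (lm < (w + eps)%:E)%E by rewrite lE lte_fin; lra.
have h2 : ((w + eps)%:E < rm)%E by apply: hd; lra.
apply: near_arcS (near_arcI (near_arc_lm_uR h1) (near_arc_rm_uR h2)).
by move=> x _ [/= -> ->].
Qed.

(** Points just below have uL = u - 2 eps + h, so u - 2 eps < rm strictly, which leaves room to the
    right. *)
Lemma left_multitrolleybus_figure : lin_kind_frame LeftMultitrolleybus ->
  right_figure eps f B A None.
Proof.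
move=> AE; split=> [u FZ|//]; apply: Or33.
have FZ' d : 0 < d -> exists2 h, 0 < h < d & (lm <= (u - 2 * eps + h)%:E <= rm)%E.
  move=> /FZ[h [h0 hd Ah]]; exists h; first by rewrite h0.
  by have [_ _] := (AE _).1 Ah; rewrite /= uL_below// ltW.
have lu : (lm <= (u - 2 * eps)%:E)%E.
  by apply: ereal_le_lim => d /FZ'[h hd /andP[? _]]; exists h.
have ur : ((u - 2 * eps)%:E < rm)%E.
  have [h /andP[h0 _] /andP[_ rh]] := FZ' 1 ltr01.
  by apply: lt_le_trans rh; rewrite lte_fin; lra.
have [d d0 hd] := room_right ur; apply: (lin_fine_right AE); exists d => // w uw wd.
have h1 : (lm < (w - eps)%:E)%E by apply: le_lt_trans lu _; rewrite lte_fin; lra.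
have h2 : ((w - eps)%:E < rm)%E by apply: hd; lra.
apply: near_arcS (near_arcI (near_arc_lm_uL h1) (near_arc_rm_uL h2)).
by move=> x _ [/= -> ->].
Qed.

(** If u = rm, the line of the right tangent at [u] starts over u - 2 eps >= lm, on an arc or a gap:
    the multicup is a source. *)
Lemma multicup_figure : lin_kind_frame Multicup -> right_figure eps f B A None.
Proof.
move=> AE; split=> [u FZ|//].
have FZ' d : 0 < d -> exists2 h, 0 < h < d &
    (lm <= (u - 2 * eps + h)%:E)%E /\ ((u - h)%:E <= rm)%E.
  move=> /FZ[h [h0 hd Ah]]; exists h; first by rewrite h0.
  by have [_ _] := (AE _).1 Ah; rewrite /= uL_below ?uR_below// ltW.
have lu : (lm <= (u - 2 * eps)%:E)%E.
  by apply: ereal_le_lim => d /FZ'[h hd [? _]]; exists h.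
have : (u%:E <= rm)%E by apply: ereal_ge_lim => d /FZ'[h hd [_ ?]]; exists h.
rewrite le_eqVlt => /predU1P[uE|ur]; last first.
  apply: Or33; have [d d0 hd] := room_right ur.
  apply: (lin_fine_right AE); exists d => // w uw wd.
  have h1 : (lm < (w - eps)%:E)%E by apply: le_lt_trans lu _; rewrite lte_fin; lra.
  have h2 : ((w + eps)%:E < rm)%E by apply: hd; lra.
  exact: near_arcI (near_arc_lm_uL h1) (near_arc_rm_uR h2).
apply: Or31.
have Aw : A (free_point eps (u - eps)).
  apply: (lin_free_point AE); rewrite /= uR_free_point// uL_free_point// subrK uE lexx.
  by have -> : u - eps - eps = u - 2 * eps by ring.
have e01 : 0 <= eps <= eps by rewrite lexx ltW.
apply: (flow_from_left_end eps0 (b0 := b0) (b1 := b1) (b2 := b2)); last 2 first.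
- exact: lf_B frame _ Aw.
- apply: (lf_f frame); have fr' := lin_frame_reflect frame.
  have := lf_lmD fr' (l := - u); rewrite EFinN uE leeN2 => /(_ erefl lr).
  by rewrite /= opprK.
have lx : on_line (u - eps) eps (free_point eps (u - eps)) by rewrite /on_line/=; ring.
apply: (lin_left_end eps0 frame Aw e01 lx).
have -> : u - eps - eps = u - 2 * eps by ring.
by rewrite lu -uE lee_fin; have := eps0; lra.
Qed.

Lemma closed_multicup_figure (l r : R) : lin_kind_frame ClosedMulticup ->
  lm = l%:E -> rm = r%:E -> r - l < 2 * eps -> right_figure eps f B A None.
Proof.
move=> AE lE rE lr2; split=> [u FZ|//]; exfalso.
have lr' : l <= r by move: lr; rewrite lE rE lee_fin.
(* The domain stays at least eps^2 - ((r - l) / 2)^2 below the free boundary. *)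
pose c := (2 * eps - (r - l)) * (2 * eps + (r - l)) / 4.
have c0 : 0 < c by rewrite divr_gt0// mulr_gt0//; have := eps0; lra.
have [|h [h0 hd Ah]] := FZ (Num.min eps (c / eps)).
  by rewrite lt_min eps0 divr_gt0.
have [_ _] := (AE _).1 Ah; rewrite /= lE rE /below_chord/= => be.
move: hd; rewrite lt_min => /andP[he]; rewrite ltr_pdivlMr// => hc.
have h2 : h ^+ 2 < c.
  apply: lt_trans hc; have : 0 < h * (eps - h) by apply: mulr_gt0; lra.
  lra.
have := sqr_ge0 (u - eps - (l + r) / 2); rewrite /c in h2; lra.
Qed.

Lemma multibirdie_figure (l : R) : lin_kind_frame Multibirdie ->
  lm = l%:E -> right_figure eps f B A (Some l).
Proof.
move=> AE lE.
have fine u : (lm <= u%:E)%E -> ((u - 2 * eps)%:E < rm)%E -> fine_right eps A (u - eps).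
  move=> lu ur; have [d d0 hd] := room_right ur.
  apply: (lin_fine_right AE); exists d => // w uw wd.
  have h1 : (lm < (w + eps)%:E)%E by apply: le_lt_trans lu _; rewrite lte_fin; lra.
  have h2 : ((w - eps)%:E < rm)%E by apply: hd; lra.
  exact: near_arcI (near_arc_lm_uR h1) (near_arc_rm_uL h2).
split=> [u FZ|u [<-]].
  have [h [h0 hd Ah]] := FZ 1 ltr01.
  have [_ _ /= []] := (AE _).1 Ah; rewrite uR_below ?uL_below ?(ltW h0)// => lh rh.
  apply: Or33; apply: fine.
  - by apply: le_trans lh _; rewrite lee_fin; lra.
  - by apply: lt_le_trans rh; rewrite lte_fin; lra.
split; last by move=> x /AE[_ _ /= []]; rewrite lE lee_fin.
apply: fine; first by rewrite lE.
by apply: lt_le_trans lr; rewrite lE lte_fin; have := eps0; lra.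
Qed.
End LinearityKinds.

(** * Flows and foliation graphs *)

Section StripsAndChords.
Context {R : realType}.
Variable eps : R.
Hypothesis eps0 : 0 < eps.
Implicit Types (f : R -> R) (B : R * R -> R) (x y z : R * R) (u w p q h r l t eta : R).

Definition finite_end (z : \bar R) : option R := if z is l%:E then Some l else None.

Lemma finite_endP (z : \bar R) l : finite_end z = Some l -> z = l%:E.
Proof. by case: z => [m| |]// [->]. Qed.

Lemma right_strip_figure f B (u1 u2 : \bar R) : (u1 < u2)%E -> tame eps f ->
  continuous (free_value eps B) -> right_strip f eps u1 u2 B ->
  right_figure eps f B (Omega_R eps u1 u2) (finite_end u1).
Proof.
move=> u12 tf cB st; split=> [u FZ|u /finite_endP u1E].
  have FZ' d : 0 < d -> exists2 h, 0 < h < d & (u1 <= (u - h)%:E <= u2)%E.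
    move=> /FZ[h [h0 hd /(Omega_RP eps0)[_]]]; rewrite uR_below ?(ltW h0)// => hh.
    by exists h; rewrite ?h0.
  have lu : (u1 < u%:E)%E.
    have [h /andP[h0 _] /andP[lh _]] := FZ' 1 ltr01.
    by apply: le_lt_trans lh _; rewrite lte_fin; lra.
  have ur : (u%:E <= u2)%E.
    by apply: ereal_ge_lim => d /FZ'[h hd /andP[_ ?]]; exists h.
  have u_in : (u1 <= u%:E <= u2)%E by rewrite (ltW lu).
  have flow := right_strip_flow eps0 tf cB st u_in.
  case: u1 lu flow {FZ FZ' u12 st u_in} => [l| |]//= lu flow.
  - apply: Or32; exists l => //; split=> // fl.
    by apply: flow => r [<-].
  - by apply: Or31; exact: flow.
split; last by move=> x /(Omega_RP eps0)[_]; rewrite u1E lee_fin => /andP[].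
have [d d0 hd] : exists2 d, 0 < d & forall w', w' < u + d -> (w'%:E < u2)%E.
  by apply: room_right; rewrite -u1E.
exists d, [::]; split=> // w w1 w2 _.
have h1 : (u1 < (w + eps)%:E)%E by rewrite u1E lte_fin; lra.
have h2 : ((w + eps)%:E < u2)%E by apply: hd; lra.
apply: near_arcS (near_arcI (near_arc_lm_uR h1) (near_arc_rm_uR h2)).
by move=> x Ox [/= x1 x2]; apply/(Omega_RP eps0); rewrite x1 x2.
Qed.

Lemma left_strip_figure f B (u1 u2 : \bar R) :
  right_figure eps f B (Omega_L eps u1 u2) None.
Proof.
split=> [u FZ|//]; apply: Or33.
have FZ' d : 0 < d -> exists2 h, 0 < h < d & (u1 <= (u - 2 * eps + h)%:E <= u2)%E.
  move=> /FZ[h [h0 hd /(Omega_LP eps0)[_]]]; rewrite uL_below ?(ltW h0)// => hh.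
  by exists h; rewrite ?h0.
have lu : (u1 <= (u - 2 * eps)%:E)%E.
  by apply: ereal_le_lim => d /FZ'[h hd /andP[? _]]; exists h.
have ur : ((u - 2 * eps)%:E < u2)%E.
  have [h /andP[h0 _] /andP[_ rh]] := FZ' 1 ltr01.
  by apply: lt_le_trans rh; rewrite lte_fin; lra.
have [d d0 hd] := room_right ur; exists d, [::]; split=> // w uw wd _.
have h1 : (u1 < (w - eps)%:E)%E by apply: le_lt_trans lu _; rewrite lte_fin; lra.
have h2 : ((w - eps)%:E < u2)%E by apply: hd; lra.
apply: near_arcS (near_arcI (near_arc_lm_uL h1) (near_arc_rm_uL h2)).
by move=> x Ox [/= x1 x2]; apply/(Omega_LP eps0); rewrite x1 x2.
Qed.

Lemma right_point_cst f q : right_point f eps (parab q) q (f q).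
Proof.
have := left_point_cst (f \o -%R) eps0 (- q).
by rewrite /right_point /= opprK sqrrN.
Qed.

Lemma right_strip_optimizer f B (u1 u2 : \bar R) x : tame eps f ->
  continuous (free_value eps B) -> right_strip f eps u1 u2 B ->
  (forall r, u1 = r%:E -> right_flow f eps B r) ->
  Omega_R eps u1 u2 x -> admits_optimizer f eps B x.
Proof.
move=> tf cB st flow [u hu [h /andP[h0 h1] ->]].
have fl := right_strip_flow eps0 tf cB st hu flow.
have [seg _ _] := st; have := seg u h hu; rewrite h0 h1 => /(_ isT) BE.
have := @optimizer_glue _ _ _ B _ _ _ _ _ _ (u - eps) (1 - h) fl (right_point_cst f u).
have -> : 1 - (1 - h) = h by ring.
rewrite [X in _ -> _ -> _ -> _ -> _ -> B X = _ -> _](_ : _ =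
  ((1 - h) * u + h * (u - eps), (1 - h) * u ^+ 2 + h * ((u - eps) ^+ 2 + eps ^+ 2))); last first.
  by rewrite /=; congr (_, _); ring.
rewrite [X in _ -> _ -> _ -> _ -> _ -> _ -> admits_optimizer _ _ _ X](_ : _ =
  ((1 - h) * u + h * (u - eps), (1 - h) * u ^+ 2 + h * ((u - eps) ^+ 2 + eps ^+ 2))); last first.
  by rewrite /=; congr (_, _); ring.
apply; rewrite ?subrK//; try (rewrite /excess/=; lra).
- by have := eps0; lra.
- by rewrite BE addrC.
Qed.

Lemma left_strip_optimizer f B (u1 u2 : \bar R) x : tame eps f ->
  continuous (free_value eps (B \o reflect)) ->
  right_strip (f \o -%R) eps (- u2)%E (- u1)%E (B \o reflect) ->
  (forall r, u2 = r%:E -> right_flow (f \o -%R) eps (B \o reflect) (- r)) ->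
  Omega_L eps u1 u2 x -> admits_optimizer f eps B x.
Proof.
move=> tf cB st flow [u hu [h /andP[h0 h1] ->]].
have hu' : (- u2 <= (- u)%:E <= - u1)%E by rewrite ereal_itv_opp opprK.
have fl : right_flow (f \o -%R) eps (B \o reflect) (- u).
  apply: (right_strip_flow eps0 (tame_oppr tf) cB st hu') => r u2r.
  by rewrite -[r]opprK; apply: flow; rewrite EFinN -u2r oppeK.
have [seg _ _] := st; have := seg _ h hu'; rewrite h0 h1 => /(_ isT) BE.
have fl' : right_point f eps (free_point eps (u + eps)) u (B (free_point eps (u + eps))).
  have e1 : free_point eps (- u - eps) = (- (u + eps), (u + eps) ^+ 2 + eps ^+ 2).
    by rewrite /free_point; congr (_, _); ring.
  by move: fl; rewrite /right_flow /right_point e1 /= /reflect/= opprK.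
have := @optimizer_glue _ _ _ B _ _ _ _ _ _ (u + eps) h (left_point_cst f eps0 u) fl'.
rewrite /=; apply; rewrite ?addrK ?h0//; try (rewrite /excess/=; lra).
- by have := eps0; lra.
- move: BE; rewrite /= /reflect /free_value /= opprK.
  have -> : - ((1 - h) * - u + h * (- u - eps)) = (1 - h) * u + h * (u + eps) by ring.
  have -> : (1 - h) * (- u) ^+ 2 + h * ((- u - eps) ^+ 2 + eps ^+ 2) =
    (1 - h) * u ^+ 2 + h * ((u + eps) ^+ 2 + eps ^+ 2) by ring.
  move=> ->; congr (_ + _ * B _); rewrite /free_point/=; congr (_, _); ring.
Qed.

(** Two constants are glued by the tangent at the middle abscissa, which is parallel to the
    chord. *)
Lemma chord_optimizer f B p q x : p <= q -> q - p <= 2 * eps ->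
  chord_candidate f p q B -> chord p q x -> admits_optimizer f eps B x.
Proof.
move=> pq qp cand [h h01 ->].
have := @optimizer_glue _ _ _ B _ _ _ _ _ _ ((p + q) / 2) h
  (left_point_cst f eps0 p) (right_point_cst f q).
have h2 : 0 <= (2 * eps - (q - p)) * (2 * eps + (q - p)) by apply: mulr_ge0; lra.
by apply; rewrite ?cand// /excess/=; lra.
Qed.

(** The case l1 = l0 covers single chords and origins of cups. *)
Record chord_family f B (a b : R -> R) (l1 l0 : R) : Prop := ChordFamily {
  cf_len : [/\ 0 <= l1, l1 <= l0 & l0 <= 2 * eps];
  cf_a : {within `[l1, l0], continuous a};
  cf_b : {within `[l1, l0], continuous b};
  cf_ab : forall l, l \in `[l1, l0]%R -> b l - a l = l;
  cf_cand : forall l, l \in `[l1, l0]%R -> chord_candidate f (a l) (b l) B }.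

Definition chord_union (a b : R -> R) (l1 l0 : R) : set (R * R) :=
  [set x | exists2 l, l1 <= l <= l0 & chord (a l) (b l) x].

Lemma within_continuous_at (a : R -> R) l1 l0 e : l1 <= l0 ->
  {within `[l1, l0], continuous a} -> 0 < e ->
  exists2 d, 0 < d & forall l, l1 <= l <= l0 -> l0 - l < d -> `|a l0 - a l| < e.
Proof.
move=> l10 /subspace_continuousP ca e0.
have l0in : `[l1, l0]%classic l0 by rewrite /= in_itv/= l10 lexx.
have /cvgrPdist_lt/(_ e e0) := ca l0 l0in.
rewrite /= near_withinE => /nbhs_ballP[d /= d0 hd].
exists d => // l /andP[l1l ll0] ld; apply: hd; last by rewrite /= in_itv/= l1l.
by rewrite /ball/= ger0_norm// subr_ge0.
Qed.

(** A point at depth h^2 on a chord of length l with middle abscissa m satisfies h^2 = eps^2 -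
    (l/2)^2 + (u - eps - m)^2. As h tends to 0 this forces l0 = 2 eps and, by continuity, an upper
    chord ending at [u]. *)
Lemma chord_family_figure f B a b l1 l0 : chord_family f B a b l1 l0 ->
  right_figure eps f B (chord_union a b l1 l0) None.
Proof.
move=> [[l1_ge0 l10 l0e] ca cb ab cand]; split=> [u FZ|//]; apply: Or31.
have key d : 0 < d -> exists h l, [/\ 0 < h < d, l1 <= l <= l0,
    `|u - eps - (a l + b l) / 2| <= h & 2 * eps - l <= 2 * h].
  move=> d0; have [|h [h0 hd [l ll]]] := FZ (Num.min d eps); first by rewrite lt_min d0.
  move: hd; rewrite lt_min => /andP[hd he] [s s01 [sE1 sE2]].
  exists h, l; rewrite h0 hd ll.
  have lE := ab l; rewrite in_itv/= ll in lE; have {}lE := lE isT.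
  pose m := (a l + b l) / 2.
  have E : eps ^+ 2 - h ^+ 2 = (l / 2) ^+ 2 - (u - eps - m) ^+ 2.
    have : (u - eps) ^+ 2 + eps ^+ 2 - h ^+ 2 = (a l + b l) * (u - eps) - a l * b l.
      by rewrite sE2 sE1 /=; ring.
    have -> : (l / 2) ^+ 2 = ((b l - a l) / 2) ^+ 2 by rewrite lE.
    by rewrite /m; lra.
  have /andP[ll1 ll0] := ll.
  split=> //.
    rewrite -(@ler_pXn2r _ 2%N)// ?nnegrE ?normr_ge0 ?(ltW h0)// -normrX ger0_norm ?sqr_ge0//.
    have l0' : 0 <= (2 * eps - l) * (2 * eps + l) by apply: mulr_ge0; lra.
    by rewrite -/m; lra.
  suff : eps - h <= l / 2 by lra.
  apply: le_of_sqr; first lra.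
  have : 0 <= h * (eps - h) by apply: mulr_ge0; lra.
  have := sqr_ge0 (u - eps - m); lra.
have l0E : l0 = 2 * eps.
  apply/le_anti; rewrite l0e/=; apply/ler_addgt0Pr => e e0.
  have [|h [l [/andP[h0 hd] /andP[_ ll0] _ h2]]] := key (e / 2); first by rewrite divr_gt0.
  lra.
have mE : u - eps = (a l0 + b l0) / 2.
  apply/eqP; rewrite -subr_eq0 -normr_le0; apply/ler_addgt0Pr => e e0; rewrite add0r.
  have e2 : 0 < e / 2 by rewrite divr_gt0.
  have [da da0 hda] := within_continuous_at l10 ca e2.
  have [db db0 hdb] := within_continuous_at l10 cb e2.
  have [|h [l [/andP[h0 hd] ll hm hl]]] := key (Num.min (e / 2) (Num.min (da / 2) (db / 2))).
    by rewrite !lt_min e2 !divr_gt0.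
  move: hd; rewrite !lt_min => /and3P[hd1 hd2 hd3].
  have {}hda := hda l ll; have {}hdb := hdb l ll.
  have := hda _; have := hdb _; rewrite !ltr_norml.
  move: hm; rewrite !ler_norml => /andP[hm1 hm2].
  move=> /(_ ltac:(lra))/andP[hb1 hb2] /(_ ltac:(lra))/andP[ha1 ha2].
  by apply/andP; split; lra.
have l0in : l0 \in `[l1, l0]%R by rewrite in_itv/= l10 lexx.
have abE := ab l0 l0in.
have aE : a l0 = u - 2 * eps by lra.
have bE : b l0 = u by lra.
rewrite -bE; apply: (flow_from_chord eps0 (p := a l0)); first by lra.
have := cand l0 l0in 2^-1; rewrite invr_ge0 ler0n invf_le1// ler1n => /(_ isT).
have -> : free_point eps (b l0 - eps) =
    ((1 - 2^-1) * a l0 + 2^-1 * b l0, (1 - 2^-1) * a l0 ^+ 2 + 2^-1 * b l0 ^+ 2).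
  by rewrite aE bE /free_point; congr (_, _); field.
by move=> ->; field.
Qed.

Lemma chord_candidate_reflect f B p q : chord_candidate f p q B ->
  chord_candidate (f \o -%R) (- q) (- p) (B \o reflect).
Proof.
move=> cand h /andP[h0 h1]; rewrite /= /reflect/= !opprK.
have := cand (1 - h); rewrite subr_ge0 h1 gerBl h0 => /(_ isT).
have -> : 1 - (1 - h) = h by ring.
have -> : - ((1 - h) * - q + h * - p) = h * p + (1 - h) * q by ring.
have -> : (1 - h) * (- q) ^+ 2 + h * (- p) ^+ 2 = h * p ^+ 2 + (1 - h) * q ^+ 2 by ring.
by move=> ->; ring.
Qed.

Lemma chord_reflect p q : reflect @^-1` chord p q = chord (- q) (- p).
Proof.
apply/seteqP; split=> x [h /andP[h0 h1]].
  move=> xE; exists (1 - h); first by rewrite subr_ge0 h1 gerBl.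
  move: xE; rewrite /reflect/= => -[xE1 xE2]; apply: injective_projections => /=.
    by rewrite -[x.1]opprK xE1; ring.
  by rewrite xE2; ring.
move=> ->; exists (1 - h); first by rewrite subr_ge0 h1 gerBl.
by rewrite /reflect/=; congr (_, _); ring.
Qed.

Lemma chord_family_reflect f B a b l1 l0 : chord_family f B a b l1 l0 ->
  chord_family (f \o -%R) (B \o reflect) (fun l => - b l) (fun l => - a l) l1 l0.
Proof.
move=> [len ca cb ab cand]; split=> //.
- by move=> l; apply: continuousN; exact: cb.
- by move=> l; apply: continuousN; exact: ca.
- by move=> l /ab; lra.
- by move=> l /cand /chord_candidate_reflect.
Qed.

Lemma chord_union_reflect a b l1 l0 :
  reflect @^-1` chord_union a b l1 l0 = chord_union (fun l => - b l) (fun l => - a l) l1 l0.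
Proof.
apply/seteqP; split=> x [l ll] h; exists l => //.
  by rewrite -chord_reflect.
by move: h; rewrite -chord_reflect.
Qed.
End StripsAndChords.

(** * Existence of the entering flows *)

Section FlowExistence.
Context {R : realType} (I : finType).
Variables (eps : R) (f : R -> R) (B : R * R -> R) (A : I -> set (R * R)).
Variables (good : I -> Prop) (dem : I -> option R).
Hypothesis eps0 : 0 < eps.
Hypothesis cover : forall x, Omega eps x -> exists2 i, good i & A i x.
Hypothesis disjoint : forall i j, i != j -> (A i)° `&` (A j)° = set0.
Hypothesis figure : forall i, good i -> right_figure eps f B (A i) (dem i).

Lemma positive_lower_bound (T : eqType) (s : seq T) (d : T -> R) :
  (forall i, 0 < d i) -> exists2 e, 0 < e & forall i, i \in s -> e <= d i.
Proof.
move=> d0; elim: s => [|i s [e e0 he]]; first by exists 1.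
exists (Num.min e (d i)); first by rewrite lt_min e0 d0.
move=> j; rewrite inE => /predU1P[->|/he ?]; first by rewrite ge_min lexx orbT.
by rewrite ge_min; apply/orP; left.
Qed.

(* The points just below the free boundary point [u - eps] accumulate in one of
   the finitely many figures. *)
Lemma figure_below u : exists2 j, good j & just_below eps (A j) u.
Proof.
apply: contrapT => no.
have /choice[d hd] : forall j, exists d, 0 < d /\ (good j -> forall h, 0 < h -> h < d ->
    ~ A j (u - eps, (u - eps) ^+ 2 + eps ^+ 2 - h ^+ 2)).
  move=> j; have [gj|ngj] := pselect (good j); last by exists 1; split.
  have nFZ : ~ just_below eps (A j) u by move=> FZ; apply: no; exists j.
  apply: contrapT => nd; apply: nFZ => d d0; apply: contrapT => nh; apply: nd.
  exists d; split=> // _ h h0 hd Ah; apply: nh; exists h; split=> //.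
have [e e0 he] := @positive_lower_bound _ (enum I) d (fun j => (hd j).1).
pose h := Num.min e eps / 2.
have m0 : 0 < Num.min e eps by rewrite lt_min e0.
have h0 : 0 < h by rewrite divr_gt0.
have hm : h < Num.min e eps by rewrite /h; lra.
have := hm; rewrite lt_min => /andP[hle hleps].
have [j gj Aj] := cover (below_Omega u h0 hleps).
by apply: ((hd j).2 gj h h0 _ Aj); apply: lt_le_trans hle (he _ _); rewrite mem_enum.
Qed.

Definition earlier u : {set I} := [set i | if dem i is Some v then v < u else false].

(** Induction on the number of figures entered to the left of [u]. The figure found below u - eps
    differs from [i], whose points have uR x >= u; if it is entered at v < u, it is no longer
    counted at [v]. *)
Lemma flow_exists i u : good i -> dem i = Some u -> right_flow f eps B u.
Proof.
move: {2}#|earlier u|.+1 (ltnSn #|earlier u|) => n.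
elim: n i u => // n IH i u; rewrite ltnS => un gi du.
have [j gj FZ] := figure_below u.
have [fineA uA] := rf_dem (figure gi) du.
have ij : i != j.
  apply/eqP => ij; have [h [h0 _]] := FZ 1 ltr01; rewrite -ij => /uA.
  by rewrite uR_below ?(ltW h0)//; lra.
have [//|[v vu [dv vflow]]|fine'] := rf_step (figure gj) FZ; last first.
  by have [x] := fine_right_interior eps0 fineA fine'; rewrite disjoint.
apply: vflow; apply: (IH j v) => //; apply: leq_trans un.
apply: proper_card; apply/properP; split.
  by apply/fintype.subsetP => k; rewrite !inE; case: (dem k) => // w /lt_trans; apply.
by exists j; rewrite !inE dv// ltxx.
Qed.
End FlowExistence.

(** * Every figure together with its reflection *)

Section Figures.
Context {R : realType}.
Variable eps : R.
Hypothesis eps0 : 0 < eps.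
Implicit Types (f : R -> R) (B : R * R -> R) (x y z : R * R) (u w p q h r l t eta : R).
Implicit Types (A G : set (R * R)) (lm rm : \bar R).

(* [dR] and [dL] are the places where the figure receives a right and, in the
   reflected picture, a left flow. *)
Definition good_figure f B A (dR dL : option R) : Prop :=
  [/\ right_figure eps f B A dR,
      right_figure eps (f \o -%R) (B \o reflect) (reflect @^-1` A) dL
    & (forall u, dR = Some u -> right_flow f eps B u) ->
      (forall u, dL = Some u -> right_flow (f \o -%R) eps (B \o reflect) u) ->
      forall x, A x -> admits_optimizer f eps B x].

Lemma Omega_R_reflect (u1 u2 : \bar R) :
  reflect @^-1` Omega_R eps u1 u2 = Omega_L eps (- u2)%E (- u1)%E.
Proof.
apply/seteqP; split=> x.
  move=> /(Omega_RP eps0)[]; rewrite Omega_reflect uR_reflect => Ox h.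
  by apply/(Omega_LP eps0); rewrite ereal_itv_opp.
move=> /(Omega_LP eps0)[Ox]; rewrite ereal_itv_opp => h.
by apply/(Omega_RP eps0); rewrite Omega_reflect uR_reflect.
Qed.

Lemma Omega_L_reflect (u1 u2 : \bar R) :
  reflect @^-1` Omega_L eps u1 u2 = Omega_R eps (- u2)%E (- u1)%E.
Proof.
apply/seteqP; split=> x.
  move=> /(Omega_LP eps0)[]; rewrite Omega_reflect uL_reflect => Ox h.
  by apply/(Omega_RP eps0); rewrite ereal_itv_opp.
move=> /(Omega_RP eps0)[Ox]; rewrite ereal_itv_opp => h.
by apply/(Omega_LP eps0); rewrite Omega_reflect uL_reflect.
Qed.

(** Reflection sends the upper end of the right tangent at [u] to that of the right tangent at 2 eps
    - u. *)
Lemma continuous_free_value_reflect B : continuous (free_value eps B) ->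
  continuous (free_value eps (B \o reflect)).
Proof.
move=> cB.
have -> : free_value eps (B \o reflect) = free_value eps B \o (fun u => 2 * eps - u).
  apply/funext => u; rewrite /free_value /= /reflect/=; congr B.
  by rewrite /free_point; congr (_, _); ring.
move=> u; apply: continuous_comp; last exact: cB.
by apply: cvgB; [exact: cvg_cst|exact: cvg_id].
Qed.

Lemma tanR_figure f B (u1 u2 : \bar R) : (u1 < u2)%E -> tame eps f ->
  continuous (free_value eps B) -> tanR_candidate f eps u1 u2 B ->
  good_figure f B (Omega_R eps u1 u2) (finite_end u1) None.
Proof.
move=> u12 tf cB cand; have [e ee [df cf' bf bf']] := tf.
have st := tanR_weak_strip eps0 ee df cf' bf bf' u12 (tanR_candidate_weak cand).
split.
- exact: right_strip_figure.
- by rewrite Omega_R_reflect; exact: left_strip_figure.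
- move=> flow _ x; apply: (right_strip_optimizer eps0 tf cB st) => r u1E.
  by apply: flow; rewrite u1E.
Qed.

Lemma tanL_figure f B (u1 u2 : \bar R) : (u1 < u2)%E -> tame eps f ->
  continuous (free_value eps B) -> tanL_candidate f eps u1 u2 B ->
  good_figure f B (Omega_L eps u1 u2) None (finite_end (- u2)%E).
Proof.
move=> u12 tf cB cand; have tf' := tame_oppr tf; have [e ee [df cf' bf bf']] := tf'.
have u12' : (- u2 < - u1)%E by rewrite lteN2.
have cB' := continuous_free_value_reflect cB.
have st := tanR_weak_strip eps0 ee df cf' bf bf' u12' (tanL_candidate_weak eps0 tf cand).
split.
- exact: left_strip_figure.
- by rewrite Omega_L_reflect; exact: right_strip_figure.
- move=> _ flow x; apply: (left_strip_optimizer eps0 tf cB' st) => r u2E.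
  by apply: flow; rewrite u2E.
Qed.

Lemma chord_union_figure f B a b l1 l0 : chord_family eps f B a b l1 l0 ->
  good_figure f B (chord_union a b l1 l0) None None.
Proof.
move=> cf; have [[l1_ge0 _ l0e] _ _ ab cand] := cf; split.
- exact: chord_family_figure cf.
- by rewrite chord_union_reflect; exact: chord_family_figure (chord_family_reflect cf).
- move=> _ _ x [l ll]; have lin : l \in `[l1, l0]%R by rewrite in_itv.
  have abl := ab l lin; have /andP[? ?] := ll.
  by apply: chord_optimizer => //; [lra|lra|exact: cand].
Qed.

Lemma chord_figure f B p q : p <= q -> q - p <= 2 * eps -> chord_candidate f p q B ->
  good_figure f B (chord p q) None None.
Proof.
move=> pq qp cand; have -> : chord p q = chord_union (cst p) (cst q) (q - p) (q - p).
  apply/seteqP; split=> [x h|x [l _] //]; exists (q - p) => //; exact/andP.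
apply: chord_union_figure; split.
- by rewrite subr_ge0.
- by apply: continuous_subspaceT => ?; exact: cvg_cst.
- by apply: continuous_subspaceT => ?; exact: cvg_cst.
- by move=> l; rewrite in_itv/= => /le_anti.
- by [].
Qed.

Definition mirror (k : lin_kind) : lin_kind := match k with
  | RightMultitrolleybus => LeftMultitrolleybus
  | LeftMultitrolleybus => RightMultitrolleybus
  | _ => k end.

Lemma lin_side_reflect k lm rm x :
  lin_side eps (mirror k) (- rm)%E (- lm)%E x <-> lin_side eps k lm rm (reflect x).
Proof.
case: k; rewrite /lin_side/= ?uR_reflect ?uL_reflect ?ereal_itv_opp//.
- by rewrite !EFinN leeNl leeNr; split=> -[].
- by rewrite !EFinN leeNl leeNr; split=> -[].
- by rewrite /below_chord/= !fineN; split; lra.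
Qed.

Lemma lin_kind_frame_reflect k lm rm G A : lin_kind_frame eps lm rm G A k ->
  lin_kind_frame eps (- rm)%E (- lm)%E (reflect @^-1` G) (reflect @^-1` A) (mirror k).
Proof.
move=> AE x; split.
  move=> /AE[Ox Gx sx]; split=> //; first by rewrite -Omega_reflect.
  exact/lin_side_reflect.
by move=> [Ox Gx /lin_side_reflect sx]; apply/AE; split=> //; rewrite Omega_reflect.
Qed.

Definition lin_ends (k : lin_kind) lm rm : Prop := match k with
  | RightMultitrolleybus => (exists l, lm = l%:E) /\ (lm < rm)%E
  | LeftMultitrolleybus => (exists r, rm = r%:E) /\ (lm < rm)%E
  | Multicup => (lm + (2 * eps)%:E <= rm)%E
  | Multibirdie => (exists l, lm = l%:E) /\ (exists r, rm = r%:E)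
  | ClosedMulticup => exists l r, [/\ lm = l%:E, rm = r%:E & r - l < 2 * eps]
  end.

(** [dR] is the left end when a right tangent bounds the domain there, [dL] the negated right end
    when a left tangent does. *)
Lemma linearity_figure f B D lm rm G b0 b1 b2 A k :
  lin_frame eps f B D lm rm G b0 b1 b2 A -> (lm <= rm)%E ->
  lin_kind_frame eps lm rm G A k -> lin_ends k lm rm ->
  exists dR dL, good_figure f B A dR dL.
Proof.
move=> fr lr AE; have fr' := lin_frame_reflect fr.
have lr' : (- rm <= - lm)%E by rewrite leeN2.
have AE' := lin_kind_frame_reflect AE.
case: k AE AE' => AE AE' /=.
- move=> [[l lE] lr2]; exists (Some l), None; split.
  + exact: (right_multitrolleybus_figure eps0 fr lr AE lE lr2).
  + exact: (left_multitrolleybus_figure fr' AE').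
  + move=> flow _ x; apply: (right_multitrolleybus_optimizer eps0 fr lr AE) => l'.
    by rewrite lE => -[<-]; exact: flow.
- move=> [[r rE] lr2]; exists None, (Some (- r)); split.
  + exact: (left_multitrolleybus_figure fr AE).
  + apply: (right_multitrolleybus_figure eps0 fr' lr' AE'); first by rewrite rE.
    by rewrite lteN2.
  + move=> _ flow x; apply: (left_multitrolleybus_optimizer eps0 fr lr AE) => l'.
    by rewrite rE => -[<-]; exact: flow.
- move=> lr2; exists None, None; split.
  + exact: (multicup_figure eps0 fr lr AE).
  + exact: (multicup_figure eps0 fr' lr' AE').
  + by move=> _ _ x; exact: (multicup_optimizer eps0 fr AE lr2).
- move=> [[l lE] [r rE]]; exists (Some l), (Some (- r)); split.
  + exact: (multibirdie_figure eps0 fr lr AE lE).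
  + by apply: (multibirdie_figure eps0 fr' lr' AE'); rewrite rE.
  + move=> flow flow' x; apply: (multibirdie_optimizer eps0 fr lr AE) => l'.
      by rewrite lE => -[<-]; exact: flow.
    by rewrite rE => -[<-]; exact: flow'.
- move=> [l [r [lE rE lr2]]]; exists None, None; split.
  + exact: (closed_multicup_figure eps0 _ _ lr AE lE rE lr2).
  + apply: (closed_multicup_figure eps0 _ _ lr' AE' (l := - r) (r := - l)).
    * by rewrite rE.
    * by rewrite lE.
    * by lra.
  + by move=> _ _ x; exact: (closed_multicup_optimizer eps0 fr lr AE lE rE (ltW lr2)).
Qed.

Lemma above_chord_refl p x : Omega eps x -> above_chord p p x.
Proof. move=> /andP[h _]; rewrite /above_chord/=; have := sqr_ge0 (x.1 - p); lra. Qed.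

(** An angle is treated as a multibirdie whose two ends coincide at [w], without gaps. *)
Lemma angle_figure f B w :
  affine_candidate f [set w] (Omega_R eps w%:E +oo%E `&` Omega_L eps -oo%E w%:E) B ->
  exists dR dL, good_figure f B (Omega_R eps w%:E +oo%E `&` Omega_L eps -oo%E w%:E) dR dL.
Proof.
move=> [b0 [b1 [b2 [fw BA]]]].
apply: (@linearity_figure f B [set w] w%:E w%:E (Omega eps) b0 b1 b2 _ Multibirdie) => //.
- split.
  + move=> u /le_anti[<-]; exists w, w; split=> //; split; last by move=> x; exact: above_chord_refl.
    by rewrite subrr mulr_ge0// ltW.
  + by move=> t ->; rewrite lexx.
  + by move=> t /fw[-> _].
  + by move=> x Ax; apply: BA; rewrite inE.
  + by move=> x [/(Omega_RP eps0)[Ox _] _].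
  + by exists [::] => w' _; exists 1.
  + by move=> w'; exact: Omega_free_point.
- move=> x; split.
    by move=> [/(Omega_RP eps0)[Ox /andP[h1 _]] /(Omega_LP eps0)[_ /andP[_ h2]]].
  by move=> [Ox _ [h1 h2]]; split;
    [apply/(Omega_RP eps0); rewrite h1 leey|apply/(Omega_LP eps0); rewrite h2 leNye].
- by split; exists w.
Qed.
End Figures.

Section LinearityIntervals.
Context {R : realType}.
Variables (eps : R) (k : lin_kind) (s : seq (\bar R * \bar R)).
Hypothesis eps0 : 0 < eps.
Hypothesis ok : lin_ok eps k s.
Implicit Types (u w : R) (x : R * R).

Let size_s : (0 < size s)%N.
Proof. by have [[s0 _ _] _] := ok; rewrite lt0n size_eq0. Qed.

Let ivl_le i : (i < size s)%N -> ((ivl s i).1 <= (ivl s i).2)%E.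
Proof. by move=> si; have [[_ h _] _] := ok; have [] := h i si. Qed.

Let ivl_gap i : (i.+1 < size s)%N -> exists r l : R,
  [/\ (ivl s i).2 = r%:E, (ivl s i.+1).1 = l%:E & 0 < l - r <= 2 * eps].
Proof. by move=> si; have [[_ _ h] _] := ok; exact: h. Qed.

Let ivl_gap_lt i : (i.+1 < size s)%N -> ((ivl s i).2 <= (ivl s i.+1).1)%E.
Proof.
by move=> /ivl_gap[r [l [-> -> /andP[h _]]]]; rewrite lee_fin; lra.
Qed.

Let leftmost_le i : (i < size s)%N -> (leftmost s <= (ivl s i).1)%E.
Proof.
elim: i => [|i IH] si; first exact: lexx.
apply: le_trans (IH (ltnW si)) _; apply: le_trans (ivl_le (ltnW si)) _.
exact: ivl_gap_lt.
Qed.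

Let rightmost_ge i : (i < size s)%N -> ((ivl s i).2 <= rightmost s)%E.
Proof.
rewrite /rightmost => si.
have : forall j, (i + j < size s)%N -> ((ivl s i).2 <= (ivl s (i + j)).2)%E.
  elim=> [|j IH]; first by rewrite addn0.
  rewrite addnS => sj; apply: le_trans (IH (ltnW sj)) _.
  by apply: le_trans (ivl_gap_lt sj) _; exact: ivl_le.
move=> /(_ ((size s).-1 - i)%N); rewrite subnKC; last by rewrite -ltnS prednK.
by apply; rewrite prednK.
Qed.

(** A point of an interval is bracketed by itself; its degenerate chord is the tangent of the
    parabola, which points of Omega lie above. *)
Let bracket u : (leftmost s <= u%:E <= rightmost s)%E -> exists p q,
  [/\ fixed_boundary s p, fixed_boundary s q, p <= u, u <= q & q - p <= 2 * eps /\
    forall x, (above_gaps s `&` Omega eps) x -> above_chord p q x].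
Proof.
move=> /andP[lu ur].
pose P i := (i < size s)%N && ((ivl s i).1 <= u%:E)%E.
have exP : exists i, P i by exists 0%N; rewrite /P size_s.
have ubP i : P i -> (i <= size s)%N by move=> /andP[/ltnW].
(* The last interval starting at or before [u]: the point lies in it or in the gap after it. *)
have [i /andP[si iu] maxi] := ex_maxnP exP ubP.
have [ui|iu'] := leP u%:E (ivl s i).2.
  have Du : fixed_boundary s u by exists i; rewrite ?iu.
  exists u, u; split=> //; split; first by rewrite subrr mulr_ge0// ltW.
  by move=> x [_ Ox]; exact: above_chord_refl Ox.
have si' : (i.+1 < size s)%N.
  rewrite ltn_neqAle si andbT; apply/eqP => iE.
  by move: ur; rewrite /rightmost -iE /= leNgt iu'.
have [r [l [rE lE /andP[rl lr]]]] := ivl_gap si'.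
exists r, l; split.
- by exists i => //; rewrite -rE lexx andbT ivl_le.
- by exists i.+1 => //; rewrite -lE lexx ivl_le.
- by move: iu'; rewrite rE lte_fin => /ltW.
- rewrite leNgt; apply/negP => lu'; have := maxi i.+1.
  by rewrite /P si' lE lee_fin ltW// ltnn => /(_ isT).
- by split=> // x [ag _]; have := ag i si'; rewrite rE lE.
Qed.

Let near_gaps : exists M : seq R, forall w, w \notin M ->
  near_arc eps w (above_gaps s `&` Omega eps).
Proof.
pose mid i := (fine (ivl s i).2 + fine (ivl s i.+1).1) / 2.
(* The last index reads the default interval, which only adds a harmless exception. *)
exists [seq mid i | i <- iota 0 (size s)] => w wM.
have near n : near_arc eps w [set x | forall i, (i < n)%N -> (i.+1 < size s)%N ->
    above_chord (fine (ivl s i).2) (fine (ivl s i.+1).1) x].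
  elim: n => [|n IH]; first by exists 1.
  have [sn|ns] := ltnP n.+1 (size s); last first.
    apply: near_arcS IH => x Ox h i; rewrite ltnS leq_eqVlt => /predU1P[->|/h//].
    by rewrite ltnNge ns.
  have [r [l [rE lE /andP[rl lr]]]] := ivl_gap sn.
  have wm : w != (r + l) / 2.
    apply: contra wM => /eqP ->; apply/mapP; exists n; last by rewrite /mid rE lE.
    by rewrite mem_iota add0n/=; exact: ltnW.
  have rl' : r <= l by lra.
  apply: near_arcS (near_arcI IH (near_arc_above_chord eps0 lr rl' wm)) => x Ox [h hn] i.
  by rewrite ltnS leq_eqVlt => /predU1P[->|/h//]; rewrite rE lE.
apply: near_arcS (near (size s)) => x Ox h; split=> // i si.
by apply: h => //; exact: ltnW.
Qed.

Lemma linearity_domain_figure (f : R -> R) (B : R * R -> R) :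
  affine_candidate f (fixed_boundary s) (lin_region eps k s) B ->
  exists dR dL, good_figure eps f B (lin_region eps k s) dR dL.
Proof.
move=> [b0 [b1 [b2 [fD BA]]]].
have [_ [[lray rray lr mc cm] _]] := ok.
have lmN : leftmost s != +oo%E by have [[_ h _] _] := ok; have [] := h _ size_s.
have rmN : rightmost s != -oo%E.
  have [[_ h _] _] := ok; have [|_ _] := h (size s).-1; last exact.
  by rewrite prednK.
have lfin : ~~ allows_left_ray k -> exists l, leftmost s = l%:E.
  move: lmN lray; case: (leftmost s) => [l _ _ _| |_ /(_ erefl) ->]//; by exists l.
have rfin : ~~ allows_right_ray k -> exists r, rightmost s = r%:E.
  move: rmN rray; case: (rightmost s) => [r _ _ _|_ /(_ erefl) ->|]//; by exists r.
apply: (@linearity_figure _ eps eps0 f B (fixed_boundary s) (leftmost s) (rightmost s)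
  (above_gaps s `&` Omega eps) b0 b1 b2 _ k).
- split.
  + exact: bracket.
  + move=> t [i si /andP[h1 h2]].
    by rewrite (le_trans (leftmost_le si) h1) (le_trans h2 (rightmost_ge si)).
  + by move=> t /fD[-> _].
  + by move=> x Ax; apply: BA; rewrite inE.
  + move=> x [ag]; case: (k) => /=.
    * by move=> /(Omega_RP eps0)[].
    * by move=> /(Omega_LP eps0)[].
    * by move=> [/(Omega_LP eps0)[]].
    * by move=> [/(Omega_RP eps0)[]].
    * by move=> [].
  + exact: near_gaps.
  + move=> w; split; last exact: Omega_free_point.
    move=> i si; have [r [l [-> -> /andP[rl lr2]]]] := ivl_gap si.
    by apply: above_chord_free_point => //=; lra.
- exact: ltW.
- move=> x; rewrite /lin_region /lin_side; case: (k); split.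
  + by move=> [ag /(Omega_RP eps0)[]].
  + by move=> [Ox [ag _] h]; split=> //; apply/(Omega_RP eps0).
  + by move=> [ag /(Omega_LP eps0)[]].
  + by move=> [Ox [ag _] h]; split=> //; apply/(Omega_LP eps0).
  + by move=> [ag [/(Omega_LP eps0)[Ox /andP[h1 _]] /(Omega_RP eps0)[_ /andP[_ h2]]]].
  + move=> [Ox [ag _] [h1 h2]]; split=> //; split.
      by apply/(Omega_LP eps0); rewrite h1 leey.
    by apply/(Omega_RP eps0); rewrite h2 leNye.
  + by move=> [ag [/(Omega_RP eps0)[Ox /andP[h1 _]] /(Omega_LP eps0)[_ /andP[_ h2]]]].
  + move=> [Ox [ag _] [h1 h2]]; split=> //; split.
      by apply/(Omega_RP eps0); rewrite h1 leey.
    by apply/(Omega_LP eps0); rewrite h2 leNye.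
  + by move=> [ag []].
  + by move=> [Ox [ag _] h].
- move: lfin rfin mc cm; case: (k) => /= lfin rfin mc cm.
  + by split=> //; exact: lfin.
  + by split=> //; exact: rfin.
  + exact: mc.
  + by split; [exact: lfin|exact: rfin].
  + have [l lE] := lfin isT; have [r rE] := rfin isT; exists l, r; split=> //.
    by move: (cm erefl); rewrite lE rE -EFinD lte_fin; lra.
Qed.
End LinearityIntervals.

(** Carries disjointness of interiors over to the reflected covering. *)
Lemma interior_reflect {R : realType} (A : set (R * R)) x :
  (reflect @^-1` A)° x -> A° (reflect x).
Proof.
case: x => x1 x2 Ax.
have c1 : - y.1 @[y --> (- x1, x2)] --> - - x1 by apply: cvgN; exact: cvg_fst.
have c2 : y.2 @[y --> (- x1, x2)] --> x2 by exact: cvg_snd.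
have c : reflect y @[y --> (- x1, x2)] --> (x1, x2).
  by rewrite opprK in c1; exact: cvg_pair c1 c2.
have E : reflect @^-1` (reflect @^-1` A) = A.
  by apply/seteqP; split=> y /=; rewrite reflectK.
by rewrite -E; exact: c _ Ax.
Qed.

(** * Assembly over a foliation graph *)

Section GraphFigures.
Context {R : realType}.
Variables (f : R -> R) (eps : R) (Gamma : foliation_graph R) (B : R * R -> R).
Hypothesis eps0 : 0 < eps.
Hypothesis tf : tame eps f.
Hypothesis graph : is_foliation_graph f eps Gamma.
Hypothesis gen : generates f eps Gamma B.

Let cB : continuous (free_value eps B).
Proof. by have [cB _ _] := gen; apply: continuous_free_value => //; exact: ltW. Qed.

Lemma edge_good_figure (e : edge Gamma) :
  exists dR dL, good_figure eps f B (edge_region eps (efig e)) dR dL.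
Proof.
have [_ _ _ /(_ e) eok _] := graph; have [_ _ /(_ e) cand] := gen.
case: (efig e) eok cand => [u1 u2|u1 u2|a b a0 b0 a1 b1] /= eok cand.
- by exists (finite_end u1), None; exact: tanR_figure.
- by exists None, (finite_end (- u2)%E); exact: tanL_figure.
- exists None, None; have [[a01 ab1 b10 l0e] [[ca cb _ abl] _]] := eok.
  apply: (@chord_union_figure _ eps eps0 f B a b (b1 - a1) (b0 - a0)); split=> //.
  + by split=> //; lra.
  + by move=> l ll; apply: abl; rewrite inE.
Qed.

Definition tangent_vertex (v : vertex_figure R) : bool :=
  match v with TangentR _ | TangentL _ => true | _ => false end.

Lemma long_chord_le (a b : R) : long_chord_attached eps Gamma a b ->
  a <= b /\ b - a <= 2 * eps.
Proof. by move=> [ab _ _ _]; have := eps0; split; lra. Qed.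

Lemma vertex_good_figure (v : vertex Gamma) : ~~ tangent_vertex (vfig v) ->
  exists dR dL, good_figure eps f B (vertex_region eps (vfig v)) dR dL.
Proof.
have [_ _ _ eok /(_ v) vok] := graph; have [_ /(_ v) cand _] := gen.
case: (vfig v) vok cand => [k s|w|a b|c|a b| | |w|w]//= vok cand _.
- exact: linearity_domain_figure.
- exact: angle_figure.
- have [ab abe] := long_chord_le vok.1.
  by exists None, None; exact: chord_figure.
(* The origin of a cup is the degenerate chord from [c] to itself. *)
- exists None, None; have -> : [set parab c] = chord c c.
    apply/seteqP; split=> [_ ->|_ [h _ ->]]/=.
      exists 0; first by rewrite lexx ler01.
      by rewrite /parab/=; congr (_, _); ring.
    by rewrite /parab; congr (_, _); ring.
  apply: chord_figure => //; first by rewrite subrr mulr_ge0// ltW.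
  move=> h _; rewrite -[RHS]mul1r -cand.
  have -> : ((1 - h) * c + h * c, (1 - h) * c ^+ 2 + h * c ^+ 2) = parab c.
    by rewrite /parab; congr (_, _); ring.
  by rewrite cand; ring.
- have [ab abe] : a <= b /\ b - a <= 2 * eps.
    case: vok => [[ab [e [_ [eE _]]]]|[/long_chord_le]//].
    have := eok e; case: (efig e) eE => [//|//|a' b' a0 b0 a1 b1 /= [<- <-]].
    by move=> [[? ? ? ?] _]; split; lra.
  by exists None, None; exact: chord_figure.
- exists None, None; split=> //.
  + by split=> // u /(_ 1 ltr01)[h []].
  + by split=> // u /(_ 1 ltr01)[h []].
- exists None, None; split=> //.
  + by split=> // u /(_ 1 ltr01)[h []].
  + by split=> // u /(_ 1 ltr01)[h []].
Qed.

Definition proper_figure (i : vertex Gamma + edge Gamma) : Prop :=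
  if i is inl v then ~~ tangent_vertex (vfig v) else True.

(* A single tangent belongs to the tangent domains that it separates. *)
Lemma proper_cover x : Omega eps x ->
  exists2 i, proper_figure i & figure_region eps i x.
Proof.
move=> Ox; have [_ [cov _] _ _ vok] := graph.
move: Ox; rewrite -cov => -[[v|e] _ ix]; last by exists (inr e).
have [tv|ntv] := boolP (tangent_vertex (vfig v)); last by exists (inl v).
move: ix (vok v) tv => /=.
case: (vfig v) => //= w xw [e [_ [u1 [_ [eE _]]]]] _; exists (inr e) => //=; rewrite eE.
- by exists w => //; have [_ _ _ /(_ e) eok _] := graph; move: eok; rewrite eE/= => /ltW ->; rewrite lexx.
- by exists w => //; have [_ _ _ /(_ e) eok _] := graph; move: eok; rewrite eE/= => /ltW ->; rewrite lexx.
Qed.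

(** Right flows come from the covering itself, left flows from the same argument for its
    reflection. *)
Lemma graph_optimizers x : Omega eps x -> admits_optimizer f eps B x.
Proof.
have /choice[d hd] : forall i : vertex Gamma + edge Gamma, exists d : option R * option R,
    proper_figure i -> good_figure eps f B (figure_region eps i) d.1 d.2.
  case=> [v|e] /=.
    have [tv|/vertex_good_figure[dR [dL h]]] := boolP (tangent_vertex (vfig v)).
      by exists (None, None).
    by exists (dR, dL).
  by have [dR [dL h]] := edge_good_figure e; exists (dR, dL).
have [_ [_ disj] _ _ _] := graph.
move=> Ox; have [i pi ix] := proper_cover Ox.
have [_ _ opt] := hd i pi; apply: opt ix => u du.
- apply: (flow_exists eps0 proper_cover disj (dem := fun i => (d i).1) _ pi du).
  by move=> j /hd[].
- apply: (@flow_exists _ _ eps (f \o -%R) (B \o reflect)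
    (fun i => reflect @^-1` figure_region eps i) proper_figure (fun i => (d i).2)
    eps0 _ _ _ i u pi du).
  + by move=> y; rewrite -Omega_reflect => /proper_cover.
  + move=> j l /disj jl; apply/seteqP; split=> // y [/interior_reflect yj /interior_reflect yl].
    by have : set0 (reflect y) by rewrite -jl.
  + by move=> j /hd[].
Qed.
End GraphFigures.

Theorem theorem5p3p1 (R : realType) (f : R -> R) (epsoo eps : R)
    (Gamma : foliation_graph R) (B : R * R -> R) :
  0 < epsoo ->
  regularity_condition f ->
  summability_condition epsoo f ->
  0 < eps -> eps < epsoo ->
  admissible f eps Gamma ->
  generates f eps Gamma B ->
  forall x, Omega eps x -> admits_optimizer f eps B x.
Proof.
move=> epsoo0 reg sum eps0 epsle [graph _] gen x.
exact: graph_optimizers eps0 (regular_tame epsoo0 eps0 epsle reg sum) graph gen x.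
Qed.
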